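(* Let $n\ge 1$ and let $y,w\in S_n$. Then $y\underset{L}{\sim}w$ (that is, $y$ and $w$ lie in the same left cell) if and only if $Q(y)=Q(w)$.
   Context: **Permutations.** $S_n$ is the group of bijections of $\{1,\dots,n\}$ with composition of maps as product. Write $w_i=w(i)$ and identify $w$ with the word $w_1\cdots w_n$. Let $s_i=(i,i+1)$, $1\le i\le n-1$; $l(w)$ is the length of a reduced expression of $w$ in the $s_i$, and $\le$ is the Bruhat order ($y\le w$ iff $y$ is a product of a subword of a reduced expression of $w$). Put $\mathcal{L}(w)=\{s_j \mid s_jw<w\}$. **P- and Q-symbols.** Tableaux have rows weakly increasing from left to right and columns strictly increasing from top to bottom (column strict semi-standard tableaux). For such a tableau $T$ and a natural number $k$, the row insertion $T\leftarrow k$ is defined as follows. Put $k_1=k$. For $i=1,2,\dots$: if $k_i$ is greater than or equal to all entries of the $i$th row, put a new cell with entry $k_i$ at the end of the $i$th row and stop; otherwise, replace by $k_i$ the leftmost entry of the $i$th row which is greater than $k_i$, let $k_{i+1}$ be the replaced entry, and go on to row $i+1$. For $w\in S_n$, $P(w)=(\cdots((\emptyset\leftarrow w_1)\leftarrow w_2)\cdots)\leftarrow w_n$ and $Q(w)=P(w^{-1})$. **Kazhdan-Lusztig polynomials.** Let $\mathcal{H}_n$ be the algebra over $\mathbb{Q}(q^{1/2})$ with generators $T_1,\dots,T_{n-1}$ and relations $(T_i-q)(T_i+1)=0$, $T_iT_{i+1}T_i=T_{i+1}T_iT_{i+1}$, $T_iT_j=T_jT_i$ $(j\ge i+2)$.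 For a reduced expression $w=s_{i_1}\cdots s_{i_r}$ put $T_w=T_{i_1}\cdots T_{i_r}$; this does not depend on the reduced expression and $\{T_w\}_{w\in S_n}$ is a basis. The Kazhdan-Lusztig polynomials $P_{y,w}(q)\in\mathbb{Z}[q]$ $(y\le w)$ are uniquely determined by $$C_w:=\sum_{y\le w}(-1)^{l(w)-l(y)}q^{\frac{l(w)}{2}-l(y)}P_{y,w}(q^{-1})T_y=\sum_{y\le w}(-1)^{l(w)-l(y)}q^{-\frac{l(w)}{2}+l(y)}P_{y,w}(q)T_{y^{-1}}^{-1}$$ for all $w$, together with $P_{w,w}(q)=1$ and $\deg P_{y,w}(q)\le\frac{l(w)-l(y)-1}{2}$ for $y<w$. For $y<w$ with $\frac{l(w)-l(y)-1}{2}$ an integer, $\mu(y,w)$ is the coefficient of $q^{\frac{l(w)-l(y)-1}{2}}$ in $P_{y,w}(q)$; otherwise $\mu(y,w)=0$. We write $\mu(y|w)\ne0$ if either $y<w$ and $\mu(y,w)\ne0$, or $y>w$ and $\mu(w,y)\ne0$. **Left cells.** Write $y\underset{L}{\le}w$ if there is a sequence $y=x_1,x_2,\dots,x_r=w$ $(r\ge1)$ such that $\mathcal{L}(x_i)\not\subset\mathcal{L}(x_{i+1})$ and $\mu(x_i|x_{i+1})\ne0$ for $1\le i<r$. Write $y\underset{L}{\sim}w$ if both $y\underset{L}{\le}w$ and $w\underset{L}{\le}y$. The equivalence classes of $\underset{L}{\sim}$ are the left cells. *)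

(* Defs.v *)
From HB Require Import structures.
From mathcomp Require Import all_boot all_order all_fingroup all_algebra.
From mathcomp Require Import boolp classical_sets.

Set Implicit Arguments.
Unset Strict Implicit.
Unset Printing Implicit Defensive.

Import GRing.Theory.
Local Open Scope quotient_scope.
Local Open Scope ring_scope.

(* Letters are the elements of 'I_n (0-based); the n.-1 simple transpositions
   are indexed by 'I_n.-1. *)
Section Permutations.
Variable n : nat.
Implicit Types (w x y : 'S_n) (u : seq 'I_n.-1).

Lemma pred_ord_lt (i : 'I_n.-1) : (i < n)%N.
Proof. by apply: ltnW; rewrite -ltn_predRL. Qed.

Lemma pred_ord_ltS (i : 'I_n.-1) : (i.+1 < n)%N.
Proof. by rewrite -ltn_predRL. Qed.

Definition simple_refl (i : 'I_n.-1) : 'S_n :=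
  tperm (Ordinal (pred_ord_lt i)) (Ordinal (pred_ord_ltS i)).

(* MathComp's group law on permutations composes from left to right,
   (x * y)%g i = y (x i); the product used here is the composition of maps,
   pmul x y i = x (y i). *)
Definition pmul x y : 'S_n := (y * x)%g.

Definition word_prod u : 'S_n :=
  foldr (fun i x => pmul (simple_refl i) x) 1%g u.

Lemma word_prod_cat u v : word_prod (u ++ v) = (word_prod v * word_prod u)%g.
Proof. by elim: u => /= [|i u ->]; rewrite ?mulg1 // /pmul mulgA. Qed.

Lemma tperm_word (a b : 'I_n) : exists u, word_prod u = tperm a b.
Proof.
wlog ab : a b / (a <= b)%N.
  by move=> H; case: (leqP a b) => [/H//|/ltnW /H]; rewrite tpermC.
have [d] : exists d, (b - a = d)%N by eexists.
elim: d b ab => [|d IHd] b ab dE.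
  have -> : a = b by apply/val_inj/eqP; rewrite eqn_leq ab -subn_eq0 dE.
  by exists [::]; rewrite tperm1.
have altb : (a < b)%N by rewrite -subn_gt0 dE.
have b_gt0 : (0 < b)%N by apply: leq_ltn_trans altb.
have ltj : (b.-1 < n.-1)%N by rewrite ltn_predRL prednK.
pose j := Ordinal ltj; pose c := Ordinal (pred_ord_lt j).
have sjE : simple_refl j = tperm c b.
  by congr tperm; apply: val_inj; rewrite /= ?prednK.
have ac : (a <= c)%N by rewrite /= -ltnS prednK.
have [|u uE] := IHd c ac; first by rewrite /= -subn1 subnAC dE subn1.
have [acE|nac] := eqVneq a c; first by exists [:: j]; rewrite /= /pmul mul1g sjE acE.
exists (j :: u ++ [:: j]); rewrite /= /pmul word_prod_cat /= /pmul mul1g uE sjE.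
rewrite -{1}[tperm c b]tpermV -mulgA -conjgE tpermJ tpermL tpermD //.
  by rewrite eq_sym.
by rewrite eq_sym neq_ltn altb.
Qed.

Lemma word_prod_surj w : exists u, word_prod u = w.
Proof.
have [ts -> _] := prod_tpermP w.
elim: ts => [|t ts [u uE]]; first by exists [::]; rewrite big_nil.
have [v vE] := tperm_word t.1 t.2.
by exists (u ++ v); rewrite big_cons word_prod_cat uE vE.
Qed.

Lemma word_of_size_ex w :
  exists k, [exists t : k.-tuple 'I_n.-1, word_prod t == w].
Proof.
have [u uE] := word_prod_surj w; exists (size u).
by apply/existsP; exists (in_tuple u); apply/eqP.
Qed.

Definition perm_len w : nat := ex_minn (word_of_size_ex w).

Definition reduced_expr w : pred ((perm_len w).-tuple 'I_n.-1) :=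
  fun t => word_prod t == w.

Lemma reduced_expr_ex w : exists t, reduced_expr (w := w) t.
Proof. by apply/existsP; rewrite /reduced_expr /perm_len; case: ex_minnP. Qed.

Definition bruhat_le y w : bool :=
  [exists t : (perm_len w).-tuple 'I_n.-1, reduced_expr t &&
    [exists m : (perm_len w).-tuple bool, word_prod (mask m t) == y]].

Definition bruhat_lt y w : bool := (y != w) && bruhat_le y w.

Definition left_descents w : {set 'S_n} :=
  [set simple_refl j | j : 'I_n.-1 & bruhat_lt (pmul (simple_refl j) w) w].

End Permutations.

(* The rows of a tableau, listed from top to bottom. *)
Definition tableau := seq (seq nat).

Fixpoint row_insert (T : tableau) (k : nat) : tableau :=
  match T with
  | [::] => [:: [:: k]]
  | r :: T' =>
      if all (fun x => x <= k)%N r then rcons r k :: T'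
      else let j := find (fun x => k < x)%N r in
           set_nth 0%N r j k :: row_insert T' (nth 0%N r j)
  end.

(* The + 1 turns the 0-based letters into the letters 1, ..., n. *)
Definition P_symbol n (w : 'S_n) : tableau :=
  foldl row_insert [::] [seq (w i : nat).+1 | i <- enum 'I_n].

Definition Q_symbol n (w : 'S_n) : tableau := P_symbol (w^-1)%g.

(* Q(q^{1/2}) is the field of rational functions in the variable hv = q^{1/2}. *)
Definition heckeK := {fraction {poly rat}}.
Definition hv : heckeK := tofrac 'X.
Definition hq : heckeK := hv ^+ 2.

(* The Hecke algebra is the presented algebra: terms over the generators,
   modulo the least congruence containing the axioms of unital associative
   heckeK-algebras and the defining relations.  The scalar multiple of x by c
   is represented by the term HMul (HCst c) x. *)
Inductive hterm (n : nat) : Type :=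
| HCst of heckeK
| HGen of 'I_n.-1
| HAdd of hterm n & hterm n
| HMul of hterm n & hterm n.
Arguments HCst {n}.

HB.instance Definition _ n := gen_eqMixin (hterm n).
HB.instance Definition _ n := gen_choiceMixin (hterm n).

Inductive heq (n : nat) : hterm n -> hterm n -> Prop :=
| heq_refl x : heq x x
| heq_sym x y : heq x y -> heq y x
| heq_trans x y z : heq x y -> heq y z -> heq x z
| heq_add x x' y y' : heq x x' -> heq y y' -> heq (HAdd x y) (HAdd x' y')
| heq_mul x x' y y' : heq x x' -> heq y y' -> heq (HMul x y) (HMul x' y')
| heq_addA x y z : heq (HAdd x (HAdd y z)) (HAdd (HAdd x y) z)
| heq_addC x y : heq (HAdd x y) (HAdd y x)
| heq_add0 x : heq (HAdd (HCst 0) x) x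
| heq_addN x : heq (HAdd (HMul (HCst (-1)) x) x) (HCst 0)
| heq_mulA x y z : heq (HMul x (HMul y z)) (HMul (HMul x y) z)
| heq_mul1 x : heq (HMul (HCst 1) x) x
| heq_mulDl x y z : heq (HMul (HAdd x y) z) (HAdd (HMul x z) (HMul y z))
| heq_mulDr x y z : heq (HMul x (HAdd y z)) (HAdd (HMul x y) (HMul x z))
| heq_cstD a b : heq (HCst (a + b)) (HAdd (HCst a) (HCst b))
| heq_cstM a b : heq (HCst (a * b)) (HMul (HCst a) (HCst b))
| heq_cstC a x : heq (HMul (HCst a) x) (HMul x (HCst a))
| heq_quad i : heq (HMul (HAdd (HGen i) (HCst (- hq))) (HAdd (HGen i) (HCst 1)))
                   (HCst 0)
| heq_braid (i j : 'I_n.-1) : j = i.+1 :> nat ->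
    heq (HMul (HMul (HGen i) (HGen j)) (HGen i))
        (HMul (HMul (HGen j) (HGen i)) (HGen j))
| heq_comm (i j : 'I_n.-1) : (i.+2 <= j)%N ->
    heq (HMul (HGen i) (HGen j)) (HMul (HGen j) (HGen i)).

Section HeckeAlgebra.
Variable n : nat.
Implicit Types x y z : hterm n.

Definition heqb : rel (hterm n) := fun x y => `[< heq x y >].

Lemma heqb_equiv : equiv_class_of heqb.
Proof.
split=> [x|x y|y x z].
- by apply/asboolP; apply: heq_refl.
- by apply/asboolP/asboolP => /heq_sym.
- by move=> /asboolP xy /asboolP yz; apply/asboolP; apply: heq_trans xy yz.
Qed.

Canonical heqb_equiv_rel := EquivRelPack heqb_equiv.

Definition hecke := {eq_quot heqb}.
HB.instance Definition _ := Choice.on hecke.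

Definition hcst (c : heckeK) : hecke := \pi_hecke (HCst c).
Definition hadd (a b : hecke) : hecke :=
  \pi_hecke (HAdd (generic_quotient.repr a) (generic_quotient.repr b)).
Definition hmul (a b : hecke) : hecke :=
  \pi_hecke (HMul (generic_quotient.repr a) (generic_quotient.repr b)).
Definition hopp (a : hecke) : hecke := hmul (hcst (-1)) a.
Definition hscale (c : heckeK) (a : hecke) : hecke := hmul (hcst c) a.

Lemma hpiP x y : heq x y <-> \pi_hecke x = \pi_hecke y.
Proof.
by split=> [xy|/eqmodP/asboolP//]; apply/eqmodP/asboolP.
Qed.

Lemma heq_repr x : heq (generic_quotient.repr (\pi_hecke x)) x.
Proof. by apply/hpiP; rewrite reprK. Qed.

Lemma haddE x y : hadd (\pi_hecke x) (\pi_hecke y) = \pi_hecke (HAdd x y).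
Proof. by apply/hpiP/heq_add; apply: heq_repr. Qed.

Lemma hmulE x y : hmul (\pi_hecke x) (\pi_hecke y) = \pi_hecke (HMul x y).
Proof. by apply/hpiP/heq_mul; apply: heq_repr. Qed.

Lemma hquotW (R : hecke -> Prop) :
  (forall x, R (\pi_hecke x)) -> forall a, R a.
Proof. by move=> Rpi a; rewrite -[a]reprK. Qed.

Lemma haddA : associative hadd.
Proof.
by elim/hquotW=> x; elim/hquotW=> y; elim/hquotW=> z;
  rewrite (haddE y z) (haddE x y) !haddE; apply/hpiP; apply: heq_addA.
Qed.
Lemma haddC : commutative hadd.
Proof.
by elim/hquotW=> x; elim/hquotW=> y;
  rewrite !haddE; apply/hpiP; apply: heq_addC.
Qed.
Lemma hadd0 : left_id (hcst 0) hadd.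
Proof.
by elim/hquotW=> x;
  rewrite /hcst haddE; apply/hpiP; apply: heq_add0.
Qed.
Lemma haddN : left_inverse (hcst 0) hopp hadd.
Proof.
by elim/hquotW=> x;
  rewrite /hopp /hcst hmulE haddE; apply/hpiP; apply: heq_addN.
Qed.

HB.instance Definition _ := GRing.isZmodule.Build hecke haddA haddC hadd0 haddN.

Lemma hmulA : associative hmul.
Proof.
by elim/hquotW=> x; elim/hquotW=> y; elim/hquotW=> z;
  rewrite (hmulE y z) (hmulE x y) !hmulE; apply/hpiP; apply: heq_mulA.
Qed.
Lemma hmul1 : left_id (hcst 1) hmul.
Proof.
by elim/hquotW=> x;
  rewrite /hcst hmulE; apply/hpiP; apply: heq_mul1.
Qed.
Lemma hmulCst c (a : hecke) : hmul (hcst c) a = hmul a (hcst c).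
Proof.
by elim/hquotW: a => x;
  rewrite /hcst !hmulE; apply/hpiP; apply: heq_cstC.
Qed.
Lemma hmul1r : right_id (hcst 1) hmul.
Proof. by move=> a; rewrite -hmulCst hmul1. Qed.
Lemma hmulDl : left_distributive hmul hadd.
Proof.
by elim/hquotW=> x; elim/hquotW=> y; elim/hquotW=> z;
  rewrite (haddE x y) (hmulE x z) (hmulE y z) haddE hmulE; apply/hpiP; apply: heq_mulDl.
Qed.
Lemma hmulDr : right_distributive hmul hadd.
Proof.
by elim/hquotW=> x; elim/hquotW=> y; elim/hquotW=> z;
  rewrite (haddE y z) (hmulE x y) (hmulE x z) haddE hmulE; apply/hpiP; apply: heq_mulDr.
Qed.

(* The character T_i |-> hq, which shows that the presented algebra is
   nonzero. *)
Fixpoint hindex x : heckeK :=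
  match x with
  | HCst c => c
  | HGen _ => hq
  | HAdd x y => hindex x + hindex y
  | HMul x y => hindex x * hindex y
  end.

Lemma heq_hindex x y : heq x y -> hindex x = hindex y.
Proof.
elim=> {x y} //=.
- by move=> x y z _ -> _ ->.
- by move=> x x' y y' _ -> _ ->.
- by move=> x x' y y' _ -> _ ->.
- by move=> x y z; rewrite addrA.
- by move=> x y; rewrite addrC.
- by move=> x; rewrite add0r.
- by move=> x; rewrite mulN1r addNr.
- by move=> x y z; rewrite mulrA.
- by move=> x; rewrite mul1r.
- by move=> x y z; rewrite mulrDl.
- by move=> x y z; rewrite mulrDr.
- by move=> a x; rewrite mulrC.
- by move=> i; rewrite subrr mul0r.
Qed.

Lemma hone_neq0 : hcst 1 != hcst 0.
Proof.
apply/eqP => /hpiP/heq_hindex /= E.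
by have := oner_neq0 heckeK; rewrite E eqxx.
Qed.

HB.instance Definition _ :=
  GRing.Zmodule_isNzRing.Build hecke hmulA hmul1 hmul1r hmulDl hmulDr hone_neq0.

Lemma hcstD a b : hcst (a + b) = hadd (hcst a) (hcst b).
Proof. by rewrite /hcst haddE; apply/hpiP; apply: heq_cstD. Qed.
Lemma hcstM a b : hcst (a * b) = hmul (hcst a) (hcst b).
Proof. by rewrite /hcst hmulE; apply/hpiP; apply: heq_cstM. Qed.

Lemma hscaleA a b (x : hecke) : hscale a (hscale b x) = hscale (a * b) x.
Proof. by rewrite /hscale hcstM hmulA. Qed.
Lemma hscaleDr : right_distributive hscale hadd.
Proof. by move=> a x y; rewrite /hscale hmulDr. Qed.
Lemma hscaleDl (x : hecke) :
  {morph hscale^~ x : a b / a + b >-> a + b}.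
Proof. by move=> a b; rewrite /hscale hcstD hmulDl. Qed.

HB.instance Definition _ := GRing.Zmodule_isLmodule.Build heckeK hecke
  hscaleA hmul1 hscaleDr hscaleDl.

Lemma hscaleAl a (x y : hecke) : a *: (x * y) = a *: x * y.
Proof. exact: hmulA. Qed.
HB.instance Definition _ := GRing.Lmodule_isLalgebra.Build heckeK hecke hscaleAl.

Lemma hscaleAr a (x y : hecke) : a *: (x * y) = x * (a *: y).
Proof.
rewrite -[LHS]/(hmul _ (hmul _ _)) -[RHS]/(hmul _ (hmul _ _)).
by rewrite hmulA hmulCst -hmulA.
Qed.
HB.instance Definition _ := GRing.Lalgebra_isAlgebra.Build heckeK hecke hscaleAr.

Definition hunit : pred hecke :=
  fun x : hecke => `[< exists y : hecke, y * x = 1 /\ x * y = 1 >].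
Definition hinv (x : hecke) : hecke := xget x [set y : hecke | y * x = 1 /\ x * y = 1].

Lemma hinvP (x : hecke) : hunit x -> hinv x * x = 1 /\ x * hinv x = 1.
Proof. by move=> /asboolP[y yP]; rewrite /hinv; case: xgetP => [z _ //|/(_ y)]. Qed.
Lemma hmulV : {in hunit, left_inverse 1 hinv *%R}.
Proof. by move=> x /hinvP[]. Qed.
Lemma hdivV : {in hunit, right_inverse 1 hinv *%R}.
Proof. by move=> x /hinvP[]. Qed.
Lemma hunitP (x y : hecke) : y * x = 1 /\ x * y = 1 -> hunit x.
Proof. by move=> xy; apply/asboolP; exists y. Qed.
Lemma hinv_out : {in [predC hunit], hinv =1 id}.
Proof.
move=> x /= /asboolP xN; rewrite /hinv; case: xgetP => [z _ zP|//].
by case: xN; exists z.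
Qed.

HB.instance Definition _ :=
  GRing.NzRing_hasMulInverse.Build hecke hmulV hdivV hunitP hinv_out.

Definition hT (i : 'I_n.-1) : hecke := \pi_hecke (HGen i).

(* By Matsumoto's theorem, independent of the reduced expression chosen. *)
Definition hTw (w : 'S_n) : hecke :=
  \prod_(i <- xchoose (reduced_expr_ex w)) hT i.

End HeckeAlgebra.

Section KazhdanLusztig.
Variable n : nat.
Implicit Types (w x y : 'S_n) (P : 'S_n -> 'S_n -> {poly int}).

Definition eval_at (p : {poly int}) (c : heckeK) : heckeK :=
  (map_poly intr p).[c].

(* The exponents l(w)/2 - l(y) of q become exponents l(w) - 2 l(y) of hv. *)
Definition half_exp w y : int := (perm_len w)%:Z - (perm_len y).*2%:Z.

Definition C_left P w : hecke n :=
  \sum_(y | bruhat_le y w)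
    ((-1) ^+ (perm_len w - perm_len y) * hv ^ half_exp w y
      * eval_at (P y w) hq^-1) *: hTw y.

Definition C_right P w : hecke n :=
  \sum_(y | bruhat_le y w)
    ((-1) ^+ (perm_len w - perm_len y) * hv ^ (- half_exp w y)
      * eval_at (P y w) hq) *: (hTw (y^-1)%g)^-1.

(* The polynomials P y w only matter for y <= w; they are normalized to 0
   elsewhere, so that the family is unique. *)
Record is_KL_family P : Prop := IsKLFamily {
  KL_supp : forall y w, ~~ bruhat_le y w -> P y w = 0;
  KL_diag : forall w, P w w = 1;
  KL_deg : forall y w, bruhat_lt y w ->
    ((size (P y w)).-1.*2 <= perm_len w - perm_len y - 1)%N;
  KL_bar : forall w, C_left P w = C_right P w
}.

Definition KL_poly : 'S_n -> 'S_n -> {poly int} :=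
  xget (fun _ _ => 0) [set P | is_KL_family P].

(* For y < w, (l(w) - l(y) - 1) / 2 is an integer iff l(w) - l(y) is odd. *)
Definition KL_mu y w : int :=
  if bruhat_lt y w && odd (perm_len w - perm_len y)
  then (KL_poly y w)`_((perm_len w - perm_len y - 1)./2) else 0.

Definition mu_neq0 y w : bool :=
  (bruhat_lt y w && (KL_mu y w != 0)) || (bruhat_lt w y && (KL_mu w y != 0)).

Definition left_step x y : bool :=
  ~~ (left_descents x \subset left_descents y) && mu_neq0 x y.

Definition left_le y w : bool := connect left_step y w.

Definition left_equiv y w : bool := left_le y w && left_le w y.

End KazhdanLusztig.

(* Main.v *)
Require Import Defs.
From HB Require Import structures.
From mathcomp Require Import all_boot all_order all_fingroup all_algebra.
From mathcomp Require Import boolp classical_sets.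
From mathcomp Require Import zify ring.

Set Implicit Arguments.
Unset Strict Implicit.
Unset Printing Implicit Defensive.

(** The theorem compares two equivalence relations on permutations.  One is
    generated by the elementary dual Knuth transformations, which exchange the
    values [c] and [c + 1] when [c - 1] or [c + 2] stands between them in the
    word of the permutation: by Knuth's theorem, applied to inverses, its
    classes are the fibres of the Q-symbol ([lmove_Q_symbol]).  The other is the
    left cell equivalence.

    One inclusion is immediate from the Kazhdan-Lusztig polynomials: a dual
    Knuth transformation goes from [x] to [s x], where the left descent sets of
    [x] and [s x] are incomparable and [mu] is [1], so it is a step of the left
    preorder in both directions ([connect_lmove_equiv]).

    For the other inclusion let [y] and [w] lie in the same left cell.  Left
    cells preserve right descent sets ([left_equiv_rdes]).  Hence a Knuth
    transformation on positions, that is a right star operation, defined on one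
    element of a left cell is defined on all of it, and it maps the left cell
    into a left cell ([left_equiv_star]).  The reason is that multiplication by
    [bH u] on the left commutes with multiplication by [bH j] on the right; one
    well-chosen coefficient of the two products gives
    [mut y w = mut y' w'], where [y'] and [w'] are the images
    ([mut_star_star]).  The same identity shows that right star operations
    respect the dual Knuth equivalence ([connect_lmove_star]), so they can be
    undone at the end ([transport]).

    Knuth transformations lead from [y] to the word obtained by reading the
    columns of the tableau of [y] from bottom to top, one after the other
    ([knuth_eq_columns]).  The same transformations take [w] to a word with the
    same descents, that is, with decreasing runs of the same lengths
    [m_1 >= m_2 >= ..].  Inserting a decreasing run puts its new cells in lower
    and lower rows, so the sum of the row indices of the cells of the tableau of
    [w] is at least the sum of the [m_j (m_j - 1) / 2], which is the
    corresponding sum for [y] ([left_equiv_depth_sum]).  By symmetry the two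
    sums are equal; and equality forces the runs to be the columns of a tableau
    ([col_tab_of_depth_sum]).  Finally, the tableau of the inverse of such a
    column word depends only on the lengths of the columns
    ([ins_inv_colword_shape]), so the two column words have the same Q-symbol.
    They are therefore dual Knuth equivalent, and undoing the star operations
    shows that [y] and [w] are as well ([left_equiv_lmove]).

    The Hecke algebra enters through the generators [hH i = - v^-1 T_i], with
    [v = q ^ (1/2)].  Up to a sign, [C_w] is then the bar invariant element with
    coefficients [v ^ (l w - l y) P_{y,w} (v ^ -2)], which lie in [v Z[v]] for
    [y < w] and whose coefficient of [v] is [mu (y, w)].  Its existence,
    uniqueness and multiplication rules are proved by the usual induction over
    the length.  This rests on the linear independence of the [T_w], which
    comes from an explicit representation, on Matsumoto's theorem, and on the
    fact that the subword order depends only on the permutations compared. *)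

Local Open Scope nat_scope.

(* Splits an arithmetic goal along its innermost equality tests. *)
Ltac split_eqns :=
  repeat match goal with |- context [if ?x == ?y then _ else _] =>
    lazymatch x with
    | context [if _ then _ else _] => fail
    | _ => case: (eqVneq x y) => ?
    end
  end.

(** * Length and descents *)

Section Length.
Variable n : nat.
Implicit Types (w x y z : 'S_n) (u v : seq 'I_n.-1) (i j : 'I_n.-1).

Definition lo i : 'I_n := Ordinal (pred_ord_lt i).
Definition hi i : 'I_n := Ordinal (pred_ord_ltS i).

Definition sl i w : 'S_n := pmul (simple_refl i) w.
Definition sr i w : 'S_n := pmul w (simple_refl i).

(** [i] is a left descent when the value [i + 1] stands before the value [i] in
    the word of [w]. *)
Definition ldes i w : bool := (w^-1%g (hi i) < w^-1%g (lo i)).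
Definition rdes i w : bool := (w (hi i) < w (lo i)).

Definition inv_set w : {set 'I_n * 'I_n} :=
  [set p : 'I_n * 'I_n | (p.1 < p.2) && (w p.2 < w p.1)].
Definition ninv w : nat := #|inv_set w|.

Lemma srefl_val i (a : 'I_n) :
  simple_refl i a = (if a == i :> nat then i.+1
                     else if a == i.+1 :> nat then (i : nat) else a) :> nat.
Proof.
rewrite /simple_refl; case: tpermP => [->|->|/eqP na /eqP nb] /=.
- by rewrite eqxx.
- by rewrite eqxx; case: eqP => //; lia.
- have -> : (a == i :> nat) = false by apply/eqP => E; case/eqP: na; apply: val_inj.
  by have -> : (a == i.+1 :> nat) = false
    by apply/eqP => E; case/eqP: nb; apply: val_inj.
Qed.

Lemma srefl_lo i : simple_refl i (lo i) = hi i.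
Proof. exact: tpermL. Qed.

Lemma srefl_hi i : simple_refl i (hi i) = lo i.
Proof. exact: tpermR. Qed.

Lemma srefl2 i : (simple_refl i * simple_refl i = 1)%g.
Proof. exact: tperm2. Qed.

Lemma srefl_inj : injective (@simple_refl n).
Proof.
move=> i j ij; apply/val_inj => /=.
move/(congr1 (fun s : 'S_n => nat_of_ord (s (lo i)))): ij.
rewrite /= srefl_val /= eqxx srefl_val /=.
by case: eqP => ?; try case: eqP => ?; lia.
Qed.

Lemma slE i w a : sl i w a = simple_refl i (w a).
Proof. by rewrite /sl /pmul permM. Qed.

Lemma srE i w a : sr i w a = w (simple_refl i a).
Proof. by rewrite /sr /pmul permM. Qed.

Lemma sl_inv i w : (sl i w)^-1%g = sr i w^-1%g.
Proof. by rewrite /sl /sr /pmul invMg tpermV. Qed.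

Lemma sr_inv i w : (sr i w)^-1%g = sl i w^-1%g.
Proof. by rewrite /sl /sr /pmul invMg tpermV. Qed.

Lemma slK i : involutive (sl i).
Proof. by move=> w; rewrite /sl /pmul -mulgA srefl2 mulg1. Qed.

Lemma srK i : involutive (sr i).
Proof. by move=> w; rewrite /sr /pmul mulgA srefl2 mul1g. Qed.

Lemma sl_sr i j w : sl i (sr j w) = sr j (sl i w).
Proof. by rewrite /sl /sr /pmul mulgA. Qed.

Lemma ldesV i w : ldes i w^-1%g = rdes i w.
Proof. by rewrite /ldes invgK. Qed.

Lemma rdesV i w : rdes i w^-1%g = ldes i w.
Proof. by []. Qed.

Lemma ldes_sl i w : ldes i (sl i w) = ~~ ldes i w.
Proof.
rewrite /ldes sl_inv !srE srefl_lo srefl_hi -leqNgt ltn_neqAle.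
rewrite -[_ != _]/(w^-1%g (lo i) != w^-1%g (hi i)) (inj_eq perm_inj).
by rewrite -(inj_eq val_inj) /= neq_ltn ltnSn.
Qed.

Lemma rdes_sr i w : rdes i (sr i w) = ~~ rdes i w.
Proof. by rewrite -!ldesV sr_inv ldes_sl. Qed.

(** Exchanging two consecutive values changes the relative order of their two
    positions and of no other pair. *)
Lemma inv_set_sl i w : ~~ ldes i w ->
  inv_set (sl i w) = (w^-1%g (lo i), w^-1%g (hi i)) |: inv_set w.
Proof.
move=> asc; apply/setP => -[a b]; rewrite !inE /= !slE.
have asc' : w^-1%g (lo i) < w^-1%g (hi i) by rewrite -[_ < _]negbK -/(ldes _ _)
  -ldes_sl /ldes sl_inv !srE srefl_lo srefl_hi in asc *; lia.
rewrite xpair_eqE -!(can2_eq (permK w) (permKV w)) -!(inj_eq val_inj) /=.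
rewrite !srefl_val.
have [Ea|na] := eqVneq (w a : nat) i; have [Eb|nb] := eqVneq (w b : nat) i.+1.
- have aE : a = w^-1%g (lo i) by apply: (canRL (permK w)); apply: val_inj.
  have bE : b = w^-1%g (hi i) by apply: (canRL (permK w)); apply: val_inj.
  have ab : a < b by rewrite aE bE.
  by rewrite ab; case: eqP; lia.
- rewrite andbF /=; congr andb.
  by case: eqP; lia.
- by rewrite /=; congr andb; case: eqP; case: eqP; lia.
- rewrite /=; case: (eqVneq (w a : nat) i.+1) => Ea.
    case: (eqVneq (w b : nat) i) => Eb; last by congr andb; lia.
    have aE : a = w^-1%g (hi i) by apply: (canRL (permK w)); apply: val_inj.
    have bE : b = w^-1%g (lo i) by apply: (canRL (permK w)); apply: val_inj.
    have ab : (a < b) = false by rewrite aE bE; lia.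
    by rewrite ab.
  by case: (eqVneq (w b : nat) i) => Eb; congr andb; lia.
Qed.

Lemma ninv_asc i w : ~~ ldes i w -> ninv (sl i w) = (ninv w).+1.
Proof.
move=> asc; rewrite /ninv inv_set_sl // cardsU1 inE /= !permKV /=.
have -> : (i.+1 < i) = false by lia.
by rewrite andbF.
Qed.

Lemma ninv_des i w : ldes i w -> (ninv (sl i w)).+1 = ninv w.
Proof. by move=> d; rewrite -[in RHS](slK i w) (@ninv_asc i (sl i w)) // ldes_sl negbK. Qed.

Lemma ldesE i w : ldes i w = (ninv (sl i w) < ninv w).
Proof.
case: (boolP (ldes i w)) => [/ninv_des <-|/ninv_asc ->]; first by rewrite ltnSn.
by rewrite ltnNge leqnSn.
Qed.

Lemma ninv_sl_le i w : ninv (sl i w) <= (ninv w).+1.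
Proof. by case: (boolP (ldes i w)) => [/ninv_des <-|/ninv_asc ->]; lia. Qed.

Lemma ninv1 : ninv 1%g = 0.
Proof.
apply/eqP; rewrite cards_eq0; apply/eqP/setP => -[a b]; rewrite !inE /= !perm1.
by lia.
Qed.

Lemma word_prod_cons i u : word_prod (i :: u) = sl i (word_prod u).
Proof. by []. Qed.

Lemma ninv_word u : ninv (word_prod u) <= size u.
Proof.
elim: u => [|i u IH]; first by rewrite /= ninv1.
by rewrite word_prod_cons (leq_trans (ninv_sl_le _ _)).
Qed.

Lemma ltn_pred_ord (k : nat) : k.+1 < n -> k < n.-1.
Proof. by lia. Qed.

(** Without a left descent the inverse is strictly increasing, hence the identity:
    an increasing map is above the identity by induction from the bottom and
    below it by induction from the top. *)
Lemma exists_ldes w : w != 1%g -> exists i, ldes i w.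
Proof.
move=> wn1; apply/existsP; apply: contraNT wn1 => /existsPn nd.
have step (a b : 'I_n) : b = a.+1 :> nat -> w^-1%g a < w^-1%g b.
  move=> ab; have lta : a.+1 < n by rewrite -ab.
  have := nd (Ordinal (ltn_pred_ord lta)); rewrite /ldes -leqNgt leq_eqVlt.
  have -> : lo (Ordinal (ltn_pred_ord lta)) = a by apply: val_inj.
  have -> : hi (Ordinal (ltn_pred_ord lta)) = b by apply: val_inj.
  rewrite (inj_eq val_inj) (inj_eq perm_inj) => /orP[/eqP E|//].
  by move: ab; rewrite E; lia.
have up k : forall a : 'I_n, a = k :> nat -> a <= w^-1%g a.
  elim: k => [|k IH] a aE; first by rewrite aE.
  have ltk : k < n by rewrite (leq_trans _ (ltn_ord a)) // aE.
  have := IH (Ordinal ltk) erefl; have := @step (Ordinal ltk) a aE.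
  by rewrite /= aE; lia.
have down k : forall a : 'I_n, a + k.+1 = n -> w^-1%g a <= a.
  elim: k => [|k IH] a aE; first by have := ltn_ord (w^-1%g a); lia.
  have lta : a.+1 < n by lia.
  have := @step a (Ordinal lta) erefl; have := IH (Ordinal lta).
  by rewrite /=; lia.
rewrite -eq_invg1; apply/eqP/permP => a; rewrite perm1; apply/val_inj/eqP.
rewrite /= eqn_leq (up a) // andbT (down (n - a.+1)) //.
by have := ltn_ord a; lia.
Qed.

Definition reduced u := ninv (word_prod u) == size u.

Lemma reduced_cons i u :
  reduced (i :: u) = reduced u && ~~ ldes i (word_prod u).
Proof.
rewrite /reduced word_prod_cons /=; have := ninv_word u.
case: (boolP (ldes i _)) => [/ninv_des <-|/ninv_asc ->] ? /=; first by lia.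
by rewrite andbT eqSS.
Qed.

Lemma reduced_word_ex w : exists2 u, word_prod u = w & reduced u.
Proof.
have [k] : exists k, ninv w <= k by eexists.
elim: k w => [|k IH] w wk.
  exists [::]; last by rewrite /reduced /= ninv1.
  apply/eqP; apply: contraT; rewrite /= eq_sym => /exists_ldes[i /ninv_des]; lia.
have [->|/exists_ldes[i di]] := eqVneq w 1%g.
  by exists [::]; rewrite // /reduced /= ninv1.
have [|u uE ru] := IH (sl i w); first by have := ninv_des di; lia.
exists (i :: u); first by rewrite word_prod_cons uE slK.
by rewrite reduced_cons ru uE ldes_sl di.
Qed.

Lemma perm_lenE w : perm_len w = ninv w.
Proof.
rewrite /perm_len; case: ex_minnP => m /existsP[t /eqP tE] mmin.
apply/eqP; rewrite eqn_leq; apply/andP; split; last first.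
  by rewrite -tE (leq_trans (ninv_word _)) ?size_tuple.
have [u uE /eqP ru] := reduced_word_ex w; apply: mmin; apply/existsP.
by rewrite -uE ru; exists (in_tuple u); rewrite /= eqxx.
Qed.

Lemma word_prod_rev u : word_prod (rev u) = (word_prod u)^-1%g.
Proof.
elim: u => [|i u IH]; first by rewrite /= invg1.
rewrite rev_cons -cats1 word_prod_cat IH [word_prod (i :: u)]word_prod_cons sl_inv.
by rewrite [word_prod _]word_prod_cons /sl /sr /pmul mul1g.
Qed.

Lemma ninvV w : ninv w^-1%g = ninv w.
Proof.
wlog suff: w / ninv w^-1%g <= ninv w.
  by move=> H; apply/eqP; rewrite eqn_leq H -{1}[w]invgK H.
have [u <- /eqP ->] := reduced_word_ex w.
by rewrite -word_prod_rev (leq_trans (ninv_word _)) ?size_rev.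
Qed.

Lemma reduced_rev u : reduced (rev u) = reduced u.
Proof. by rewrite /reduced word_prod_rev ninvV size_rev. Qed.

Lemma ninv_rasc i w : ~~ rdes i w -> ninv (sr i w) = (ninv w).+1.
Proof. by rewrite -ldesV -ninvV sr_inv => /ninv_asc ->; rewrite ninvV. Qed.

(** Because [l (s_i w s_j) <= l (s_i w) + 1 = l w < l (w s_j)]. *)
Lemma ldes_sr i j w : ~~ rdes j w -> ldes i w -> ldes i (sr j w).
Proof.
move=> aj di; rewrite ldesE sl_sr (ninv_rasc aj) ltnS.
by rewrite -ninvV sr_inv (leq_trans (ninv_sl_le _ _)) // ninvV -ldesE.
Qed.

Lemma rdes_sl i j w : ~~ ldes i w -> rdes j w -> rdes j (sl i w).
Proof.
by move=> ai dj; rewrite -ldesV sl_inv ldes_sr // ?ldesV // rdesV.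
Qed.

(** * Matsumoto's theorem *)

Inductive braid_eq : seq 'I_n.-1 -> seq 'I_n.-1 -> Prop :=
| braid_refl u : braid_eq u u
| braid_sym u v : braid_eq u v -> braid_eq v u
| braid_trans u v t : braid_eq u v -> braid_eq v t -> braid_eq u t
| braid_cons i u v : braid_eq u v -> braid_eq (i :: u) (i :: v)
| braid_far i j u : i.+2 <= j -> braid_eq [:: i, j & u] [:: j, i & u]
| braid_near i j u : j = i.+1 :> nat ->
    braid_eq [:: i, j, i & u] [:: j, i, j & u].

Lemma sl_far i j w : i.+2 <= j -> sl i (sl j w) = sl j (sl i w).
Proof.
move=> ij; apply/permP => a; apply: val_inj; rewrite !slE /=.
by do 4?rewrite srefl_val; split_eqns; lia.
Qed.

Lemma sl_near i j w : j = i.+1 :> nat ->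
  sl i (sl j (sl i w)) = sl j (sl i (sl j w)).
Proof.
move=> ij; apply/permP => a; apply: val_inj; rewrite !slE /=.
by do 6?rewrite srefl_val; split_eqns; lia.
Qed.

Lemma ldes_far i j w : i.+2 <= j -> ldes j (sl i w) = ldes j w /\ ldes i (sl j w) = ldes i w.
Proof.
move=> ij; rewrite /ldes !sl_inv !srE.
have E (k : 'I_n.-1) (b : 'I_n) : b != k :> nat -> b != k.+1 :> nat -> simple_refl k b = b.
  by move=> /negPf n1 /negPf n2; apply: val_inj; rewrite /= srefl_val n1 n2.
by rewrite !E //=; lia.
Qed.

(** All the descents met along the two sides of a braid relation compare two of
    the positions of the values [i], [i + 1] and [i + 2]; [c] compares the
    positions of [i] and [i + 2]. *)
Lemma ldes_near_orbit i j (y : 'S_n) : j = i.+1 :> nat -> exists c : bool,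
  [/\ (ldes i y -> ldes j y -> c) /\ (~~ ldes i y -> ~~ ldes j y -> ~~ c),
      ldes j (sl i y) = c, ldes i (sl j y) = c,
      ldes j (sl i (sl j y)) = ldes i y & ldes i (sl j (sl i y)) = ldes j y].
Proof.
move=> ij; exists (y^-1%g (hi j) < y^-1%g (lo i))%N.
have loj : lo j = hi i by apply: val_inj; rewrite /= ij.
have sihj : simple_refl i (hi j) = hi j.
  by apply: val_inj; rewrite /= srefl_val /= ij; split_eqns; lia.
have sjli : simple_refl j (lo i) = lo i.
  by apply: val_inj; rewrite /= srefl_val /= ij; split_eqns; lia.
have sjhi : simple_refl j (hi i) = hi j by rewrite -loj srefl_lo.
have sjhj : simple_refl j (hi j) = hi i by rewrite -loj srefl_hi.
rewrite /ldes !sl_inv !srE loj.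
rewrite !(srefl_lo i, srefl_hi i, sihj, sjli, sjhi, sjhj).
split=> //; split; lia.
Qed.

Lemma ldes_near i j w : j = i.+1 :> nat -> ldes i w -> ldes j w ->
  [/\ ldes j (sl i w), ldes i (sl j (sl i w)), ldes i (sl j w)
    & ldes j (sl i (sl j w))].
Proof.
move=> ij di dj; have [c [[C _] -> -> -> ->]] := ldes_near_orbit w ij.
by rewrite di dj C.
Qed.

(** Induction over the length.  If the words begin with different letters [i] and
    [j], both are left descents of the product, which therefore has a reduced
    word beginning with the longest element of the subgroup that they generate;
    both words are braid equivalent to such a word. *)
Theorem matsumoto u v : reduced u -> reduced v ->
  word_prod u = word_prod v -> braid_eq u v.
Proof.
have [k] : exists k, size u <= k by eexists.
elim: k u v => [|k IH] [|i u] [|j v] //= szu ru rv uv; do ?exact: braid_refl.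
- by move: rv; rewrite /reduced /= -uv ninv1.
- by move: rv; rewrite /reduced /= -uv ninv1.
- by move: ru; rewrite /reduced /= uv ninv1.
have szuv : size u = size v.
  by move: ru rv; rewrite /reduced /= uv => /eqP-> /eqP[].
move: ru rv; rewrite !reduced_cons => /andP[ru ai] /andP[rv aj].
set w := sl i (word_prod u); have uE : word_prod u = sl i w by rewrite slK.
have vE : word_prod v = sl j w by rewrite /w -[sl i _]/(pmul _ _) uv -/(sl j _) slK.
have di : ldes i w by move: ai; rewrite uE ldes_sl negbK.
have dj : ldes j w by move: aj; rewrite vE ldes_sl negbK.
have szk : size u <= k by [].
have szk' : size v <= k by rewrite -szuv.
clearbody w; clear uv ai aj.
wlog ltij : i j u v uE vE di dj ru rv szu szuv szk szk' / i <= j.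
  move=> H; case: (leqP i j) => [|/ltnW] ij; first exact: H.
  by apply: braid_sym; apply: H => //; rewrite -szuv.
case: (ltngtP i j) ltij => // [ltij _|/val_inj ij _]; last first.
  by subst j; apply/braid_cons/IH; rewrite // uE vE.
have [jE|far] := eqVneq (j : nat) i.+1.
- have [d1 d2 d3 d4] := ldes_near jE di dj.
  have [z zE rz] := reduced_word_ex (sl i (sl j (sl i w))).
  have b1 : braid_eq u [:: j, i & z].
    apply: IH; rewrite // ?reduced_cons ?word_prod_cons ?rz zE !slK ?uE //.
    by rewrite !ldes_sl d2 d1.
  have b2 : braid_eq v [:: i, j & z].
    apply: IH; rewrite // ?reduced_cons ?word_prod_cons ?rz zE ?vE sl_near // !slK //.
    by rewrite !ldes_sl d4 d3.
  apply: braid_trans (braid_cons i b1) _.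
  apply: braid_trans _ (braid_cons j (braid_sym b2)).
  exact: braid_near.
- have ij2 : i.+2 <= j by lia.
  have [d1 d2] := ldes_far w ij2.
  have [z zE rz] := reduced_word_ex (sl i (sl j w)).
  have b1 : braid_eq u (j :: z).
    apply: IH => //.
      by rewrite reduced_cons rz zE (sl_far _ ij2) ldes_sl d1 dj.
    by rewrite word_prod_cons zE uE (sl_far _ ij2) slK.
  have b2 : braid_eq v (i :: z).
    apply: IH => //.
      by rewrite reduced_cons rz zE ldes_sl d2 di.
    by rewrite word_prod_cons zE vE slK.
  apply: braid_trans (braid_cons i b1) _.
  apply: braid_trans _ (braid_cons j (braid_sym b2)).
  exact: braid_far.
Qed.

End Length.

(** * The Bruhat order *)

Section Bruhat.
Variable n : nat.
Implicit Types (w x y z : 'S_n) (u v t : seq 'I_n.-1) (i j : 'I_n.-1).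

Definition below u y := exists2 t, subseq t u & word_prod t = y.

Lemma below_cons i u y : below (i :: u) y <-> below u y \/ below u (sl i y).
Proof.
split=> [[[|j t] sub <-]|[[t sub <-]|[t sub tE]]].
- by left; exists [::]; rewrite ?sub0seq.
- move: sub => /=; case: eqP => [-> sub|_ sub]; last by left; exists (j :: t).
  by right; exists t; rewrite // -[pmul _ _]/(sl i _) slK.
- by exists t => //; apply: subseq_trans sub (subseq_cons _ _).
- by exists (i :: t); rewrite /= ?eqxx // tE -[pmul _ _]/(sl i _) slK.
Qed.

(** The set of products of subwords is [{1, s_i}] times the corresponding set for
    the rest of the word, and it takes the same value on the two sides of each
    braid relation.  So the choice of a reduced expression does not matter in
    the Bruhat order. *)
Lemma below_braid u v : braid_eq u v -> forall y, below u y <-> below v y.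
Proof.
elim=> {u v} [u|u v _ IH|u v t _ IH1 _ IH2|i u v _ IH|i j u ij|i j u ij] y //.
- by rewrite IH.
- by rewrite IH1.
- by rewrite !below_cons !IH.
- by rewrite !below_cons (sl_far _ ij); tauto.
- by rewrite !below_cons !slK (sl_near _ ij); tauto.
Qed.

Lemma bruhat_leP y w :
  reflect (exists u, [/\ reduced u, word_prod u = w & below u y]) (bruhat_le y w).
Proof.
apply: (iffP existsP) => [[t /andP[/eqP tE /existsP[m /eqP mE]]]|].
  exists t; split=> //; first by rewrite /reduced tE size_tuple perm_lenE.
  by exists (mask m t); rewrite ?mask_subseq.
case=> u [/eqP ru uE [t /subseqP[m szm tE] <-]].
have szu : size u == perm_len w by rewrite perm_lenE -uE ru.
have szm' : size m == perm_len w by rewrite szm.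
exists (Tuple szu); rewrite /reduced_expr /= uE eqxx; apply/existsP.
by exists (Tuple szm'); rewrite /= tE.
Qed.

Lemma bruhat_le_word y u : reduced u -> bruhat_le y (word_prod u) <-> below u y.
Proof.
move=> ru; split=> [/bruhat_leP[v [rv uv bv]]|bu]; last by apply/bruhat_leP; exists u.
exact/(below_braid (matsumoto rv ru uv)).
Qed.

(** The deletion condition.  When a letter [i] is prepended to a reduced word
    having [i] as a descent, Matsumoto's theorem lets [i] be moved to the front
    of that word, and the two copies cancel. *)
Lemma reduced_subword t :
  exists t', [/\ subseq t' t, reduced t' & word_prod t' = word_prod t].
Proof.
have [k] : exists k, size t <= k by eexists.
elim: k t => [|k IH] [|i t] //= szt.
- by exists [::]; rewrite /reduced /= ninv1.
- by exists [::]; rewrite /reduced /= ninv1.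
have [t1 [sub1 red1 E1]] := IH t szt.
case: (boolP (ldes i (word_prod t1))) => di; last first.
  exists (i :: t1); rewrite /= eqxx reduced_cons red1 di; split=> //.
  by rewrite -E1.
have [z zE rz] := reduced_word_ex (sl i (word_prod t1)).
have zt : braid_eq (i :: z) t1.
  apply: matsumoto => //; first by rewrite reduced_cons rz zE ldes_sl di.
  by rewrite word_prod_cons zE slK.
have [t2 sub2 E2] : below t1 (sl i (word_prod t1)).
  by apply/(below_braid zt)/below_cons; left; exists z.
have [|t3 [sub3 red3 E3]] := IH t2.
  by rewrite (leq_trans (size_subseq sub2)) // (leq_trans (size_subseq sub1)).
exists t3; split=> //; last by rewrite E3 E2 E1.
exact: subseq_trans (subseq_trans sub3 sub2) (subseq_trans sub1 (subseq_cons _ _)).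
Qed.

Lemma bruhat_refl w : bruhat_le w w.
Proof.
have [u <- ru] := reduced_word_ex w.
by apply/bruhat_le_word => //; exists u; rewrite ?subseq_refl.
Qed.

(** A subword of a reduced word of [w] with product [x] contains a reduced word of
    [x], in which [y] can then be found. *)
Lemma bruhat_trans y x w : bruhat_le y x -> bruhat_le x w -> bruhat_le y w.
Proof.
have [u <- ru] := reduced_word_ex w.
move=> yx /(bruhat_le_word _ ru)[t sub tE].
have [t1 [sub1 red1 E1]] := reduced_subword t.
move: yx; rewrite -tE -E1 => /(bruhat_le_word _ red1)[t2 sub2 <-].
apply/bruhat_le_word => //; exists t2 => //.
exact: subseq_trans sub2 (subseq_trans sub1 sub).
Qed.

Lemma bruhat_ninv y w : bruhat_le y w -> ninv y <= ninv w ?= iff (y == w).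
Proof.
move=> /bruhat_leP[u [/eqP ru <- [t sub <-]]].
have le1 := ninv_word t; have le2 := size_subseq sub.
split; first by rewrite ru (leq_trans le1 le2).
apply/eqP/eqP => [E|->//]; congr word_prod; apply/eqP.
by rewrite -(size_subseq_leqif sub) eqn_leq le2 /= -ru -E.
Qed.

Lemma bruhat_lt_ninv y w : bruhat_lt y w -> ninv y < ninv w.
Proof. by case/andP=> neq /bruhat_ninv/ltn_leqif ->. Qed.

Lemma bruhat_sl_up i y x : ~~ ldes i x -> bruhat_le y x ->
  bruhat_le y (sl i x) /\ bruhat_le (sl i y) (sl i x).
Proof.
have [u <- ru] := reduced_word_ex x.
move=> ai /(bruhat_le_word _ ru) bu; rewrite -word_prod_cons.
have riu : reduced (i :: u) by rewrite reduced_cons ru.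
by split; apply/bruhat_le_word => //; apply/below_cons; rewrite ?slK; tauto.
Qed.

Lemma bruhat_lt_sl i w : bruhat_lt (sl i w) w = ldes i w.
Proof.
apply/idP/idP => [/bruhat_lt_ninv|di]; first by rewrite -ldesE.
apply/andP; split.
  by apply: contraTneq di => E; move: (ldes_sl i w); rewrite E; case: ldes.
have ai : ~~ ldes i (sl i w) by rewrite ldes_sl di.
by have [] := bruhat_sl_up ai (bruhat_refl _); rewrite slK.
Qed.

Lemma left_descents_sub x y :
  reflect (forall i, ldes i x -> ldes i y) (left_descents x \subset left_descents y).
Proof.
have memE i w : (simple_refl i \in left_descents w) = ldes i w.
  rewrite /left_descents (mem_imset _ _ (@srefl_inj n)) inE.
  exact: bruhat_lt_sl.
apply: (iffP fintype.subsetP) => [sub i di|sub s].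
  by rewrite -memE sub ?memE.
by move=> /imsetP[j]; rewrite inE -[pmul _ _]/(sl _ _) bruhat_lt_sl => /sub dj ->; rewrite memE.
Qed.

End Bruhat.

Import GRing.Theory.
Local Open Scope ring_scope.

(** * The involution of the field of coefficients *)

Section FractionLift.
Variables (R : idomainType) (F : fieldType) (f : {rmorphism R -> F}).
Hypothesis f_inj : injective f.

(** A fraction is the quotient of the numerator and the denominator of its chosen
    representative; [fraction_lift] evaluates on that representative. *)
Lemma fraction_split (x : {fraction R}) :
  x = FracField.tofrac (frac (generic_quotient.repr x)).1 / FracField.tofrac (frac (generic_quotient.repr x)).2.
Proof.
have d0 := denom_ratioP (generic_quotient.repr x).
apply: (mulIf (x := FracField.tofrac (frac (generic_quotient.repr x)).2)).
  by rewrite tofrac_eq0.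
rewrite divfK ?tofrac_eq0 // -{1}[x]reprK; unlock FracField.tofrac.
rewrite -[LHS]FracField.pi_mul; apply/eqmodP.
rewrite /= FracField.equivfE /FracField.mulf !numden_Ratio ?mulf_neq0 ?oner_eq0 //.
by rewrite !mulr1 mulrC.
Qed.

Definition fraction_lift (x : {fraction R}) : F :=
  f (frac (generic_quotient.repr x)).1 / f (frac (generic_quotient.repr x)).2.

Lemma fraction_liftE a b : b != 0 ->
  fraction_lift (FracField.tofrac a / FracField.tofrac b) = f a / f b.
Proof.
move=> b0; set x := _ / _; have d0 := denom_ratioP (generic_quotient.repr x).
have := fraction_split x; rewrite /fraction_lift.
move: (frac _).1 (frac _).2 d0 => c d d0 xE.
have fn0 (r : R) : r != 0 -> f r != 0 by rewrite -(inj_eq f_inj) rmorph0.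
apply/eqP; rewrite (GRing.eqr_div _ _ (fn0 _ d0) (fn0 _ b0)) -!rmorphM /=.
move/eqP: xE; rewrite /x (GRing.eqr_div) ?tofrac_eq0 // -!rmorphM tofrac_eq => /eqP <-.
by rewrite mulrC.
Qed.

Lemma fraction_lift_tofrac a : fraction_lift (FracField.tofrac a) = f a.
Proof.
by rewrite -[FracField.tofrac a]divr1 -(rmorph1 (@FracField.tofrac R))
  fraction_liftE ?oner_eq0 // rmorph1 divr1.
Qed.

Lemma fraction_lift_zmod : zmod_morphism fraction_lift.
Proof.
move=> x y; rewrite (fraction_split x) (fraction_split y).
have dx := denom_ratioP (generic_quotient.repr x); have dy := denom_ratioP (generic_quotient.repr y).
move: (frac _).1 (frac _).2 dx (frac _).1 (frac _).2 dy => a b b0 c d d0.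
have fn0 (r : R) : r != 0 -> f r != 0 by rewrite -(inj_eq f_inj) rmorph0.
rewrite -mulNr addf_div ?tofrac_eq0 // -!(rmorphN, rmorphM, rmorphD) /=.
rewrite !fraction_liftE ?mulf_neq0 // -mulNr addf_div ?fn0 //.
by rewrite !(rmorphN, rmorphM, rmorphD).
Qed.

Lemma fraction_lift_monoid : monoid_morphism fraction_lift.
Proof.
split=> [|x y].
  by rewrite -(rmorph1 (@FracField.tofrac R)) fraction_lift_tofrac rmorph1.
rewrite (fraction_split x) (fraction_split y).
have dx := denom_ratioP (generic_quotient.repr x); have dy := denom_ratioP (generic_quotient.repr y).
move: (frac _).1 (frac _).2 dx (frac _).1 (frac _).2 dy => a b b0 c d d0.
rewrite mulf_div -!rmorphM /= !fraction_liftE ?mulf_neq0 // mulf_div.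
by rewrite !rmorphM.
Qed.

End FractionLift.

Definition rat_cst : {rmorphism rat -> heckeK} :=
  [the {rmorphism rat -> heckeK} of @FracField.tofrac {poly rat} \o polyC].

Definition inv_eval : {rmorphism {poly rat} -> heckeK} :=
  [the {rmorphism {poly rat} -> heckeK} of
     horner_eval hv^-1 \o map_poly rat_cst].

Lemma hv_neq0 : hv != 0.
Proof. by rewrite tofrac_eq0 polyX_eq0. Qed.

(** Evaluation at [v^-1], up to a power of [v], is the evaluation at [v] of the
    reversed polynomial; hence it is injective. *)
Lemma inv_evalE p :
  inv_eval p * hv ^+ size p
    = hv * FracField.tofrac (\poly_(i < size p) p`_(size p - i.+1)).
Proof.
rewrite /= /horner_eval horner_poly mulr_suml poly_def raddf_sum mulr_sumr.
rewrite (reindex_inj rev_ord_inj) /=; apply: eq_bigr => i _.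
have H m k : hv^-1 ^+ m * hv ^+ (m + k.+1) = hv * hv ^+ k.
  by rewrite exprD mulrA -exprMn mulVf ?hv_neq0 // expr1n mul1r exprS.
rewrite -mul_polyC rmorphM rmorphXn /= -/hv -mulrA [RHS]mulrCA; congr (_ * _).
by have := H (size p - i.+1)%N i; rewrite subnK.
Qed.

Lemma inv_eval_inj : injective inv_eval.
Proof.
apply: raddf_inj => p p0; apply/eqP; rewrite -lead_coef_eq0.
have := inv_evalE p; rewrite p0 mul0r => /esym/eqP.
rewrite mulf_eq0 (negPf hv_neq0) tofrac_eq0 => /= /eqP/(congr1 (fun q : {poly rat} => q`_0)).
rewrite coef_poly coef0 lead_coefE subn1; case: ltnP => [_ -> //|].
by rewrite leqn0 size_poly_eq0 => /eqP->; rewrite coef0.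
Qed.

(** The automorphism [v |-> v^-1]. *)
Definition barK (x : heckeK) : heckeK := fraction_lift inv_eval x.

HB.instance Definition _ := GRing.isZmodMorphism.Build heckeK heckeK barK
  (fraction_lift_zmod inv_eval_inj).
HB.instance Definition _ := GRing.isMonoidMorphism.Build heckeK heckeK barK
  (fraction_lift_monoid inv_eval_inj).

Lemma barK_hv : barK hv = hv^-1.
Proof.
rewrite /barK fraction_lift_tofrac; last exact: inv_eval_inj.
by rewrite /= /horner_eval map_polyX hornerX.
Qed.

(** * Ring morphisms out of the Hecke algebra *)

(** The universal property of the presented algebra: a central ring morphism from
    the scalars and images of the generators that satisfy the relations. *)
Section HeckeLift.
Variables (n : nat) (A : pzRingType) (c : {rmorphism heckeK -> A}) (g : 'I_n.-1 -> A).
Hypotheses (c_central : forall k a, c k * a = a * c k)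
  (g_quad : forall i, (g i + c (- hq)) * (g i + 1) = 0)
  (g_near : forall i j : 'I_n.-1, j = i.+1 :> nat -> g i * g j * g i = g j * g i * g j)
  (g_far : forall i j : 'I_n.-1, (i.+2 <= j)%N -> g i * g j = g j * g i).

Fixpoint hterm_lift (x : hterm n) : A :=
  match x with
  | HCst k => c k
  | HGen i => g i
  | HAdd x y => hterm_lift x + hterm_lift y
  | HMul x y => hterm_lift x * hterm_lift y
  end.

Lemma heq_lift x y : heq x y -> hterm_lift x = hterm_lift y.
Proof.
elim=> {x y} //=.
- by move=> x y z _ -> _ ->.
- by move=> x x' y y' _ -> _ ->.
- by move=> x x' y y' _ -> _ ->.
- by move=> x y z; rewrite addrA.
- by move=> x y; rewrite addrC.
- by move=> x; rewrite rmorph0 add0r.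
- by move=> x; rewrite rmorphN1 mulN1r addNr rmorph0.
- by move=> x y z; rewrite mulrA.
- by move=> x; rewrite rmorph1 mul1r.
- by move=> x y z; rewrite mulrDl.
- by move=> x y z; rewrite mulrDr.
- by move=> a b; rewrite rmorphD.
- by move=> a b; rewrite rmorphM.
- by move=> i; rewrite rmorph1 g_quad rmorph0.
Qed.

Definition hecke_lift (x : hecke n) : A := hterm_lift (generic_quotient.repr x).

Lemma hecke_lift_pi x : hecke_lift (\pi_(hecke n) x)%qT = hterm_lift x.
Proof. by apply: heq_lift; apply: heq_repr. Qed.

Lemma hecke_lift_hT i : hecke_lift (hT i) = g i.
Proof. exact: hecke_lift_pi. Qed.

Lemma hecke_liftD : {morph hecke_lift : x y / x + y}.
Proof.
elim/hquotW=> x; elim/hquotW=> y; rewrite -[_ + _]/(hadd _ _) haddE.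
by rewrite !hecke_lift_pi.
Qed.

Lemma hecke_liftM : {morph hecke_lift : x y / x * y}.
Proof.
elim/hquotW=> x; elim/hquotW=> y; rewrite -[X in hecke_lift X]/(hmul _ _) hmulE.
by rewrite !hecke_lift_pi.
Qed.

Lemma hecke_lift_cst k : hecke_lift (hcst n k) = c k.
Proof. exact: hecke_lift_pi. Qed.

Lemma hecke_liftZ k x : hecke_lift (k *: x) = c k * hecke_lift x.
Proof. by rewrite -[k *: x]/(hcst n k * x) hecke_liftM hecke_lift_cst. Qed.

Lemma hecke_lift1 : hecke_lift 1 = 1.
Proof. by rewrite -[1 in LHS]/(hcst n 1) hecke_lift_cst rmorph1. Qed.

Lemma hecke_lift0 : hecke_lift 0 = 0.
Proof. by rewrite -[0 in LHS]/(hcst n 0) hecke_lift_cst rmorph0. Qed.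

End HeckeLift.

(** * The action of the generators over an abstract field *)

(* The field is abstract so that no computation unfolds the construction of the
   fractions. *)
Section FieldIdentities.
Variables (F : fieldType) (v : F).
Hypothesis v0 : v != 0.

Lemma hH_sq_id1 : - v^-1 * (- v^-1 * v ^+ 2) = 1.
Proof. by field. Qed.

Lemma hH_sq_id2 : - v^-1 * (- v^-1 * (v ^+ 2 - 1)) = (v^-1 - v) * - v^-1.
Proof. by field. Qed.

Lemma bar_hH_id1 : - v * (v ^+ 2)^-1 = - v^-1.
Proof. by field. Qed.

Lemma bar_hH_id2 : - v * (v ^+ 2)^-1 + v = v - v^-1.
Proof. by field. Qed.

Variable n : nat.
Implicit Types (f : 'S_n -> F) (y : 'S_n) (i j : 'I_n.-1).

(** The operator by which [hH i] acts on the function [f] standing for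
    [\sum_y f y *: hHw y]. *)
Definition hH_act i f y : F :=
  f (sl i y) + (if ldes i y then (v^-1 - v) * f y else 0).

Definition hT_act i f y : F := - v * hH_act i f y.

Lemma hT_act_linear i k f1 f2 y :
  hT_act i (fun z => k * f1 z + f2 z) y = k * hT_act i f1 y + hT_act i f2 y.
Proof. by rewrite /hT_act /hH_act; case: ifP => _; ring. Qed.

Lemma hT_act_quad i f y :
  hT_act i (fun z => hT_act i f z + 1 * f z) y
  + - v ^+ 2 * (hT_act i f y + 1 * f y) = 0.
Proof.
rewrite /hT_act /hH_act slK ldes_sl.
by case: (ldes i y) => /=; field.
Qed.

Lemma hT_act_near i j f y : j = i.+1 :> nat ->
  hT_act i (hT_act j (hT_act i f)) y = hT_act j (hT_act i (hT_act j f)) y.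
Proof.
move=> ij; rewrite /hT_act /hH_act.
have [c [[C1 C2] E1 E2 E3 E4]] := ldes_near_orbit y ij.
rewrite !slK !ldes_sl ?(E1, E2, E3, E4) -?(sl_near _ ij) ?slK.
case: (ldes i y) (ldes j y) c C1 C2 {E1 E2 E3 E4} => [] [] [] C1 C2 /=;
  try (by move: (C1 isT isT)); try (by move: (C2 isT isT)); by field.
Qed.

Lemma hT_act_far i j f y : (i.+2 <= j)%N ->
  hT_act i (hT_act j f) y = hT_act j (hT_act i f) y.
Proof.
move=> ij; rewrite /hT_act /hH_act (sl_far _ ij).
have [-> ->] := ldes_far y ij.
by case: (ldes i y); case: (ldes j y); ring.
Qed.

End FieldIdentities.

(** * The standard basis of the Hecke algebra *)

Section StandardBasis.
Variable n : nat.
Local Notation hecke := (hecke n).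
Local Notation v := hv.
Implicit Types (w x y z : 'S_n) (u : seq 'I_n.-1) (i j : 'I_n.-1) (a b : hecke).

Lemma hcstE k : hcst n k = k%:A.
Proof. by rewrite -[k%:A]/(hmul _ (hcst n 1)) hmul1r. Qed.

Lemma hT_quad i : (hT i + (- hq)%:A) * (hT i + 1) = 0 :> hecke.
Proof.
rewrite -hcstE -[_ * _]/(hmul (hadd _ (hcst n _)) (hadd _ (hcst n 1))).
rewrite /hT /hcst !haddE hmulE; apply/hpiP; exact: heq_quad.
Qed.

Lemma hT_near i j : j = i.+1 :> nat -> hT i * hT j * hT i = hT j * hT i * hT j :> hecke.
Proof.
move=> ij; rewrite -[LHS]/(hmul (hmul _ _) _) -[RHS]/(hmul (hmul _ _) _) /hT.
rewrite (hmulE (HGen i) (HGen j)) (hmulE (HGen j) (HGen i)) !hmulE.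
by apply/hpiP/heq_braid.
Qed.

Lemma hT_far i j : (i.+2 <= j)%N -> hT i * hT j = hT j * hT i :> hecke.
Proof.
move=> ij; rewrite -[LHS]/(hmul _ _) -[RHS]/(hmul _ _) /hT !hmulE.
by apply/hpiP/heq_comm.
Qed.

Lemma hq_neq0 : hq != 0.
Proof. by rewrite expf_neq0 ?hv_neq0. Qed.

Lemma hT_sq i : hT i * hT i = (hq - 1) *: hT i + hq%:A :> hecke.
Proof.
have := hT_quad i; rewrite mulrDl !mulrDr !mulr1 !mulr_algl.
move/eqP; rewrite !scaleNr -addrA addr_eq0 => /eqP->.
by rewrite !opprD !opprK scalerBl scale1r addrA [- _ + _]addrC.
Qed.

Lemma hT_invl i : (hq^-1 *: (hT i + 1) - 1) * hT i = 1 :> hecke.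
Proof.
rewrite mulrBl mul1r -scalerAl mulrDl mul1r hT_sq scalerBl scale1r.
by rewrite addrAC subrK -scalerDr scalerA mulVf ?hq_neq0 // scale1r addrC addKr.
Qed.

Lemma hT_invr i : hT i * (hq^-1 *: (hT i + 1) - 1) = 1 :> hecke.
Proof.
rewrite mulrBr mulr1 -scalerAr mulrDr mulr1 hT_sq scalerBl scale1r.
by rewrite addrAC subrK -scalerDr scalerA mulVf ?hq_neq0 // scale1r addrC addKr.
Qed.

Lemma hT_unit i : (hT i : hecke) \is a GRing.unit.
Proof. by apply/unitrP; eexists; split; [exact: hT_invl|exact: hT_invr]. Qed.

Lemma hTV i : (hT i : hecke)^-1 = hq^-1 *: (hT i + 1) - 1.
Proof.
by apply: (mulrI (hT_unit i)); rewrite mulrV ?hT_unit // hT_invr.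
Qed.

(** The scalar part of the bar involution [bar], which is semilinear over [barK]
    and sends [T_i] to its inverse. *)
Definition bar_cst : {rmorphism heckeK -> hecke} :=
  [the {rmorphism heckeK -> hecke} of in_alg hecke \o barK].

Definition bar : hecke -> hecke := hecke_lift bar_cst (fun i => (hT i)^-1).

Lemma bar_cst_central k a : bar_cst k * a = a * bar_cst k.
Proof. by rewrite /= mulr_algl mulr_algr. Qed.

Lemma barK_hq : barK hq = hq^-1.
Proof. by rewrite rmorphXn /= barK_hv exprVn. Qed.

Lemma bar_quad i : ((hT i)^-1 + bar_cst (- hq)) * ((hT i)^-1 + 1) = 0 :> hecke.
Proof.
rewrite /= rmorphN /= barK_hq hTV subrK.
have -> : hq^-1 *: (hT i + 1) - 1 + in_alg hecke (- hq^-1)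
    = hq^-1 *: (hT i + (- hq)%:A) :> hecke.
  rewrite /= !scalerDr scalerA mulrN mulVf ?hq_neq0 // !scaleNr scale1r.
  by rewrite addrAC addrK.
by rewrite -scalerAl -scalerAr hT_quad !scaler0.
Qed.

Lemma bar_near i j : j = i.+1 :> nat ->
  (hT i)^-1 * (hT j)^-1 * (hT i)^-1 = (hT j)^-1 * (hT i)^-1 * (hT j)^-1 :> hecke.
Proof.
have U k l : hT k * hT l \is a @GRing.unit hecke by rewrite unitrMr ?hT_unit.
by move=> ij; rewrite -!invrM ?U ?hT_unit //= !mulrA hT_near.
Qed.

Lemma bar_far i j : (i.+2 <= j)%N ->
  (hT i)^-1 * (hT j)^-1 = (hT j)^-1 * (hT i)^-1 :> hecke.
Proof. by move=> ij; rewrite -!invrM ?hT_unit // (hT_far ij). Qed.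

Lemma barD : {morph bar : a b / a + b}.
Proof. exact: (hecke_liftD bar_cst_central bar_quad bar_near bar_far). Qed.
Lemma barM : {morph bar : a b / a * b}.
Proof. exact: (hecke_liftM bar_cst_central bar_quad bar_near bar_far). Qed.
Lemma barZ k a : bar (k *: a) = barK k *: bar a.
Proof.
rewrite /bar (hecke_liftZ bar_cst_central bar_quad bar_near bar_far) /=.
by rewrite mulr_algl.
Qed.
Lemma bar1 : bar 1 = 1.
Proof. exact: (hecke_lift1 bar_cst_central bar_quad bar_near bar_far). Qed.
Lemma bar0 : bar 0 = 0.
Proof. exact: (hecke_lift0 bar_cst_central bar_quad bar_near bar_far). Qed.
Lemma bar_hT i : bar (hT i) = (hT i)^-1.
Proof. exact: (hecke_lift_hT bar_cst_central bar_quad bar_near bar_far). Qed.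
Lemma bar_sum I (r : seq I) (P : pred I) (F : I -> hecke) :
  bar (\sum_(k <- r | P k) F k) = \sum_(k <- r | P k) bar (F k).
Proof. exact: (big_morph _ barD bar0). Qed.
Lemma barN a : bar (- a) = - bar a.
Proof. by rewrite -scaleN1r barZ rmorphN1 scaleN1r. Qed.

(** The anti-involution [flip] that fixes the generators is a morphism to the
    opposite ring, here in its scalar part.  It turns statements about left
    multiplication into statements about right multiplication. *)
Definition flip_cst (k : heckeK) : hecke^c := k%:A : hecke.

Lemma flip_cst_zmod : zmod_morphism flip_cst.
Proof. by move=> k l; rewrite /flip_cst scalerBl. Qed.
Lemma flip_cst_monoid : monoid_morphism flip_cst.
Proof.
split=> [|k l]; rewrite /flip_cst; first exact: scale1r.
by rewrite -[RHS]/((l%:A : hecke) * k%:A) mulr_algl scalerA mulrC.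
Qed.
HB.instance Definition _ := GRing.isZmodMorphism.Build heckeK hecke^c flip_cst
  flip_cst_zmod.
HB.instance Definition _ := GRing.isMonoidMorphism.Build heckeK hecke^c flip_cst
  flip_cst_monoid.

Definition flip (a : hecke) : hecke := hecke_lift flip_cst (@hT n : _ -> hecke^c) a.

Lemma flip_cst_central k (a : hecke^c) : flip_cst k * a = a * flip_cst k.
Proof.
rewrite -[LHS]/((a : hecke) * k%:A) -[RHS]/(k%:A * (a : hecke)).
by rewrite mulr_algl mulr_algr.
Qed.

Lemma flip_quad i : ((hT i : hecke^c) + flip_cst (- hq)) * ((hT i : hecke^c) + 1) = 0.
Proof.
have := hT_quad i; rewrite -[X in _ -> X = _]/(((hT i : hecke) + 1) * (hT i + (- hq)%:A)).
rewrite !mulrDl !mulrDr !mulr1 !mul1r !mulr_algl !mulr_algr => <-.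
by rewrite -!addrA; congr (_ + _); rewrite addrCA.
Qed.

Lemma flip_near i j : j = i.+1 :> nat ->
  (hT i : hecke^c) * hT j * hT i = (hT j : hecke^c) * hT i * hT j.
Proof.
move=> ij; rewrite -[LHS]/((hT i : hecke) * (hT j * hT i)).
by rewrite -[RHS]/((hT j : hecke) * (hT i * hT j)) !mulrA hT_near.
Qed.

Lemma flip_far i j : (i.+2 <= j)%N ->
  (hT i : hecke^c) * hT j = (hT j : hecke^c) * hT i.
Proof. by move=> ij; apply/esym; apply: hT_far. Qed.

Lemma flipD : {morph flip : a b / a + b}.
Proof. exact: (hecke_liftD flip_cst_central flip_quad flip_near flip_far). Qed.
Lemma flipM a b : flip (a * b) = flip b * flip a.
Proof. exact: (hecke_liftM flip_cst_central flip_quad flip_near flip_far). Qed.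
Lemma flipZ k a : flip (k *: a) = k *: flip a.
Proof.
rewrite /flip (hecke_liftZ flip_cst_central flip_quad flip_near flip_far).
by rewrite -[LHS]/(flip a * k%:A) mulr_algr.
Qed.
Lemma flip1 : flip 1 = 1.
Proof. exact: (hecke_lift1 flip_cst_central flip_quad flip_near flip_far). Qed.
Lemma flip0 : flip 0 = 0.
Proof. exact: (hecke_lift0 flip_cst_central flip_quad flip_near flip_far). Qed.
Lemma flip_hT i : flip (hT i) = hT i.
Proof. exact: (hecke_lift_hT flip_cst_central flip_quad flip_near flip_far). Qed.
Lemma flip_sum I (r : seq I) (P : pred I) (F : I -> hecke) :
  flip (\sum_(k <- r | P k) F k) = \sum_(k <- r | P k) flip (F k).
Proof. exact: (big_morph _ flipD flip0). Qed.

(** The normalization of the generators in which the bar invariant basis has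
    coefficients in [Z[v]].  The definition is locked so that unification does
    not read a scalar multiple as a product. *)
Definition hH i : hecke := locked (- v^-1 *: hT i).

Lemma hHE i : hH i = - v^-1 *: hT i.
Proof. by rewrite /hH -lock. Qed.

Lemma hT_hH i : hT i = - v *: hH i.
Proof. by rewrite hHE scalerA mulrNN mulfV ?hv_neq0 // scale1r. Qed.

Lemma hH_sq i : hH i * hH i = 1 + (v^-1 - v) *: hH i.
Proof.
rewrite hHE -scalerAl -scalerAr hT_sq !scalerDr !scalerA addrC; congr (_ + _ *: _).
  by rewrite -mulrA /hq hH_sq_id1 ?hv_neq0 // scale1r.
by rewrite -mulrA /hq hH_sq_id2 ?hv_neq0.
Qed.

Lemma hH_near i j : j = i.+1 :> nat -> hH i * hH j * hH i = hH j * hH i * hH j.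
Proof.
by move=> ij; rewrite !hHE -!scalerAl -!scalerAr -!scalerAl hT_near.
Qed.

Lemma hH_far i j : (i.+2 <= j)%N -> hH i * hH j = hH j * hH i.
Proof. by move=> ij; rewrite !hHE -!scalerAl -!scalerAr hT_far. Qed.

Lemma bar_hH i : bar (hH i) = hH i + (v - v^-1)%:A.
Proof.
rewrite hHE barZ bar_hT hTV rmorphN fmorphV /= barK_hv invrK.
rewrite scalerDr scalerA scalerDr scalerN scaleNr opprK -addrA -scalerDl.
by rewrite bar_hH_id2 ?bar_hH_id1 ?hv_neq0.
Qed.

Lemma flip_hH i : flip (hH i) = hH i.
Proof. by rewrite hHE flipZ flip_hT. Qed.

Definition hHword u : hecke := \prod_(i <- u) hH i.

Lemma hHword_braid u1 u2 : braid_eq u1 u2 -> hHword u1 = hHword u2.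
Proof.
rewrite /hHword; elim=> {u1 u2} //.
- by move=> u1 u2 u3 _ -> _ ->.
- by move=> i u1 u2 _ IH; rewrite !big_cons IH.
- by move=> i j u ij; rewrite !big_cons !mulrA hH_far.
- by move=> i j u ij; rewrite !big_cons !mulrA hH_near.
Qed.

Definition hHw w : hecke := hHword (xchoose (reduced_expr_ex w)).

Lemma hHw_word u : reduced u -> hHw (word_prod u) = hHword u.
Proof.
move=> ru; apply: hHword_braid; set t := xchoose _.
have /eqP tE : reduced_expr t := xchooseP _.
by apply: matsumoto => //; rewrite /reduced tE size_tuple perm_lenE.
Qed.

Lemma hTw_hHw w : hTw w = (- v) ^+ ninv w *: hHw w.
Proof.
rewrite /hTw /hHw; set t := xchoose _.
have -> : ninv w = size t by rewrite size_tuple perm_lenE.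
rewrite /hHword.
elim: (tval t) => [|i u IH]; first by rewrite !big_nil scale1r.
by rewrite !big_cons IH hT_hH -scalerAl -scalerAr scalerA exprS.
Qed.

Lemma hHw1 : hHw 1%g = 1.
Proof.
rewrite -[1%g]/(word_prod [::]) hHw_word; first by rewrite /hHword big_nil.
by rewrite /reduced /= ninv1.
Qed.

Lemma hH_hHw i w :
  hH i * hHw w = hHw (sl i w) + (if ldes i w then v^-1 - v else 0) *: hHw w.
Proof.
have asc x : ~~ ldes i x -> hH i * hHw x = hHw (sl i x).
  have [u <- ru] := reduced_word_ex x => ai.
  by rewrite -word_prod_cons !hHw_word ?reduced_cons ?ru // /hHword big_cons.
case: ifPn => di; last by rewrite scale0r addr0 asc.
have ai : ~~ ldes i (sl i w) by rewrite ldes_sl di.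
have E : hHw w = hH i * hHw (sl i w) by rewrite asc // slK.
by rewrite {1}E mulrA hH_sq mulrDl mul1r -scalerAl -E.
Qed.

Lemma flip_hHw w : flip (hHw w) = hHw w^-1%g.
Proof.
have [u <- ru] := reduced_word_ex w.
rewrite -word_prod_rev !hHw_word ?reduced_rev // /hHword.
elim: u {ru} => [|i u IH]; first by rewrite !big_nil flip1.
by rewrite rev_cons -cats1 big_cat big_seq1 big_cons flipM IH flip_hH.
Qed.

Lemma hTword_inv u : \prod_(i <- rev u) (hT i : hecke) \is a GRing.unit /\
  (\prod_(i <- rev u) (hT i : hecke))^-1 = \prod_(i <- u) (hT i)^-1.
Proof.
elim: u => [|i u [U E]]; first by rewrite !big_nil unitr1 invr1.
rewrite rev_cons -cats1 big_cat big_seq1 big_cons /= unitrMr ?hT_unit //.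
by rewrite invrM ?hT_unit // E.
Qed.

Lemma hTw_word u : reduced u -> hTw (word_prod u) = \prod_(i <- u) hT i.
Proof.
move=> ru; rewrite hTw_hHw hHw_word // (eqP ru) /hHword.
elim: u {ru} => [|i u IH]; first by rewrite !big_nil scale1r.
by rewrite !big_cons -IH hT_hH -scalerAl -scalerAr scalerA exprS.
Qed.

Lemma bar_hTw w : bar (hTw w) = (hTw w^-1%g)^-1.
Proof.
have [u <- ru] := reduced_word_ex w.
rewrite -word_prod_rev !hTw_word ?reduced_rev // (hTword_inv u).2.
elim: u {ru} => [|i u IH]; first by rewrite !big_nil bar1.
by rewrite !big_cons barM bar_hT IH.
Qed.

(** The regular representation, on functions [f] standing for
    [\sum_y f y *: hHw y].  The function attached to [1] is sent by [hHw y] to the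
    one attached to [y], which shows that the [hHw y] are linearly
    independent. *)
Local Notation fn := ('S_n -> heckeK).

Fixpoint act (x : hterm n) (f : fn) : fn :=
  match x with
  | HCst k => fun y => k * f y
  | HGen i => hT_act v i f
  | HAdd x1 x2 => fun y => act x1 f y + act x2 f y
  | HMul x1 x2 => act x1 (act x2 f)
  end.

Lemma act_ext (x : hterm n) (f1 f2 : fn) : f1 =1 f2 -> act x f1 =1 act x f2.
Proof.
move=> E; elim: x f1 f2 E => [k|i|x1 IH1 x2 IH2|x1 IH1 x2 IH2] f1 f2 E y /=.
- by rewrite E.
- by rewrite /hT_act /hH_act !E.
- by rewrite (IH1 _ f2) // (IH2 _ f2).
- by apply: IH1; apply: IH2.
Qed.

(** Linearity of each operator is needed for right distributivity and for the
    centrality of the scalars. *)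
Lemma act_linear (x : hterm n) k (f1 f2 : fn) y :
  act x (fun z => k * f1 z + f2 z) y = k * act x f1 y + act x f2 y.
Proof.
elim: x f1 f2 y => [c|i|x1 IH1 x2 IH2|x1 IH1 x2 IH2] f1 f2 y /=.
- by rewrite mulrDr mulrCA.
- exact: hT_act_linear.
- by rewrite IH1 IH2 mulrDr addrACA.
- by rewrite -IH1; apply: act_ext => z; rewrite IH2.
Qed.

Lemma act_add (x : hterm n) (f1 f2 : fn) y :
  act x (fun z => f1 z + f2 z) y = act x f1 y + act x f2 y.
Proof.
rewrite -[act x f1 y]mul1r -act_linear.
by apply: act_ext => z; rewrite mul1r.
Qed.

Lemma act_scale (x : hterm n) k (f : fn) y : act x (fun z => k * f z) y = k * act x f y.
Proof.
have E0 : act x (fun=> 0) y = 0.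
  have := act_linear x (-1) (fun=> 0) (fun=> 0) y.
  rewrite (mulN1r (act x _ y)) addNr => H; apply: etrans _ H; apply: act_ext => z.
  by rewrite mulr0 addr0.
rewrite -[RHS]addr0 -[in RHS]E0 -act_linear.
by apply: act_ext => z; rewrite addr0.
Qed.

Lemma heq_act (x y : hterm n) : heq x y -> forall f, act x f =1 act y f.
Proof.
elim=> {x y} /=.
- by [].
- by move=> x y _ IH f z; rewrite IH.
- by move=> x y z _ IH1 _ IH2 f t; rewrite IH1 IH2.
- by move=> x x' y y' _ IH1 _ IH2 f z /=; rewrite IH1 IH2.
- move=> x x' y y' _ IH1 _ IH2 f z /=; rewrite IH1.
  by apply: act_ext => t; rewrite IH2.
- by move=> x y z f t /=; rewrite addrA.
- by move=> x y f t /=; rewrite addrC.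
- by move=> x f t /=; rewrite mul0r add0r.
- by move=> x f t /=; rewrite mulN1r addNr mul0r.
- by [].
- by move=> x f t /=; rewrite mul1r.
- by [].
- by move=> x y z f t /=; rewrite act_add.
- by move=> a b f t /=; rewrite mulrDl.
- by move=> a b f t /=; rewrite mulrA.
- by move=> a x f t /=; rewrite act_scale.
- by move=> i f t /=; rewrite mul0r /hq (hT_act_quad hv_neq0).
- by move=> i j ij f t; apply: hT_act_near; rewrite ?hv_neq0.
- by move=> i j ij f t; apply: hT_act_far.
Qed.

(** The coefficient of [hHw y], read off from the regular representation. *)
Definition hcoef y (a : hecke) : heckeK :=
  act (generic_quotient.repr a) (fun z => (z == 1%g)%:R) y.

Lemma hcoef_pi y (x : hterm n) : hcoef y (\pi_(hecke) x)%qT = act x (fun z => (z == 1%g)%:R) y.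
Proof. by apply: heq_act; apply: heq_repr. Qed.

Lemma hcoefD y : {morph hcoef y : a b / a + b}.
Proof.
by elim/hquotW=> a; elim/hquotW=> b; rewrite -[_ + _]/(hadd _ _) haddE !hcoef_pi.
Qed.

Lemma hcoefZ y k a : hcoef y (k *: a) = k * hcoef y a.
Proof.
by elim/hquotW: a => a; rewrite -[k *: _]/(hmul (hcst n k) _) hmulE !hcoef_pi.
Qed.

Lemma hcoef0 y : hcoef y 0 = 0.
Proof. by rewrite -(scale0r 0) hcoefZ mul0r. Qed.

Lemma hcoef_sum y I (r : seq I) (P : pred I) (F : I -> hecke) :
  hcoef y (\sum_(k <- r | P k) F k) = \sum_(k <- r | P k) hcoef y (F k).
Proof. exact: (big_morph _ (hcoefD y) (hcoef0 y)). Qed.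

Lemma hcoef_hH y i a :
  hcoef y (hH i * a) = hcoef (sl i y) a + (if ldes i y then (v^-1 - v) * hcoef y a else 0).
Proof.
elim/hquotW: a => a; rewrite hHE -scalerAl hcoefZ -[hT i * _]/(hmul _ _) hmulE.
rewrite hcoef_pi /= /hT_act mulrA mulrNN mulVf ?hv_neq0 // mul1r /hH_act.
by rewrite !hcoef_pi.
Qed.

Lemma hcoef_hHw y w : hcoef y (hHw w) = (y == w)%:R.
Proof.
have [u <- ru] := reduced_word_ex w; rewrite hHw_word // /hHword.
elim: u y ru => [|i u IH] y.
  by rewrite big_nil -[1]/(hcst n 1) hcoef_pi /= mul1r.
rewrite reduced_cons big_cons => /andP[ru ai].
rewrite hcoef_hH !IH // word_prod_cons (can2_eq (slK i) (slK i)).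
case: ifP => [di|_]; rewrite ?addr0 //.
have [E|ne] := eqVneq y (word_prod u); first by rewrite E (negPf ai) in di.
by rewrite mulr0 addr0.
Qed.

Lemma hecke_ind (P : hecke -> Prop) :
  (forall k, P k%:A) -> (forall i, P (hT i)) ->
  (forall a b, P a -> P b -> P (a + b)) -> (forall a b, P a -> P b -> P (a * b)) ->
  forall a, P a.
Proof.
move=> Pc Pg PD PM; elim/hquotW; elim=> [k|i|x IHx y IHy|x IHx y IHy].
- by move: (Pc k); rewrite -hcstE.
- exact: Pg.
- by rewrite -haddE; apply: PD.
- by rewrite -hmulE; apply: PM.
Qed.

Lemma bar_flip a : bar (flip a) = flip (bar a).
Proof.
elim/hecke_ind: a => [k|i|a b IHa IHb|a b IHa IHb].
- by rewrite flipZ flip1 !barZ !bar1 flipZ flip1.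
- rewrite flip_hT bar_hT hTV flipD flipZ flipD flip_hT flip1.
  by rewrite -[X in _ = _ + X]/(flip (- 1)) -scaleN1r flipZ flip1.
- by rewrite flipD !barD flipD IHa IHb.
- by rewrite flipM !barM flipM IHa IHb.
Qed.

(** The bar involution is unitriangular with respect to the length, because it adds
    a scalar to each generator. *)
Lemma hcoef_bar_hHw y w :
  (ninv w <= ninv y)%N -> hcoef y (bar (hHw w)) = (y == w)%:R.
Proof.
have [u <- ru] := reduced_word_ex w.
elim: u y ru => [|i u IH] y.
  by rewrite -[word_prod [::]]/1%g hHw1 bar1 -hHw1 hcoef_hHw.
rewrite reduced_cons => /andP[ru ai]; rewrite word_prod_cons (ninv_asc ai) => le.
have -> : hHw (sl i (word_prod u)) = hH i * hHw (word_prod u).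
  by rewrite hH_hHw (negPf ai) scale0r addr0.
have uy : (y == word_prod u) = false by apply/eqP => E; move: le; rewrite E ltnn.
rewrite barM bar_hH mulrDl mulr_algl hcoefD hcoef_hH hcoefZ (IH y) ?(ltnW le) //.
rewrite uy !mulr0 if_same !addr0 IH ?(can2_eq (slK i) (slK i)) //.
by have := ninv_sl_le i (sl i y); rewrite slK; lia.
Qed.

End StandardBasis.

(** * Kazhdan-Lusztig elements *)

Lemma barK_eval (p : {poly int}) c : barK (eval_at p c) = eval_at p (barK c).
Proof.
rewrite /eval_at -horner_map -map_poly_comp /=; congr (_.[_]).
by apply: eq_map_poly => m /=; rewrite rmorph_int.
Qed.

Definition evv (p : {poly int}) : heckeK := eval_at p hv.

Lemma evv_zmod : zmod_morphism evv.
Proof. by move=> p q; rewrite /evv /eval_at rmorphB hornerD hornerN. Qed.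
Lemma evv_monoid : monoid_morphism evv.
Proof.
by split=> [|p q]; rewrite /evv /eval_at ?rmorph1 ?hornerC // rmorphM hornerM.
Qed.
HB.instance Definition _ := GRing.isZmodMorphism.Build {poly int} heckeK evv evv_zmod.
HB.instance Definition _ := GRing.isMonoidMorphism.Build {poly int} heckeK evv evv_monoid.

Lemma evvX : evv 'X = hv.
Proof. by rewrite /evv /eval_at map_polyX hornerX. Qed.

Lemma evvC (c : int) : evv c%:P = c%:~R.
Proof. by rewrite /evv /eval_at map_polyC hornerC. Qed.

Lemma evvE (p : {poly int}) : evv p = FracField.tofrac (map_poly intr p : {poly rat}).
Proof.
elim/poly_ind: p => [|p c IH]; first by rewrite !rmorph0.
rewrite rmorphD rmorphM /= evvX evvC IH !rmorphD !rmorphM /= map_polyX map_polyC /=.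
by rewrite !rmorph_int.
Qed.

Lemma evv_inj : injective evv.
Proof.
move=> p q; rewrite !evvE => /eqP; rewrite tofrac_eq => /eqP.
by apply: map_inj_poly; [exact: intr_inj|].
Qed.

Lemma hecke_int_inj : injective (fun m : int => m%:~R : heckeK).
Proof. by move=> a b; rewrite /= -!evvC => /evv_inj/polyC_inj. Qed.

Lemma evv_bar (p : {poly int}) : barK (evv p) = inv_eval (map_poly intr p).
Proof.
rewrite barK_eval barK_hv /eval_at /= /horner_eval -map_poly_comp /=.
by congr (_.[_]); apply: eq_map_poly => m /=; rewrite !rmorph_int.
Qed.

(** Multiplied by [v ^ size p], the equation equates a polynomial of degree
    [2 size p - 1] and one of degree at most [size p]. *)
Lemma bar_fixed (p : {poly int}) : p`_0 = 0 -> barK (evv p) = evv p -> p = 0.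
Proof.
move=> p0 E; apply/eqP; apply: contraT => pn0.
have := inv_evalE (map_poly intr p); rewrite -evv_bar E evvE -!rmorphXn -!rmorphM.
set P : {poly rat} := map_poly intr p.
have szP : size P = size p by apply: size_map_inj_poly; [exact: intr_inj|].
move/eqP; rewrite tofrac_eq szP => /eqP/(congr1 (fun q : {poly rat} => size q)).
rewrite size_mulXn ?szP; last by rewrite -size_poly_eq0 szP size_poly_eq0.
rewrite mulrC; have := size_poly (size p) (fun i => P`_(size p - i.+1)).
set Q := \poly_(i < _) _ => szQ szE.
have : (size (Q * 'X)%R <= (size p).+1)%N.
  by rewrite (leq_trans (size_polyMleq _ _)) // size_polyX addn2.
rewrite -szE => le; have sz1 : (size p <= 1)%N by lia.
by move: pn0; rewrite (size1_polyC sz1) p0 eqxx.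
Qed.

Section FieldIdentities.
Variables (F : fieldType) (v : F).
Hypothesis v0 : v != 0.

Lemma bH_id1 : v^-1 - v + v + v = v + v^-1.
Proof. by ring. Qed.

Lemma bH_id2 : v * v + 1 = (v + v^-1) * v.
Proof. by field. Qed.

Lemma C_left_id a b (e : F) : (b <= a)%N ->
  (-1) ^+ (a - b) * (v ^+ a * v ^- b.*2) * e * (- v) ^+ b = (-1) ^+ a * (v ^+ (a - b) * e).
Proof.
move=> ba; rewrite -{2 3}(subnK ba) [(- v) ^+ b]exprNn !exprD -muln2 exprM.
have -> : (v ^+ b) ^+ 2 = v ^+ b * v ^+ b by rewrite expr2.
have vb : v ^+ b != 0 by rewrite expf_neq0.
by field.
Qed.

End FieldIdentities.

Section KLElements.
Variable n : nat.
Local Notation hecke := (hecke n).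
Local Notation v := hv.
Implicit Types (w x y z : 'S_n) (i j : 'I_n.-1) (f g : 'S_n -> {poly int}).

Definition comb f : hecke := \sum_y evv (f y) *: hHw y.

Lemma hcoef_comb y f : hcoef y (comb f) = evv (f y).
Proof.
rewrite hcoef_sum (bigD1 y) //= hcoefZ hcoef_hHw eqxx mulr1 big1 ?addr0 // => z.
by rewrite eq_sym => /negPf zy; rewrite hcoefZ hcoef_hHw zy mulr0.
Qed.

Lemma combB f g : comb f - comb g = comb (fun y => f y - g y).
Proof. by rewrite /comb -sumrB; apply: eq_bigr => y _; rewrite rmorphB scalerBl. Qed.

Lemma comb_scale p f : evv p *: comb f = comb (fun y => p * f y).
Proof. by rewrite /comb scaler_sumr; apply: eq_bigr => y _; rewrite rmorphM scalerA. Qed.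

Lemma comb_sum (P : pred 'S_n) (F : 'S_n -> 'S_n -> {poly int}) :
  \sum_(z | P z) comb (F z) = comb (fun y => \sum_(z | P z) F z y).
Proof.
rewrite /comb exchange_big; apply: eq_bigr => y _ /=.
by rewrite raddf_sum scaler_suml.
Qed.

(** On a longest element of the support, unitriangularity leaves an equation that
    [bar_fixed] excludes. *)
Lemma bar_comb_inj f :
  bar (comb f) = comb f -> (forall y, (f y)`_0 = 0) -> forall y, f y = 0.
Proof.
move=> fbar f0 y0; apply/eqP; apply: contraT => fy0.
have [y fy ymax] := @arg_maxnP _ y0 (fun z => f z != 0) (@ninv n) fy0.
case/eqP: fy; apply: bar_fixed (f0 y) _.
rewrite -[RHS]hcoef_comb -fbar bar_sum hcoef_sum (bigD1 y) //= barZ hcoefZ.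
rewrite hcoef_bar_hHw // eqxx mulr1 big1 ?addr0 // => z zy; rewrite barZ hcoefZ.
have [->|fz] := eqVneq (f z) 0; first by rewrite !rmorph0 mul0r.
rewrite hcoef_bar_hHw; last exact: ymax.
by rewrite eq_sym (negPf zy) mulr0.
Qed.

(** The characterization of the Kazhdan-Lusztig element of [w] by its
    coefficients [f y = v ^ (l w - l y) * P_{y,w} (v ^ -2)]. *)
Record is_KL_elt w f : Prop := IsKLElt {
  KLe_bar : bar (comb f) = comb f;
  KLe_coef0 : forall y, (f y)`_0 = (y == w)%:R;
  KLe_supp : forall y k, (f y)`_k != 0 ->
    [/\ bruhat_le y w, (k + ninv y <= ninv w)%N & ~~ odd (k + ninv y + ninv w)]
}.

Lemma KL_elt_uniq w f g : is_KL_elt w f -> is_KL_elt w g -> f = g.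
Proof.
move=> [fb f0 _] [gb g0 _].
suff H y : f y - g y = 0 by apply: funext => y; apply/eqP; rewrite -subr_eq0 H.
move: y; apply: bar_comb_inj => [|y]; last by rewrite coefB f0 g0 subrr.
by rewrite -combB barD barN fb gb.
Qed.

Lemma KL_elt_diag w f : is_KL_elt w f -> f w = 1.
Proof.
move=> [_ f0 fs]; apply/polyP => [[|k]]; first by rewrite f0 eqxx coef1.
rewrite coef1; apply/eqP; apply: contraT => /fs[_].
by rewrite leqNgt -[X in (X < _)%N]add0n ltn_add2r.
Qed.

Lemma KL_elt_out w f y : is_KL_elt w f -> ~~ bruhat_le y w -> f y = 0.
Proof.
move=> [_ _ fs] out; apply/polyP => k; rewrite coef0; apply/eqP.
by apply: contraNT out => /fs[].
Qed.

Lemma KL_elt_mu_lt w f y : is_KL_elt w f -> (f y)`_1 != 0 -> bruhat_lt y w.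
Proof.
move=> fw fy1; apply/andP; split; last by have [_ _ fs] := fw; case: (fs _ _ fy1).
by apply: contraNneq fy1 => ->; rewrite (KL_elt_diag fw) coef1.
Qed.

Definition bH i : hecke := hH i + v%:A.

Lemma bar_bH i : bar (bH i) = bH i.
Proof.
rewrite /bH barD bar_hH barZ bar1 barK_hv -addrA -scalerDl.
by rewrite subrK.
Qed.

Lemma bH_sq i : bH i * bH i = (v + v^-1) *: bH i.
Proof.
rewrite /bH mulrDl !mulrDr mulr_algl mulr_algr hH_sq mulr_algl scalerA.
rewrite -!addrA addrC -!addrA.
rewrite -[X in _ + (_ + (_ + (_ + X)))]scale1r -scalerDl !addrA -!scalerDl.
by rewrite scalerDr scalerA bH_id1 ?bH_id2 ?hv_neq0.
Qed.

Lemma bH_comb i f : bH i * comb f =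
  \sum_y (evv (f (sl i y)) + (if ldes i y then v^-1 else v) * evv (f y)) *: hHw y.
Proof.
rewrite /comb /bH mulr_sumr.
under eq_bigr => y _.
  rewrite -scalerAr mulrDl mulr_algl hH_hHw -addrA -scalerDl scalerDr scalerA.
  over.
rewrite big_split /= (reindex_inj (inv_inj (slK i))) /= -big_split /=.
apply: eq_bigr => y _; rewrite slK scalerDl; congr (_ + _ *: _).
by rewrite mulrC; case: ifP => _; rewrite ?subrK ?add0r.
Qed.

(** One step of the recursion over the length, which multiplies by [bH i] and
    subtracts the multiples of lower elements that restore the absence of
    constant terms. *)
Definition KL_step i w (F : 'S_n -> 'S_n -> {poly int}) y : {poly int} :=
  (if ldes i y then F w (sl i y) + drop_poly 1 (F w y)
   else F w (sl i y) + 'X * F w y)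
  - \sum_(z | ldes i z && bruhat_lt z w) ((F w z)`_1)%:P * F z y.

Lemma comb_KL_step i w F : ~~ ldes i w -> is_KL_elt w (F w) ->
  comb (KL_step i w F) =
  bH i * comb (F w) - \sum_(z | ldes i z && bruhat_lt z w) evv ((F w z)`_1)%:P *: comb (F z).
Proof.
move=> ai Fw; rewrite /KL_step -combB; congr (_ - _); last first.
  by rewrite -comb_sum; apply: eq_bigr => z _; rewrite comb_scale.
rewrite bH_comb; apply: eq_bigr => y _; congr (_ *: _).
case: ifP => di; rewrite rmorphD; congr (_ + _); last by rewrite rmorphM /= evvX.
have E : F w y = 'X * drop_poly 1 (F w y).
  apply/polyP => [[|k]]; rewrite coefXM /= ?coef_drop_poly ?addn1 //.
  by rewrite (KLe_coef0 Fw); case: eqP ai => // <-; rewrite di.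
by rewrite [in RHS]E rmorphM /= evvX mulrA mulVf ?hv_neq0 // mul1r.
Qed.

Lemma KL_step_coef i w F y k :
  (KL_step i w F y)`_k = (F w (sl i y))`_k
    + (if ldes i y then (F w y)`_k.+1 else if k is k'.+1 then (F w y)`_k' else 0)
    - \sum_(z | ldes i z && bruhat_lt z w) (F w z)`_1 * (F z y)`_k.
Proof.
rewrite /KL_step coefB coef_sum; congr (_ - _); last first.
  by apply: eq_bigr => z _; rewrite coefCM.
case: ifP => _; rewrite coefD; first by rewrite coef_drop_poly addn1.
by rewrite coefXM; case: k.
Qed.

(** The subtracted multiples remove exactly the constant terms at the elements
    [z < w] with [s_i z < z]; the one at [s_i w] remains, and is [1]. *)
Lemma KL_stepP i w F : ~~ ldes i w -> is_KL_elt w (F w) ->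
  (forall z, bruhat_lt z w -> is_KL_elt z (F z)) ->
  is_KL_elt (sl i w) (KL_step i w F).
Proof.
move=> ai Fw Fz; split.
- rewrite comb_KL_step // barD barN barM bar_bH (KLe_bar Fw) bar_sum.
  congr (_ - _); apply: eq_bigr => z /andP[_ zw].
  by rewrite barZ (KLe_bar (Fz z zw)) evvC rmorph_int.
- move=> y; rewrite KL_step_coef (KLe_coef0 Fw) (can2_eq (slK i) (slK i)).
  have sumE : \sum_(z | ldes i z && bruhat_lt z w) (F w z)`_1 * (F z y)`_0
    = if ldes i y then (F w y)`_1 else 0.
    have -> : (if ldes i y then (F w y)`_1 else 0)
      = if ldes i y && bruhat_lt y w then (F w y)`_1 else 0.
      case: (ldes i y) => //=; case: ifP => // nlt.
      by apply/eqP; apply: contraFT nlt => /(KL_elt_mu_lt Fw).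
    rewrite big_mkcond /= (bigD1 y) //= big1 => [|z zy]; last first.
      case: ifP => // /andP[_ zw]; rewrite (KLe_coef0 (Fz z zw)).
      by rewrite eq_sym (negPf zy) mulr0.
    rewrite addr0; case: ifP => // /andP[_ yw].
    by rewrite (KLe_coef0 (Fz y yw)) eqxx mulr1.
  rewrite sumE; case: ifP => di; first by rewrite addrK.
  by rewrite addr0 subr0.
- move=> y k; rewrite KL_step_coef => nz.
  have ninvw := ninv_asc ai.
  have [Tz|] := eqVneq (F w (sl i y))`_k 0; last first.
    move=> /(KLe_supp Fw)[le1 le2 par]; have [_] := bruhat_sl_up ai le1.
    rewrite slK ninvw => le; split=> //;
      by case: (boolP (ldes i y)) le2 par => [/ninv_des|/ninv_asc] E; lia.
  have [Uz|Un] := eqVneq (if ldes i y then (F w y)`_k.+1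
     else if k is k'.+1 then (F w y)`_k' else 0) 0; last first.
    have : exists2 k', (F w y)`_k' != 0 & (k' = k.+1 \/ k = k'.+1).
      move: Un; case: ifP => _; first by exists k.+1; auto.
      by case: k {nz Tz} => [|k]; rewrite ?eqxx //; exists k; auto.
    case=> k' /(KLe_supp Fw)[le1 le2 par] kk; have [le _] := bruhat_sl_up ai le1.
    by rewrite ninvw; split=> //; case: kk le2 par; lia.
  move: nz; rewrite Tz Uz addr0 sub0r oppr_eq0 => nz.
  have /existsP[z /and3P[/andP[_ zw] m1 m2]] : [exists z,
      [&& ldes i z && bruhat_lt z w, (F w z)`_1 != 0 & (F z y)`_k != 0]].
    apply: contraNT nz => /existsPn no; apply/eqP; rewrite big1 // => z zP.
    move: (no z); rewrite zP /= negb_and !negbK.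
    by case/orP => /eqP->; rewrite ?mul0r ?mulr0.
  have [l1 l2 l3] := KLe_supp Fw m1; have [l4 l5 l6] := KLe_supp (Fz z zw) m2.
  have [le _] := bruhat_sl_up ai (bruhat_trans l4 l1).
  by rewrite ninvw; split=> //; lia.
Qed.

Lemma KL_elt1 : is_KL_elt 1%g (fun y => (y == 1%g)%:R).
Proof.
have E : comb (fun y => (y == 1%g)%:R) = 1.
  rewrite /comb (bigD1 1%g) //= eqxx rmorph1 scale1r hHw1 big1 ?addr0 // => y.
  by move/negPf->; rewrite rmorph0 scale0r.
split=> [|y|y k]; first by rewrite E bar1.
- by case: eqP; rewrite ?coef0 ?coef1.
- have [->|_] := eqVneq y 1%g; rewrite ?coef0 ?eqxx // coef1.
  case: k => // _; split; rewrite ?bruhat_refl //; lia.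
Qed.

(** Induction over the length, peeling off a left descent. *)
Lemma KL_elts_ex : exists F, forall w, is_KL_elt w (F w).
Proof.
suff H k : exists F, forall w, (ninv w < k)%N -> is_KL_elt w (F w).
  have [F FP] := H (\max_(w : 'S_n) ninv w).+1.
  by exists F => w; apply: FP; rewrite ltnS; apply: (leq_bigmax w).
elim: k => [|k [F FP]]; first by exists (fun _ _ => 0).
suff /choice[G GP] : forall w, exists f, (ninv w < k.+1)%N -> is_KL_elt w f.
  by exists G.
move=> w; case: (leqP k.+1 (ninv w)) => [_|wk]; first by exists (F w).
have [->|/exists_ldes[i di]] := eqVneq w 1%g.
  by exists (fun y => (y == 1%g)%:R) => _; apply: KL_elt1.
have lt := ninv_des di.
exists (KL_step i (sl i w) F) => _; rewrite -{1}(slK i w); apply: KL_stepP.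
- by rewrite ldes_sl di.
- by apply: FP; lia.
- by move=> z /bruhat_lt_ninv zw; apply: FP; lia.
Qed.

(** ** Comparison with the polynomials in [q] *)

(** [to_v m] and [of_v m] translate between a polynomial [P] in [q] and
    [v ^ m * P (v ^ -2)], for [2 deg P <= m]. *)
Definition to_v (m : nat) (P : {poly int}) : {poly int} :=
  \sum_(k < m./2.+1) P`_k *: 'X^(m - k.*2).

Definition of_v (m : nat) (f : {poly int}) : {poly int} :=
  \poly_(k < m./2.+1) f`_(m - k.*2).

Lemma coef_to_v m P (j : nat) : (to_v m P)`_j =
  if (j <= m)%N && ~~ odd (m - j) then P`_(m - j)./2 else 0.
Proof.
rewrite /to_v coef_sum; case: ifP => [/andP[jm ev]|nj].
  have lt : ((m - j)./2 < m./2.+1)%N by rewrite ltnS half_leq ?leq_subr.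
  rewrite (bigD1 (Ordinal lt)) //= coefZ coefXn even_halfK // subKn // eqxx mulr1.
  rewrite big1 ?addr0 // => k kn; rewrite coefZ coefXn.
  case: eqP => [jE|_]; last by rewrite mulr0.
  case/eqP: kn; apply: val_inj => /=; have := ltn_ord k; rewrite jE => ltk.
  by rewrite subKn ?doubleK //; lia.
rewrite big1 // => k _; rewrite coefZ coefXn; case: eqP => [jE|_]; last by rewrite mulr0.
have := ltn_ord k; move: nj; rewrite jE leq_subr /= => nj ltk.
by move: nj; rewrite subKn ?odd_double //; lia.
Qed.

Lemma evv_to_v m (P : {poly int}) : (size P <= m./2.+1)%N -> hv ^+ m * eval_at P hq^-1 = evv (to_v m P).
Proof.
move=> szP; rewrite /to_v rmorph_sum /eval_at.
have -> : map_poly intr P = \poly_(k < m./2.+1) (P`_k)%:~R :> {poly heckeK}.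
  apply/polyP => k; rewrite coef_map coef_poly /=; case: ltnP => // le.
  by rewrite nth_default ?rmorph0 // (leq_trans szP).
rewrite horner_poly mulr_sumr; apply: eq_bigr => k _.
rewrite -mul_polyC rmorphM rmorphXn /= evvX evvC mulrCA; congr (_ * _).
have le : (k.*2 <= m)%N by have := ltn_ord k; lia.
rewrite /hq exprVn -exprM mul2n -{1}(subnK le) exprD mulfK //.
by rewrite expf_neq0 ?hv_neq0.
Qed.

Lemma to_vK m (f : {poly int}) :
  (forall k, f`_k != 0 -> (k <= m)%N && ~~ odd (m - k)) -> to_v m (of_v m f) = f.
Proof.
move=> supp; apply/polyP => j; rewrite coef_to_v /of_v coef_poly.
have [fj|/supp jm] := eqVneq f`_j 0; last first.
  rewrite jm; case/andP: jm => jm ev; rewrite ltnS half_leq ?leq_subr //.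
  by rewrite even_halfK // subKn.
case: ifP => // /andP[jm ev]; rewrite ltnS half_leq ?leq_subr //.
by rewrite even_halfK // subKn // fj.
Qed.

(** The sign and the powers of [v] in the definition of [C_w] are absorbed by the
    normalization of the basis, up to the sign of [w]. *)
Lemma C_left_comb (P : 'S_n -> 'S_n -> {poly int}) w :
  (forall y, ~~ bruhat_le y w -> P y w = 0) ->
  (forall y, bruhat_le y w -> (size (P y w) <= (ninv w - ninv y)./2.+1)%N) ->
  C_left P w = (- 1) ^+ ninv w *: comb (fun y => to_v (ninv w - ninv y) (P y w)).
Proof.
move=> supp szP; rewrite /C_left /comb scaler_sumr big_mkcond; apply: eq_bigr => y _.
case: ifPn => [le|/supp->]; last first.
  have -> : to_v (ninv w - ninv y) 0 = 0.
    by rewrite /to_v big1 // => k _; rewrite coef0 scale0r.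
  by rewrite rmorph0 scale0r scaler0.
rewrite hTw_hHw -evv_to_v ?szP // !scalerA /half_exp !perm_lenE; congr (_ *: _).
have ley := leq_of_leqif (bruhat_ninv le).
rewrite expfzDr ?hv_neq0 // -exprnN -exprnP.
exact: (C_left_id hv_neq0 _ ley).
Qed.

Lemma C_right_bar (P : 'S_n -> 'S_n -> {poly int}) w : C_right P w = bar (C_left P w).
Proof.
rewrite /C_right /C_left bar_sum; apply: eq_bigr => y _.
rewrite barZ bar_hTw; congr (_ *: _).
rewrite !rmorphM /= rmorphXn rmorphN1 barK_eval fmorphV /= barK_hq invrK.
by rewrite fmorphXz /= barK_hv exprz_inv.
Qed.

Lemma KL_family_ex : exists P : 'S_n -> 'S_n -> {poly int}, is_KL_family P.
Proof.
have [F FP] := KL_elts_ex.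
pose P y w := of_v (ninv w - ninv y) (F w y).
have toP w : (fun y => to_v (ninv w - ninv y) (P y w)) = F w.
  apply: funext => y; apply: to_vK => k /(KLe_supp (FP w))[_ le par].
  by lia.
have supp y w : ~~ bruhat_le y w -> P y w = 0.
  move=> /(KL_elt_out (FP w)) E; rewrite /P E; apply/polyP => k.
  by rewrite coef_poly !coef0 if_same.
exists P; split=> //.
- move=> w; rewrite /P subnn (KL_elt_diag (FP w)); apply/polyP => [[|k]].
    by rewrite coef_poly coef1.
  by rewrite coef_poly coef1.
- move=> y w yw; rewrite !perm_lenE; have lt := bruhat_lt_ninv yw.
  have [->|Pn0] := eqVneq (P y w) 0; first by rewrite size_poly0.
  have : lead_coef (P y w) != 0 by rewrite lead_coef_eq0.
  rewrite lead_coefE coef_poly; case: ifP; last by rewrite eqxx.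
  rewrite ltnS => le nz; have : (ninv w - ninv y - (size (P y w)).-1.*2 != 0)%N.
    apply: contraNneq nz => ->; rewrite (KLe_coef0 (FP w)).
    by case/andP: yw => /negPf->.
  rewrite subn_eq0 -ltnNge => h; rewrite subn1 -ltnS prednK ?subn_gt0 //.
- move=> w; rewrite C_right_bar C_left_comb => [|y|y _]; last 2 first.
  + exact: supp.
  + exact: size_poly.
  by rewrite toP barZ rmorphXn rmorphN1 (KLe_bar (FP w)).
Qed.

Lemma KL_polyP : is_KL_family (@KL_poly n).
Proof. by have [P PP] := KL_family_ex; apply: (xgetPex _ (ex_intro _ P PP)). Qed.

(** The polynomial [v ^ (l w - l y) * P_{y,w} (v ^ -2)]. *)
Definition kl w y : {poly int} := to_v (ninv w - ninv y) (KL_poly y w).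

Lemma kl_elt w : is_KL_elt w (kl w).
Proof.
have [supp diag deg kbar] := KL_polyP.
have szP y : bruhat_le y w -> (size (KL_poly y w) <= (ninv w - ninv y)./2.+1)%N.
  have [->|yw le] := eqVneq y w; first by rewrite diag size_poly1.
  have lt : bruhat_lt y w by rewrite /bruhat_lt yw le.
  by have := deg _ _ lt; rewrite !perm_lenE; lia.
split.
- have := kbar w; rewrite C_right_bar C_left_comb //; last by move=> y; apply: supp.
  rewrite barZ rmorphXn rmorphN1 => /(congr1 (fun a => (-1) ^+ ninv w *: a)).
  by rewrite !scalerA -exprMn mulrNN mulr1 expr1n !scale1r => <-.
- move=> y; rewrite /kl coef_to_v leq0n subn0 /=.
  have [->|yw] := eqVneq y w; first by rewrite subnn diag coef1.
  case: ifP => // ev; have [le|nle] := boolP (bruhat_le y w); last by rewrite supp ?coef0.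
  have lt : bruhat_lt y w by rewrite /bruhat_lt yw le.
  have := deg _ _ lt; rewrite !perm_lenE => dg; rewrite nth_default //.
  by move: dg ev (bruhat_lt_ninv lt); move: (size _) (ninv w) (ninv y) => a b c; lia.
- move=> y k; rewrite /kl coef_to_v; case: ifP => [/andP[le ev]|]; last by rewrite eqxx.
  have [ley|nle] := boolP (bruhat_le y w); last by rewrite supp ?coef0 ?eqxx.
  have := leq_of_leqif (bruhat_ninv ley).
  by move=> ? _; split=> //; lia.
Qed.

(** At most one of the summands is not zero, because their supports are
    [z < w] and [w < z]; so this is the symmetric form of [mu]. *)
Definition mut z w : int := (kl w z)`_1 + (kl z w)`_1.

Lemma mutC z w : mut z w = mut w z.
Proof. by rewrite /mut addrC. Qed.

Lemma KL_muE y w : bruhat_lt y w -> KL_mu y w = (kl w y)`_1.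
Proof.
move=> lt; rewrite /KL_mu lt /= !perm_lenE /kl coef_to_v.
have := bruhat_lt_ninv lt => ltn.
have -> : (0 < ninv w - ninv y)%N by rewrite subn_gt0.
by have -> : odd (ninv w - ninv y) = ~~ odd (ninv w - ninv y - 1) by lia.
Qed.

Lemma kl1_out y w : ~~ bruhat_lt y w -> (kl w y)`_1 = 0.
Proof.
by move=> nlt; apply/eqP; apply: contraNT nlt => /(KL_elt_mu_lt (kl_elt w)).
Qed.

Lemma mu_neq0E y w : mu_neq0 y w = (mut y w != 0).
Proof.
rewrite /mu_neq0 /mut; case: (boolP (bruhat_lt y w)) => [lt|nlt] /=.
  have nlt : ~~ bruhat_lt w y.
    by apply/negP => /bruhat_lt_ninv; have := bruhat_lt_ninv lt; lia.
  by rewrite (negPf nlt) (kl1_out nlt) KL_muE //= addr0 orbF.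
rewrite (kl1_out nlt) add0r; case: (boolP (bruhat_lt w y)) => [lt|/kl1_out->].
  by rewrite KL_muE.
by rewrite eqxx.
Qed.

(** ** Multiplication by the generators *)

Definition bKL w : hecke := comb (kl w).

Lemma bH_asc i w : ~~ ldes i w -> bH i * bKL w =
  bKL (sl i w) + \sum_(z | ldes i z && bruhat_lt z w) evv ((kl w z)`_1)%:P *: bKL z.
Proof.
move=> ai; have E : comb (KL_step i w kl) = bKL (sl i w).
  congr comb; apply: KL_elt_uniq (kl_elt _).
  by apply: KL_stepP => // *; apply: kl_elt.
by rewrite -E comb_KL_step ?subrK //; apply: kl_elt.
Qed.

(** Induction over the length: [bKL w] is [bH i * bKL (s_i w)] minus multiples of
    elements with the descent [i], and [bH i] is an eigenvector of the left
    multiplication by itself. *)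
Lemma bKL_des i w : ldes i w -> bH i * bKL w = (v + v^-1) *: bKL w.
Proof.
have [k] : exists k, (ninv w <= k)%N by eexists.
elim: k w => [|k IH] w wk di; first by move: wk; rewrite -(ninv_des di).
have ai : ~~ ldes i (sl i w) by rewrite ldes_sl di.
have := bH_asc ai; rewrite slK => /esym/(canRL (addrK _)) E.
rewrite {1}E mulrBr mulrA bH_sq -scalerAl E scalerBr; congr (_ - _).
rewrite mulr_sumr scaler_sumr; apply: eq_bigr => z /andP[dz zw].
rewrite -scalerAr IH // ?scalerA 1?mulrC //.
by have := bruhat_lt_ninv zw; have := ninv_des di; lia.
Qed.

(** Comparing coefficients at [x] in [bKL_des] gives [kl w x = v * kl w (s_i x)],
    whose coefficient of [v] is the constant term of [kl w (s_i x)]. *)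
Lemma kl1_des i w x : ldes i w -> ~~ ldes i x -> (kl w x)`_1 = (sl i x == w)%:R.
Proof.
move=> di ax; have := congr1 (hcoef x) (bKL_des di).
rewrite hcoefZ {1}/bH mulrDl mulr_algl hcoefD hcoefZ hcoef_hH (negPf ax) addr0 !hcoef_comb.
rewrite mulrDl addrC => /addrI E.
have -> : kl w x = 'X * kl w (sl i x).
  by apply: evv_inj; rewrite rmorphM /= evvX E mulrA mulfV ?hv_neq0 // mul1r.
by rewrite coefXM /= (KLe_coef0 (kl_elt w)).
Qed.

(** By [kl1_des] the only [z > w] with descent [i] and a nonzero weight is
    [s_i w], which accounts for the leading term of [bH_asc]. *)
Lemma bKL_asc i w : ~~ ldes i w ->
  bH i * bKL w = \sum_(z : 'S_n | ldes i z) (mut z w)%:~R *: bKL z.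
Proof.
move=> ai; rewrite bH_asc //.
have -> : \sum_(z : 'S_n | ldes i z) (mut z w)%:~R *: bKL z =
  \sum_(z : 'S_n | ldes i z) ((sl i w == z)%:R *: bKL z + ((kl w z)`_1)%:~R *: bKL z).
  apply: eq_bigr => z dz; rewrite /mut (kl1_des dz ai) -scalerDl addrC rmorphD /=.
  by rewrite rmorph_nat.
rewrite big_split /=; congr (_ + _).
  rewrite (bigD1 (sl i w)) ?ldes_sl //= eqxx scale1r big1 ?addr0 // => z /andP[_].
  by rewrite eq_sym => /negPf->; rewrite scale0r.
rewrite [RHS](bigID (fun z => bruhat_lt z w)) /= [X in _ = _ + X]big1 ?addr0 => [|z /andP[_ nlt]].
  by apply: eq_bigr => z _; rewrite evvC.
by rewrite kl1_out // scale0r.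
Qed.

Lemma bKL_free (c : 'S_n -> heckeK) :
  \sum_z c z *: bKL z = 0 -> forall z, c z = 0.
Proof.
move=> E z0; apply/eqP; apply: contraT => cz0.
have [z cz zmax] := @arg_maxnP _ z0 (fun z => c z != 0) (@ninv n) cz0.
case/eqP: cz; have := congr1 (hcoef z) E; rewrite hcoef_sum hcoef0 (bigD1 z) //=.
rewrite hcoefZ hcoef_comb (KL_elt_diag (kl_elt z)) rmorph1 mulr1 big1 ?addr0 // => x xz.
rewrite hcoefZ hcoef_comb; have [->|cx] := eqVneq (c x) 0; first by rewrite mul0r.
rewrite (KL_elt_out (kl_elt x)) ?rmorph0 ?mulr0 //.
apply/negP => /bruhat_ninv le; have := ltn_leqif le; rewrite eq_sym (negPf xz) /=.
by rewrite ltnNge => /negP; apply; exact: zmax.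
Qed.

Lemma flip_comb f : flip (comb f) = comb (fun y => f y^-1%g).
Proof.
rewrite /comb flip_sum (reindex_inj (@invg_inj _)) /=; apply: eq_bigr => y _.
by rewrite flipZ flip_hHw invgK.
Qed.

(** The image of [bKL w] under [flip] is bar invariant and has the coefficients that
    characterize [bKL w^-1]. *)
Lemma klV w y : kl w^-1%g y^-1%g = kl w y.
Proof.
suff E : (fun y => kl w^-1%g y^-1%g - kl w y) = (fun=> 0).
  by apply/eqP; rewrite -subr_eq0 -[X in X == _]/((fun y => _) y) E.
apply: funext; apply: bar_comb_inj => [|x].
  rewrite -combB barD barN -flip_comb bar_flip.
  by rewrite (KLe_bar (kl_elt w)) (KLe_bar (kl_elt w^-1%g)).
by rewrite coefB !(KLe_coef0 (kl_elt _)) (inj_eq (@invg_inj _)) subrr.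
Qed.

Lemma mutV z w : mut z^-1%g w^-1%g = mut z w.
Proof. by rewrite /mut !klV. Qed.

Lemma flip_bKL w : flip (bKL w) = bKL w^-1%g.
Proof. by rewrite /bKL flip_comb; congr comb; apply: funext => y; rewrite -klV invgK. Qed.

Lemma flip_bH i : flip (bH i) = bH i.
Proof. by rewrite /bH flipD flip_hH flipZ flip1. Qed.

Lemma flipK (a : hecke) : flip (flip a) = a.
Proof.
elim/hecke_ind: a => [k|i|a b IHa IHb|a b IHa IHb].
- by rewrite !(flipZ, flip1).
- by rewrite !flip_hT.
- by rewrite !flipD IHa IHb.
- by rewrite !flipM IHa IHb.
Qed.

Lemma bKL_rdes i w : rdes i w -> bKL w * bH i = (v + v^-1) *: bKL w.
Proof.
rewrite -ldesV => di; rewrite -[LHS]flipK flipM flip_bH flip_bKL bKL_des //.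
by rewrite flipZ flip_bKL invgK.
Qed.

Lemma bKL_rasc i w : ~~ rdes i w ->
  bKL w * bH i = \sum_(z | rdes i z) (mut z w)%:~R *: bKL z.
Proof.
rewrite -ldesV => ai; rewrite -[LHS]flipK flipM flip_bH flip_bKL bKL_asc //.
rewrite flip_sum (reindex_inj (@invg_inj _)) /=.
apply: eq_big => [z|z _]; first by rewrite ldesV.
by rewrite flipZ flip_bKL invgK mutV.
Qed.

Lemma kl1_rdes i w x : rdes i w -> ~~ rdes i x -> (kl w x)`_1 = (sr i x == w)%:R.
Proof.
rewrite -!ldesV => dw ax; rewrite -klV (kl1_des dw ax) -sr_inv.
by rewrite (inj_eq (@invg_inj _)).
Qed.

End KLElements.

(** * Left cells and star operations *)

Section Cells.
Variable n : nat.
Local Notation v := hv.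
Implicit Types (w x y z : 'S_n) (i j k l u : 'I_n.-1).

Lemma left_stepP x y :
  reflect ((exists2 i, ldes i x & ~~ ldes i y) /\ mut x y != 0) (left_step x y).
Proof.
rewrite /left_step mu_neq0E; apply: (iffP andP) => [[ns m]|[[i di ni] m]]; split=> //.
  apply: contrapT => no; case/negP: ns; apply/left_descents_sub => i di.
  by apply: contrapT => /negP ni; apply: no; exists i.
by apply/negP => /left_descents_sub/(_ i di); rewrite (negPf ni).
Qed.

Lemma mut_cases z w : mut z w != 0 -> (kl w z)`_1 != 0 \/ (kl z w)`_1 != 0.
Proof.
rewrite /mut; have [->|] := eqVneq (kl w z)`_1 0; last by left.
by rewrite add0r; right.
Qed.

Lemma nat_of_bool_neq0 (b : bool) : (b%:R != 0 :> int) = b.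
Proof. by case: b. Qed.

(** If [z < w] and some right descent [j] of [w] is not one of [z], then
    [w = z s_j], and [z] could not have a left descent that [w] lacks.  If
    [z > w], then [z = s_u w], and right descents survive. *)
Lemma mut_rdes_sub u z w j : mut z w != 0 -> ldes u z -> ~~ ldes u w ->
  rdes j w -> rdes j z.
Proof.
move=> /mut_cases[m|m] dz aw dj.
  apply: contraT => aj; move: m; rewrite (kl1_rdes dj aj) nat_of_bool_neq0 => /eqP E.
  by move: aw; rewrite -E ldes_sr.
by move: m; rewrite (kl1_des dz aw) nat_of_bool_neq0 => /eqP <-; rewrite rdes_sl.
Qed.

Lemma mut_ldes_sub u z w j : mut z w != 0 -> rdes u z -> ~~ rdes u w ->
  ldes j w -> ldes j z.
Proof. by rewrite -mutV -!ldesV -!rdesV; apply: mut_rdes_sub. Qed.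

Lemma left_step_rdes x y j : left_step x y -> rdes j y -> rdes j x.
Proof. by case/left_stepP => [[i di ni] m]; apply: mut_rdes_sub m di ni. Qed.

Lemma left_le_rdes x y j : left_le x y -> rdes j y -> rdes j x.
Proof.
case/connectP => p; elim: p x => [|z p IH] x /=; first by move=> _ ->.
by case/andP => st pth E dj; apply: left_step_rdes st _; apply: IH pth E dj.
Qed.

Lemma left_equiv_rdes x y j : left_equiv x y -> rdes j x = rdes j y.
Proof. by case/andP => xy yx; apply/idP/idP; apply: left_le_rdes. Qed.

Lemma left_equiv_sym x y : left_equiv x y -> left_equiv y x.
Proof. by rewrite /left_equiv andbC. Qed.

Definition adjacent i j := (j == i.+1 :> nat) || (i == j.+1 :> nat).

(** The elementary Knuth transformations on positions are the exchanges of two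
    adjacent positions under which, of two neighbouring descents, the one that is
    present changes from [i] to [j]. *)
Definition star i j w w' :=
  [&& adjacent i j, rdes i w, ~~ rdes j w, ~~ rdes i w', rdes j w'
    & (w' == sr i w) || (w' == sr j w)].

Lemma adjacent_sym i j : adjacent i j = adjacent j i.
Proof. by rewrite /adjacent orbC. Qed.

Lemma star_sym i j w w' : star i j w w' -> star j i w' w.
Proof.
rewrite /star adjacent_sym => /and5P[-> -> -> -> /andP[-> E]] /=.
by rewrite -!(can2_eq (srK _) (srK _)) eq_sym [sr i w == _]eq_sym orbC.
Qed.

(** Both sides compare the letters at the two outer ones of three consecutive
    positions. *)
Lemma rdes_near i j w : adjacent i j -> rdes j (sr i w) = rdes i (sr j w).
Proof.
rewrite -!ldesV !sr_inv => /orP[] /eqP ij.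
  by have [c [_ -> ->]] := ldes_near_orbit w^-1%g ij.
by have [c [_ -> ->]] := ldes_near_orbit w^-1%g ij.
Qed.

Lemma star_uniq i j w w1 w2 : star i j w w1 -> star i j w w2 -> w1 = w2.
Proof.
case/and5P=> adj _ _ ni1 /andP[dj1 E1] /and5P[_ _ _ ni2 /andP[dj2 E2]].
have := rdes_near w adj.
case/orP: E1 ni1 dj1 => /eqP->; case/orP: E2 ni2 dj2 => /eqP-> //.
  by move=> /negPf-> _ _ ->.
by move=> _ -> /negPf->.
Qed.

Lemma star_ex i j w : adjacent i j -> rdes i w -> ~~ rdes j w ->
  exists w', star i j w w'.
Proof.
move=> adj di nj; have := rdes_near w adj.
case: (boolP (rdes j (sr i w))) => [dj _|_ /esym nd].
  by exists (sr i w); rewrite /star adj di nj dj rdes_sr di eqxx.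
by exists (sr j w); rewrite /star adj di nj nd rdes_sr nj eqxx orbT.
Qed.

Lemma mut_sr k x : ~~ rdes k x -> mut x (sr k x) = 1.
Proof.
move=> ak; rewrite /mut (kl1_rdes _ ak) ?rdes_sr // eqxx kl1_out ?addr0 //.
by apply/negP => /bruhat_lt_ninv; rewrite ninv_rasc // ltnNge leqnSn.
Qed.

Lemma star_mut i j w w' : star i j w w' -> mut w' w = 1.
Proof.
case/and5P=> _ di nj ni /andP[dj /orP[]] /eqP E; last first.
  by rewrite mutC E mut_sr.
by rewrite -(srK i w) -E mut_sr.
Qed.

(** The edge between [w] and [w'] has incomparable right descent sets at its two
    ends, so each set of left descents contains the other. *)
Lemma star_ldes i j w w' u : star i j w w' -> ldes u w' = ldes u w.
Proof.
move=> st; have m := star_mut st; case/and5P: st => _ di nj ni /andP[dj _].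
have m1 : mut w' w != 0 by rewrite m.
have m2 : mut w w' != 0 by rewrite mutC.
apply/idP/idP; first exact: mut_ldes_sub m2 di ni.
exact: mut_ldes_sub m1 dj nj.
Qed.

(** An edge along which the descent [i] is replaced by [j] is a star operation:
    [kl1_rdes] leaves [w s_i] and [w s_j] as the only possible ends. *)
Lemma mut_star i j w z : adjacent i j -> mut z w != 0 ->
  rdes i w -> ~~ rdes j w -> ~~ rdes i z -> rdes j z -> star i j w z.
Proof.
move=> adj /mut_cases m di nj ni dj; rewrite /star adj di nj ni dj /=.
case: m.
  by rewrite (kl1_rdes di ni) nat_of_bool_neq0 => /eqP <-; rewrite srK eqxx.
by rewrite (kl1_rdes dj nj) nat_of_bool_neq0 eq_sym => ->; rewrite orbT.
Qed.

(** [lrow u] and [rrow u] are the matrices of the left and right multiplications by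
    [bH u] in the basis [bKL]. *)
Definition lrow u w x : heckeK :=
  if ldes u w then (v + v^-1) * (x == w)%:R
  else if ldes u x then (mut x w)%:~R else 0.

Definition rrow u w x : heckeK :=
  if rdes u w then (v + v^-1) * (x == w)%:R
  else if rdes u x then (mut x w)%:~R else 0.

Lemma bKL_single c w : \sum_x (c * (x == w)%:R) *: bKL x = c *: bKL w.
Proof.
rewrite (bigD1 w) //= eqxx mulr1 big1 ?addr0 // => x /negPf->.
by rewrite mulr0 scale0r.
Qed.

Lemma bH_lrow u w : bH u * bKL w = \sum_x lrow u w x *: bKL x.
Proof.
rewrite /lrow; case: (boolP (ldes u w)) => d; first by rewrite bKL_des // bKL_single.
rewrite bKL_asc // big_mkcond; apply: eq_bigr => x _.
by case: ifP; rewrite ?scale0r.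
Qed.

Lemma bH_rrow u w : bKL w * bH u = \sum_x rrow u w x *: bKL x.
Proof.
rewrite /rrow; case: (boolP (rdes u w)) => d; first by rewrite bKL_rdes // bKL_single.
rewrite bKL_rasc // big_mkcond; apply: eq_bigr => x _.
by case: ifP; rewrite ?scale0r.
Qed.

(** Associativity, read in the basis [bKL]. *)
Lemma row_comm u j w x :
  \sum_z lrow u w z * rrow j z x = \sum_z rrow j w z * lrow u z x.
Proof.
apply/eqP; rewrite -subr_eq0; apply/eqP.
pose c y := \sum_z lrow u w z * rrow j z y - \sum_z rrow j w z * lrow u z y.
apply: (@bKL_free n c) x; rewrite /c.
under eq_bigr do rewrite scalerBl.
rewrite sumrB; apply/eqP; rewrite subr_eq0; apply/eqP.
have -> : \sum_x (\sum_z lrow u w z * rrow j z x) *: bKL x = bH u * bKL w * bH j.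
  rewrite bH_lrow mulr_suml; under eq_bigr do rewrite scaler_suml.
  rewrite exchange_big; apply: eq_bigr => z _.
  rewrite -scalerAl bH_rrow scaler_sumr; apply: eq_bigr => y _.
  by rewrite scalerA.
rewrite -mulrA bH_rrow mulr_sumr; under [RHS]eq_bigr do rewrite scaler_suml.
rewrite [RHS]exchange_big; apply: eq_bigr => z _.
rewrite -scalerAr bH_lrow scaler_sumr; apply: eq_bigr => y _.
by rewrite scalerA.
Qed.

(** In [(bH u * bKL w) * bH j = bH u * (bKL w * bH j)] look at the coefficient of
    [bKL y'], where [i] is not a descent of [y'].  On the left, [bH u * bKL w]
    only involves [z] with the descent [i], and the only one of them joined to
    [y'] is [y].  On the right, [bKL w * bH j] involves [w'] and elements with
    both descents, which cannot lead to [y']. *)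
Theorem mut_star_star i j u y y' w w' : star i j y y' -> star i j w w' ->
  ldes u y -> ~~ ldes u w -> mut y w = mut y' w'.
Proof.
move=> sty stw dy nw; have adj : adjacent i j by case/andP: sty.
have [_ _ _ niy' /andP[djy' _]] := and5P sty.
have [_ diw njw niw' /andP[djw' _]] := and5P stw.
have [_ diy njy _ _] := and5P sty.
have ldy' := star_ldes u sty; have ldw' := star_ldes u stw.
apply: hecke_int_inj; have := row_comm u j w y'.
rewrite (bigD1 y) //= [X in _ + X]big1 => [|z zy].
  rewrite (bigD1 w') //= [X in _ = _ + X]big1 => [|z zw].
    rewrite /lrow /rrow (negPf nw) dy (negPf njy) djy' (star_mut sty).
    by rewrite (negPf njw) djw' (star_mut stw) ldw' ldy' (negPf nw) dy !mulr1 mul1r !addr0.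
  rewrite /rrow (negPf njw); case: ifP => djz; last by rewrite mul0r.
  have [->|m] := eqVneq (mut z w) 0; first by rewrite mul0r.
  have noz : ~~ rdes i z -> False.
    by move=> niz; case/eqP: zw; apply: star_uniq (mut_star adj m diw njw niz djz) stw.
  rewrite /lrow ldy' dy; case: (boolP (ldes u z)) => dz.
    case: eqP => [E|_]; last by rewrite !mulr0.
    by case: noz; rewrite -E.
  have [->|m'] := eqVneq (mut y' z) 0; first by rewrite mulr0.
  case: noz; apply: contra niy'.
  by apply: mut_rdes_sub m' _ dz; rewrite ldy'.
rewrite /lrow (negPf nw); case: ifP => dz; last by rewrite mul0r.
have [->|m] := eqVneq (mut z w) 0; first by rewrite mul0r.
have diz := mut_rdes_sub m dz nw diw.
rewrite /rrow djy'; case: (boolP (rdes j z)) => djz.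
  case: eqP => [E|_]; last by rewrite !mulr0.
  by move: niy'; rewrite E diz.
have [->|m'] := eqVneq (mut y' z) 0; first by rewrite mulr0.
case/eqP: zy; apply: (@star_uniq j i y'); last exact: star_sym.
exact/star_sym/(mut_star adj).
Qed.

Lemma left_step_star i j x x' y y' : star i j x x' -> star i j y y' ->
  left_step x y -> left_step x' y'.
Proof.
move=> stx sty /left_stepP[[u dx ny] m]; apply/left_stepP; split.
  by exists u; rewrite ?(star_ldes u stx) ?(star_ldes u sty).
by rewrite -(mut_star_star stx sty dx ny).
Qed.

(** All the elements of a chain inside a left cell have the right descents of its
    ends, so the star operation applies along the whole chain. *)
Lemma left_le_star i j x x' w w' : left_le x w -> left_le w x ->
  star i j x x' -> star i j w w' -> left_le x' w'.
Proof.
move=> /connectP[p]; elim: p x x' => [|z p IH] x x' /=.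
  by move=> _ -> _ st1 st2; rewrite (star_uniq st1 st2) /left_le connect0.
case/andP=> st pth E wx stx stw.
have zw : left_le z w by apply/connectP; exists p.
have wz : left_le w z by apply: connect_trans wx (connect1 st).
have eqz : left_equiv w z by rewrite /left_equiv wz.
have [_ diw njw _ _] := and5P stw; have adj : adjacent i j by case/andP: stw.
have [z' stz] : exists z', star i j z z'.
  by apply: star_ex; rewrite -?(left_equiv_rdes _ eqz).
apply: connect_trans (IH z z' pth E wz stz stw).
exact/connect1/(left_step_star stx stz).
Qed.

Theorem left_equiv_star i j x x' w w' : left_equiv x w ->
  star i j x x' -> star i j w w' -> left_equiv x' w'.
Proof.
case/andP=> xw wx stx stw; apply/andP; split.
  exact: left_le_star xw wx stx stw.
exact: left_le_star wx xw stw stx.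
Qed.

(** The elementary dual Knuth transformations are the star operations on
    inverses. *)
Definition lmove x y := [exists i, exists j, star i j x^-1%g y^-1%g].

Lemma lmove_sym x y : lmove x y -> lmove y x.
Proof.
case/existsP=> i /existsP[j st]; apply/existsP; exists j; apply/existsP; exists i.
exact: star_sym.
Qed.

Lemma lmove_step x y : lmove x y -> left_step x y.
Proof.
case/existsP=> i /existsP[j st]; apply/left_stepP; split.
  by case/and5P: st => _ di _ ni _; exists i; rewrite -rdesV.
by rewrite -mutV mutC (star_mut st).
Qed.

Lemma connect_lmove_sym x y : connect lmove x y = connect lmove y x.
Proof.
by apply: (@sym_connect_sym _ lmove) => a b; apply/idP/idP; apply: lmove_sym.
Qed.

Lemma connect_lmove_equiv x y : connect lmove x y -> left_equiv x y.
Proof.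
have H a b : connect lmove a b -> left_le a b.
  by apply: connect_sub => c d /lmove_step/connect1.
by move=> xy; rewrite /left_equiv !H // connect_lmove_sym.
Qed.

(** Left and right star operations commute: the right one preserves the weight of
    the edge from [x] to [x'] and the left descents of its ends, and by
    [mut_star] these data characterize the left one. *)
Lemma lmove_star i j x x' y y' : lmove x x' ->
  star i j x y -> star i j x' y' -> lmove y y'.
Proof.
case/existsP=> k /existsP[l st] sty sty'.
have [adj dk nl nk /andP[dl _]] := and5P st.
rewrite !rdesV in dk nl nk dl.
apply/existsP; exists k; apply/existsP; exists l; apply: mut_star => //.
- by rewrite mutV mutC -(mut_star_star sty sty' dk nk) mutC -mutV (star_mut st).
- by rewrite rdesV (star_ldes _ sty).
- by rewrite rdesV (star_ldes _ sty).
- by rewrite rdesV (star_ldes _ sty').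
- by rewrite rdesV (star_ldes _ sty').
Qed.

Lemma connect_lmove_star i j x x' y y' : connect lmove x x' ->
  star i j x y -> star i j x' y' -> connect lmove y y'.
Proof.
move=> /connectP[p]; elim: p x y => [|z p IH] x y /=.
  by move=> _ -> st1 st2; rewrite (star_uniq st1 st2) connect0.
case/andP=> mv pth E stx stx'.
have eqz : left_equiv x z by apply: connect_lmove_equiv; apply: connect1.
have [adj di nj _ _] := and5P stx.
have [z' stz] : exists z', star i j z z'.
  by apply: star_ex; rewrite -?(left_equiv_rdes _ eqz).
apply: connect_trans (IH z z' pth E stz stx').
exact/connect1/(lmove_star mv stx stz).
Qed.

End Cells.

Local Open Scope nat_scope.

(** * Row insertion and Knuth equivalence *)

(** Insertion into one row; the second component is the list, of length at most
    one, of the letters that are passed on to the next row. *)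
Fixpoint rins (r : seq nat) (x : nat) : seq nat * seq nat :=
  if r is e :: r' then
    if x < e then (x :: r', [:: e]) else (e :: (rins r' x).1, (rins r' x).2)
  else ([:: x], [::]).

Lemma rinsE r x : rins r x =
  if all (fun e => e <= x) r then (rcons r x, [::])
  else (set_nth 0 r (find (fun e => x < e) r) x,
        [:: nth 0 r (find (fun e => x < e) r)]).
Proof.
elim: r => [|e r IH] //=; rewrite IH; case: ltnP => //= le.
by case: ifP.
Qed.

Lemma row_insert_cons r T x :
  row_insert (r :: T) x = (rins r x).1 :: foldl row_insert T (rins r x).2.
Proof. by rewrite rinsE /=; case: ifP. Qed.

Fixpoint rword (r u : seq nat) : seq nat * seq nat :=
  if u is x :: u' then
    ((rword (rins r x).1 u').1, (rins r x).2 ++ (rword (rins r x).1 u').2)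
  else (r, [::]).

Lemma foldl_row_insert r T u : foldl row_insert (r :: T) u =
  (rword r u).1 :: foldl row_insert T (rword r u).2.
Proof.
elim: u r T => [|x u IH] r T //.
rewrite -[foldl _ _ (x :: u)]/(foldl row_insert (row_insert (r :: T) x) u).
by rewrite row_insert_cons IH foldl_cat.
Qed.

Lemma rins_perm r x : perm_eq (x :: r) ((rins r x).1 ++ (rins r x).2).
Proof.
elim: r => [|e r IH] //=; case: ifP => _ /=.
  by rewrite perm_cons -[e :: r]cat1s perm_catC.
rewrite -[(rins r x).1 ++ _]/((rins r x).1 ++ _).
by rewrite -[x :: e :: r]/([:: x; e] ++ r) (perm_catCA [:: x] [:: e]) /= perm_cons.
Qed.

Lemma rins_out r x : (rins r x).2 = [::] \/
  exists b, [/\ (rins r x).2 = [:: b], b \in r & x < b].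
Proof.
elim: r => [|e r IH] /=; first by left.
case: ltnP => xe /=; first by right; exists e; rewrite mem_head.
case: IH => [->|[b [-> br xb]]]; first by left.
by right; exists b; rewrite inE br orbT.
Qed.

Lemma path_rins e r x : path ltn e r -> e < x -> x \notin r ->
  path ltn e (rins r x).1.
Proof.
elim: r e => [|f r IH] e /=; first by move=> _ ->.
rewrite inE negb_or => /andP[ef pf] ex /andP[xf xr].
case: ltnP => h /=; last by rewrite ef IH //; lia.
rewrite ex; case: r pf {IH xr} => //= g r /andP[fg ->]; rewrite andbT.
exact: ltn_trans h fg.
Qed.

Lemma sorted_rins r x : sorted ltn r -> x \notin r -> sorted ltn (rins r x).1.
Proof.
case: r => [|e r] //= pr; rewrite inE negb_or => /andP[xe xr].
case: ltnP => h /=; last by rewrite path_rins //; lia.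
case: r pr {xr} => //= g r /andP[fg ->]; rewrite andbT.
exact: ltn_trans h fg.
Qed.

(** [rins_incr] and [rins_decr] are the row bumping lemma: the letters passed on by
    two successive insertions are in the same order as the letters inserted. *)
Lemma rins_incr r y z : sorted ltn r -> y < z ->
  (rins (rins r y).1 z).2 = [::] \/
  exists by_ bz, [/\ (rins r y).2 = [:: by_], (rins (rins r y).1 z).2 = [:: bz] & by_ < bz].
Proof.
elim: r => [|e r IH] /=; first by move=> _ yz; rewrite ltnNge (ltnW yz); left.
move=> pr yz; case: ltnP => ye /=.
  rewrite ltnNge (ltnW yz) /=; case: (rins_out r z) => [->|[b [-> br zb]]]; first by left.
  right; exists e, b; split=> //.
  by move: pr; rewrite (path_sortedE ltn_trans) => /andP[/allP/(_ b br)].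
by rewrite ltnNge (leq_trans ye (ltnW yz)) /=; apply: IH; rewrite // (path_sorted pr).
Qed.

Lemma rins_decr r x y : y < x -> exists b,
  [/\ (rins (rins r x).1 y).2 = [:: b], b <= x & b = x \/ b \in r].
Proof.
move=> yx; elim: r => [|e r [b [IH1 IH2 IH3]]] /=.
  by exists x; rewrite yx; split=> //; left.
case: ltnP => xe /=; first by exists x; rewrite yx; split=> //; left.
case: ltnP => ye /=; first by exists e; split=> //; right; rewrite mem_head.
exists b; split=> //; case: IH3 => ?; [by left|right; rewrite inE].
by apply/orP; right.
Qed.

Variant knuth3 : seq nat -> seq nat -> Prop :=
| Knuth_yzx x y z : x < y -> y < z -> knuth3 [:: y; z; x] [:: y; x; z]
| Knuth_xzy x y z : x < y -> y < z -> knuth3 [:: x; z; y] [:: z; x; y].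

Definition knuth1 u v : Prop :=
  exists p s a b, [/\ knuth3 a b, u = p ++ a ++ s & v = p ++ b ++ s].

(** Induction over the row.  When its first entry [e] exceeds the smallest of the
    three letters, [e] takes part in the words passed on, together with what the
    other letters bump from the rest of the row; the position of [e] among the
    three letters decides which of the two relations appears there. *)
Lemma knuth_row r a1 a2 : knuth3 a1 a2 -> sorted ltn r -> uniq (a1 ++ r) ->
  (rword r a1).1 = (rword r a2).1 /\
  ((rword r a1).2 = (rword r a2).2 \/
   knuth3 (rword r a1).2 (rword r a2).2 \/ knuth3 (rword r a2).2 (rword r a1).2).
Proof.
case=> x y z xy yz; have xz := ltn_trans xy yz;
  have xyE : (x < y) = true := xy; have yzE : (y < z) = true := yz;
  have xzE : (x < z) = true := xz; have yx : (y < x) = false by lia.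
- have zx : (z < x) = false by lia.
  have zy : (z < y) = false by lia.
  elim: r => [|e r IH] sr ur.
    by do 4 rewrite /= ?(zy, xyE, zx); split; [|left].
  have pe : all (ltn e) r by move: sr; rewrite /= (path_sortedE ltn_trans) => /andP[].
  have /IH{}IH : sorted ltn r by apply: path_sorted sr.
  have nyzx : [&& x != e, y != e & z != e].
    by move: ur; rewrite /= !inE !negb_or => ur; apply/and3P; split; lia.
  have {}IH : (rword r [:: y; z; x]).1 = (rword r [:: y; x; z]).1 /\
     ((rword r [:: y; z; x]).2 = (rword r [:: y; x; z]).2 \/
     knuth3 (rword r [:: y; z; x]).2 (rword r [:: y; x; z]).2 \/
     knuth3 (rword r [:: y; x; z]).2 (rword r [:: y; z; x]).2).
    apply: IH; apply: subseq_uniq ur.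
    exact: cat_subseq (subseq_refl _) (subseq_cons _ _).
  case: (ltnP x e) => [xe|ex]; last first.
    have [xe [ye ze]] : (x < e) = false /\ (y < e) = false /\ (z < e) = false by lia.
    by move: IH; do 3 rewrite /= ?(xe, ye, ze); move=> -[-> IH]; split.
  have xeE : (x < e) = true by [].
  case: (ltnP y e) => [ye|ey] /=.
    have yeE : (y < e) = true by [].
    do 4 rewrite /= ?(yeE, zy, xyE, xeE, zx); rewrite !cats0; split=> //.
    case: (rins_out r z) => [->|[b [-> br _]]]; first by left.
    by right; left; apply: Knuth_yzx => //; apply: (allP pe).
  have ze : (z < e) = false by lia.
  have ye : (y < e) = false by lia.
  do 4 rewrite /= ?(ye, ze, xeE, zx); rewrite !cats0; split=> //.
  have [->|[b1 [b2 [E1 -> b12]]]] := rins_incr (path_sorted sr) yz; first by left.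
  right; left; rewrite E1 /=; apply: Knuth_yzx => //.
  by case: (rins_out r y); rewrite E1 // => -[b [[<-] br _]]; apply: (allP pe).
- have zx : (z < x) = false by lia.
  elim: r => [|e r IH] sr ur.
    by do 4 rewrite /= ?(zx, xzE, yx, yzE); split; [|left].
  have pe : all (ltn e) r by move: sr; rewrite /= (path_sortedE ltn_trans) => /andP[].
  have /IH{}IH : sorted ltn r by apply: path_sorted sr.
  have nyzx : [&& x != e, y != e & z != e].
    by move: ur; rewrite /= !inE !negb_or => ur; apply/and3P; split; lia.
  have {}IH : (rword r [:: x; z; y]).1 = (rword r [:: z; x; y]).1 /\
     ((rword r [:: x; z; y]).2 = (rword r [:: z; x; y]).2 \/
     knuth3 (rword r [:: x; z; y]).2 (rword r [:: z; x; y]).2 \/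
     knuth3 (rword r [:: z; x; y]).2 (rword r [:: x; z; y]).2).
    apply: IH; apply: subseq_uniq ur.
    exact: cat_subseq (subseq_refl _) (subseq_cons _ _).
  case: (ltnP x e) => [xe|ex]; last first.
    have [xe [ye ze]] : (x < e) = false /\ (y < e) = false /\ (z < e) = false by lia.
    by move: IH; do 3 rewrite /= ?(xe, ye, ze); move=> -[-> IH]; split.
  have xeE : (x < e) = true by [].
  case: (ltnP z e) => [ze|ez] /=.
    have zeE : (z < e) = true by [].
    do 4 rewrite /= ?(zeE, xeE, zx, xzE, yx); rewrite !cats0.
    case: r pe {IH sr ur} => [|b r] /= pe; first by rewrite yz /=; split; [|left].
    have zb : z < b by lia.
    have yb : y < b by lia.
    rewrite zb yb /= yz /=; split=> //; right; left.
    by apply: Knuth_yzx => //; lia.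
  have ze : (z < e) = false by lia.
  do 4 rewrite /= ?(ze, xeE, zx, yx); rewrite !cats0; split=> //.
  have [b [-> bz be]] := rins_decr r yz.
  case: (rins_out r z) => [->|[c [-> cr zc]]]; first by left.
  right; left; apply: Knuth_xzy; last by lia.
  by case: be => [->|br]; [lia|apply: (allP pe)].
Qed.

Lemma knuth3_perm a1 a2 : knuth3 a1 a2 -> perm_eq a1 a2.
Proof. by case=> x y z _ _; apply/seq.permP => p /=; lia. Qed.

Lemma rword_perm r u : perm_eq (u ++ r) ((rword r u).1 ++ (rword r u).2).
Proof.
elim: u r => [|x u IH] r /=; first by rewrite cats0.
apply/seq.permP => p; have /seq.permP/(_ p) := IH (rins r x).1.
by have /seq.permP/(_ p) := rins_perm r x; rewrite /= !count_cat; lia.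
Qed.

Lemma rword_gt0 r u : 0 < size u + size r -> 0 < size (rword r u).1.
Proof.
elim: u r => [|x u IH] r //= _; apply: IH.
by case: r => [|e r] /=; [|case: ifP => _ /=]; lia.
Qed.

Definition ins (u : seq nat) : tableau := foldl row_insert [::] u.

Lemma ins_row u : u != [::] ->
  ins u = (rword [::] u).1 :: ins (rword [::] u).2.
Proof. by case: u => // x u _; apply: foldl_row_insert. Qed.

(** Row by row; from the empty tableau fewer than three letters are passed on, so
    that the alternatives in [knuth_row] reduce to equality. *)
Lemma knuth_insert T a1 a2 : knuth3 a1 a2 -> all (sorted ltn) T ->
  uniq (a1 ++ flatten T) -> foldl row_insert T a1 = foldl row_insert T a2.
Proof.
elim: T a1 a2 => [|r T IH] a1 a2 kn /=.
  move=> _ ua; have [E1 E2] := knuth_row (r := [::]) kn isT ua.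
  rewrite -/(ins a1) -/(ins a2) (@ins_row a1) ?(@ins_row a2); try by case: kn.
  rewrite E1; case: E2 => [->//|E2]; exfalso.
  have sz3 b1 b2 : knuth3 b1 b2 -> size b1 = 3 /\ size b2 = 3 by case.
  have [s1 s2] := sz3 _ _ kn.
  have := rword_gt0 (r := [::]) (u := a1); rewrite s1 => /(_ isT).
  have := perm_size (rword_perm [::] a1); rewrite !size_cat s1.
  by case: E2 => /sz3[z1 z2]; rewrite ?z1 ?z2 /=; lia.
case/andP=> sr sT ua.
have uar : uniq (a1 ++ r).
  by move: ua; rewrite catA cat_uniq => /and3P[].
have ua1 : uniq ((rword r a1).2 ++ flatten T).
  move: ua; rewrite catA (perm_uniq (perm_cat (rword_perm r a1) (perm_refl _))).
  by rewrite -catA cat_uniq => /and3P[].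
have [E1 E2] := knuth_row kn sr uar.
rewrite !foldl_row_insert E1; congr (_ :: _).
case: E2 => [->//|[E2|E2]]; first exact: IH.
apply/esym/IH => //; rewrite (perm_uniq (perm_cat (knuth3_perm E2) (perm_refl _))).
exact: ua1.
Qed.

Lemma flatten_row_insert T x : perm_eq (x :: flatten T) (flatten (row_insert T x)).
Proof.
elim: T x => [|r T IH] x //.
rewrite row_insert_cons /= -cat_cons.
apply: perm_trans (perm_cat (rins_perm r x) (perm_refl _)) _.
rewrite -catA perm_cat2l.
by case: (rins_out r x) => [->|[b [-> _ _]]] //=.
Qed.

Lemma flatten_foldl_insert T u :
  perm_eq (u ++ flatten T) (flatten (foldl row_insert T u)).
Proof.
elim: u T => [|x u IH] T //=; apply: perm_trans _ (IH _).
apply/seq.permP => p; have /seq.permP/(_ p) := flatten_row_insert T x.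
by rewrite /= !count_cat; lia.
Qed.

Lemma flatten_ins u : perm_eq u (flatten (ins u)).
Proof. by have := flatten_foldl_insert [::] u; rewrite cats0. Qed.

Lemma sorted_row_insert T x : all (sorted ltn) T -> uniq (x :: flatten T) ->
  all (sorted ltn) (row_insert T x).
Proof.
elim: T x => [|r T IH] x //.
rewrite [all _ _]/= [flatten _]/= => /andP[sr sT] ux; rewrite row_insert_cons /=.
have [xr uT] : x \notin r /\ uniq ((rins r x).2 ++ flatten T).
  move: (ux); rewrite -cat_cons (perm_uniq (perm_cat (rins_perm r x) (perm_refl _))).
  rewrite -catA cat_uniq => /and3P[_ _ ->]; split=> //.
  by move: ux; rewrite /= mem_cat negb_or => /andP[/andP[]].
rewrite sorted_rins //=; move: uT.
case: (rins_out r x) => [->|[b [-> _ _]]] //= uT; exact: IH.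
Qed.

Lemma sorted_ins u : uniq u -> all (sorted ltn) (ins u).
Proof.
elim/last_ind: u => [|u x IH] // ux; rewrite /ins foldl_rcons -/(ins u).
have ux' : uniq (x :: u) by rewrite -(perm_uniq (permEl (perm_rcons x u))).
apply: sorted_row_insert; first by apply: IH; move: ux' => /andP[].
by rewrite -(perm_uniq (_ : perm_eq (x :: u) _)) // perm_cons flatten_ins.
Qed.

Lemma knuth1_perm u v : knuth1 u v -> perm_eq u v.
Proof.
case=> p [s [a1 [a2 [kn -> ->]]]]; rewrite perm_cat2l perm_cat2r.
exact: knuth3_perm.
Qed.

Theorem knuth1_ins u v : uniq u -> knuth1 u v -> ins u = ins v.
Proof.
move=> uu [p [s [a1 [a2 [kn uE vE]]]]]; subst u v.
rewrite /ins !foldl_cat -/(ins p); congr foldl.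
move: uu; rewrite catA cat_uniq => /and3P[uu _ _].
apply: knuth_insert => //.
  by apply: sorted_ins; move: uu; rewrite cat_uniq => /andP[].
rewrite -(perm_uniq (_ : perm_eq (p ++ a1) _)) //.
by rewrite perm_catC perm_cat2l flatten_ins.
Qed.

Inductive knuth_eq : seq nat -> seq nat -> Prop :=
| knuth_refl u : knuth_eq u u
| knuth_step u v : knuth1 u v -> knuth_eq u v
| knuth_sym u v : knuth_eq u v -> knuth_eq v u
| knuth_trans u v w : knuth_eq u v -> knuth_eq v w -> knuth_eq u w.

Lemma knuth_eq_perm u v : knuth_eq u v -> perm_eq u v.
Proof.
elim=> {u v} // [u v /knuth1_perm//|u v _|u v w _ IH1 _ IH2].
  by rewrite perm_sym.
exact: perm_trans IH1 IH2.
Qed.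

Lemma knuth_eq_cat p s u v : knuth_eq u v -> knuth_eq (p ++ u ++ s) (p ++ v ++ s).
Proof.
elim=> {u v} [u|u v [p' [s' [a1 [a2 [kn -> ->]]]]]|u v _ IH|u v w _ IH1 _ IH2].
- exact: knuth_refl.
- apply: knuth_step; exists (p ++ p'), (s' ++ s), a1, a2.
  by rewrite -!catA.
- exact: knuth_sym.
- exact: knuth_trans IH1 IH2.
Qed.

(** The letter [k] crosses the letters of [r] one at a time, each time with its left
    neighbour as the witness required by the Knuth relation. *)
Lemma knuth_slide e r k : path ltn e r -> k < e ->
  knuth_eq (e :: r ++ [:: k]) [:: e, k & r].
Proof.
elim: r e => [|a r IH] e /=; first by move=> *; apply: knuth_refl.
case/andP=> ea pa ke; apply: (@knuth_trans _ [:: e, a, k & r]).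
  have := @knuth_eq_cat [:: e] [::] _ _ (IH a pa (ltn_trans ke ea)).
  by rewrite !cats0.
apply: knuth_step; exists [::], r, [:: e; a; k], [:: e; k; a].
by split=> //; apply: Knuth_yzx.
Qed.

(** The bumped letter is moved to the front of the row by Knuth relations: the
    inserted letter slides left to the bumped one, which then crosses the smaller
    entries. *)
Lemma knuth_rins r k : sorted ltn r -> k \notin r ->
  knuth_eq (r ++ [:: k]) ((rins r k).2 ++ (rins r k).1).
Proof.
elim: r => [|e r IH] sr; first by move=> _; apply: knuth_refl.
rewrite inE negb_or => /andP[kne kr] /=; case: ltnP => h /=; first exact: knuth_slide.
have ek : e < k by lia.
have {}IH : knuth_eq (e :: r ++ [:: k]) (e :: (rins r k).2 ++ (rins r k).1).
  have := @knuth_eq_cat [:: e] [::] _ _ (IH (path_sorted sr) kr).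
  by rewrite !cats0.
have := path_rins sr ek kr.
case: (rins_out r k) IH => [->//|[b [E br kb]]] IH pr.
apply: knuth_trans IH _; rewrite E /=.
have : exists h t, (rins r k).1 = h :: t /\ h < b.
  case: r {sr kr br pr h} E => [|f r] //=; case: ltnP => fk /= E; last first.
    by exists f, (rins r k).1; split=> //; lia.
  by exists k, r.
case=> f [t [rE fb]]; rewrite rE in pr *; case/andP: pr => ef _.
apply: knuth_step; exists [::], t, [:: e; b; f], [:: b; e; f].
by split=> //; apply: Knuth_xzy.
Qed.

Definition reading (T : tableau) : seq nat := flatten (rev T).

Lemma reading_cons r T : reading (r :: T) = reading T ++ r.
Proof. by rewrite /reading rev_cons flatten_rcons. Qed.

Lemma knuth_row_insert T k : all (sorted ltn) T -> uniq (k :: flatten T) ->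
  knuth_eq (reading T ++ [:: k]) (reading (row_insert T k)).
Proof.
elim: T k => [|r T IH] k; first by move=> _ _; apply: knuth_refl.
rewrite [all _ _]/= [flatten _]/= => /andP[sr sT] ux.
rewrite row_insert_cons !reading_cons -catA.
have [xr uT] : k \notin r /\ uniq ((rins r k).2 ++ flatten T).
  move: (ux); rewrite -cat_cons (perm_uniq (perm_cat (rins_perm r k) (perm_refl _))).
  rewrite -catA cat_uniq => /and3P[_ _ ->]; split=> //.
  by move: ux; rewrite /= mem_cat negb_or => /andP[/andP[]].
have := @knuth_eq_cat (reading T) [::] _ _ (knuth_rins sr xr); rewrite !cats0.
move=> kn; apply: knuth_trans kn _; move: uT.
case: (rins_out r k) => [-> _|[b [-> _ _]] uT]; first exact: knuth_refl.
have := @knuth_eq_cat [::] (rins r k).1 _ _ (IH b sT uT).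
by rewrite /= -catA.
Qed.

Theorem knuth_reading u : uniq u -> knuth_eq u (reading (ins u)).
Proof.
elim/last_ind: u => [|u x IH] ux; first exact: knuth_refl.
have ux' : uniq (x :: u) by rewrite -(perm_uniq (permEl (perm_rcons x u))).
have uu : uniq u by case/andP: ux'.
rewrite /ins foldl_rcons -/(ins u) -cats1.
have := @knuth_eq_cat [::] [:: x] _ _ (IH uu) => /= kn.
apply: knuth_trans kn _; apply: knuth_row_insert; first exact: sorted_ins.
by rewrite -(perm_uniq (_ : perm_eq (x :: u) _)) // perm_cons flatten_ins.
Qed.

Corollary ins_knuth_eq u v : uniq u -> uniq v -> ins u = ins v -> knuth_eq u v.
Proof.
move=> uu uv E; apply: knuth_trans (knuth_reading uu) _.
by rewrite E; apply/knuth_sym/knuth_reading.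
Qed.

(** * Tableaux given by their columns *)

(* A tableau is also described by the list of its columns, each of which is listed
   from top to bottom. *)

Definition heads (cols : seq (seq nat)) : seq nat :=
  [seq head 0 c | c <- cols & c != [::]].

(** The first argument is the number of rows, for which [rows] takes the length of
    the first column. *)
Fixpoint rows_rec (k : nat) (cols : seq (seq nat)) : tableau :=
  if k is k'.+1 then heads cols :: rows_rec k' (map behead cols) else [::].

Definition rows (cols : seq (seq nat)) : tableau :=
  rows_rec (size (head [::] cols)) cols.

Lemma rows_nil cols : head [::] cols = [::] -> rows cols = [::].
Proof. by rewrite /rows => ->. Qed.

Lemma rows_cons cols : head [::] cols != [::] ->
  rows cols = heads cols :: rows (map behead cols).
Proof. by case: cols => [|[|e c] cols]. Qed.

Lemma heads_cat A B : heads (A ++ B) = heads A ++ heads B.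
Proof. by rewrite /heads filter_cat map_cat. Qed.

Lemma heads_nils B : all (fun b => size b <= 0) B -> heads B = [::].
Proof.
elim: B => //= b B IH /andP[]; rewrite leqn0 size_eq0 /heads /= => /eqP-> /=.
exact: IH.
Qed.

Lemma all_size_behead k B : all (fun b => size b <= k) B ->
  all (fun b => size b <= k.-1) (map (@behead nat) B).
Proof. by move=> h; rewrite all_map; apply: sub_all h => b /=; rewrite size_behead; lia. Qed.

Lemma rows_cat_nils A B : all (fun b => size b <= 0) B -> rows (A ++ B) = rows A.
Proof.
move=> B0; rewrite /rows; case: A => [|a A].
  by case: B B0 => //= b B /andP[]; rewrite leqn0 => /eqP->.
rewrite [head _ _]/= [head _ (a :: A)]/=; move: (size a) => k; elim: k (a :: A) B B0 => //= k IH A' B B0.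
by rewrite heads_cat (heads_nils B0) cats0 map_cat IH // (all_size_behead (k := 0)).
Qed.

(** The entries of the column [a] are at most those of [c] in the same rows, and
    [a] is at least as long as [c]. *)
Fixpoint col_le (a c : seq nat) {struct c} : bool :=
  if c is y :: c' then
    if a is e :: a' then (e <= y) && col_le a' c' else false
  else true.

Lemma col_le_size a c : col_le a c -> size c <= size a.
Proof. by elim: c a => [|y c IH] [|e a] //= /andP[_ /IH]. Qed.

Lemma col_le_trans : transitive col_le.
Proof.
move=> b a c; elim: c a b => [|z c IH] [|x a] [|y b] //= /andP[xy ab] /andP[yz bc].
by rewrite (leq_trans xy yz) (IH _ _ ab bc).
Qed.

Lemma col_le_behead a d c : sorted ltn (d :: c) -> col_le a (d :: c) -> col_le a c.
Proof.
elim: c a d => [|e c IH] [|f a] d //= /andP[de pc] /andP[fd].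
case: a => // g a /andP[ge ac]; rewrite (leq_trans fd (ltnW de)) /=.
by apply: (IH (g :: a) e) => //=; rewrite ge.
Qed.

Lemma col_le_count k a c : col_le a c ->
  count (fun e => e <= k) c <= count (fun e => e <= k) a.
Proof.
elim: c a => [|y c IH] [|e a] //= /andP[ey /IH]; case: (leqP y k) => /= yk.
  by rewrite (leq_trans ey yk).
by move=> le; rewrite (leq_trans le) // leq_addl.
Qed.

Lemma rins_cat r1 r2 d x : all (fun e => e <= x) r1 -> x < d ->
  rins (r1 ++ d :: r2) x = (r1 ++ x :: r2, [:: d]).
Proof.
elim: r1 => [|e r1 IH] /=; first by move=> _ ->.
by case/andP=> ex all1 xd; rewrite ltnNge ex /= IH.
Qed.

Lemma rins_end r x : all (fun e => e <= x) r -> rins r x = (rcons r x, [::]).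
Proof. by move=> h; rewrite rinsE h. Qed.

(** The row in which the insertion of [x] creates a cell; rows are counted from
    [0]. *)
Fixpoint ins_row_index (T : tableau) (x : nat) : nat :=
  if T is r :: T' then
    if (rins r x).2 is b :: _ then (ins_row_index T' b).+1 else 0
  else 0.

Lemma ins_row_index_cons r T x : ins_row_index (r :: T) x =
  if (rins r x).2 is b :: _ then (ins_row_index T b).+1 else 0.
Proof. by []. Qed.

(** The entries to the left of the column, in the rows concerned, are too small to
    be bumped, and those to its right are not reached; so the whole bumping path
    stays in the column. *)
Lemma insert_on_column A c B x : sorted ltn (x :: c) ->
  all (fun a => col_le a (x :: c)) A -> all (fun b => size b <= size c) B ->
  row_insert (rows (A ++ c :: B)) x = rows (A ++ (x :: c) :: B)
  /\ ins_row_index (rows (A ++ c :: B)) x = size c.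
Proof.
elim: c A B x => [|d c IH] A B x.
  move=> _ Ax B0.
  have hA : all (fun e => e <= x) (heads A).
    apply/allP => e /mapP[a]; rewrite mem_filter => /andP[_ /(allP Ax)].
    by case: a => //= f a /andP[fx _] ->.
  have hB := heads_nils B0.
  case: A Ax hA => [|a A] Ax hA.
    rewrite rows_nil // rows_cons //=; split=> //; congr (_ :: _).
    by rewrite /heads /= -/(heads B) hB.
  have an : a != [::] by move: Ax => /=; case: (a).
  have n1 : head [::] ((a :: A) ++ [::] :: B) != [::] by [].
  have n2 : head [::] ((a :: A) ++ [:: x] :: B) != [::] by [].
  rewrite (rows_cons n1) (rows_cons n2) row_insert_cons ins_row_index_cons !map_cat.
  have E y : heads ((a :: A) ++ y :: B) = heads (a :: A) ++ heads [:: y].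
    by rewrite heads_cat -[y :: B]cat1s heads_cat hB cats0.
  by rewrite !E cats0 rins_end // -cats1.
move=> /= /andP[xd pc] Ax Bc.
have hA : all (fun e => e <= x) (heads A).
  apply/allP => e /mapP[a]; rewrite mem_filter => /andP[_ /(allP Ax)].
  by case: a => //= f a /andP[fx _] ->.
have n1 : head [::] (A ++ (d :: c) :: B) != [::].
  by case: A Ax {hA} => //= -[].
have n2 : head [::] (A ++ [:: x, d & c] :: B) != [::].
  by case: A Ax {hA n1} => //= -[].
have [] := IH (map behead A) (map behead B) d.
- by [].
- apply/allP => a' /mapP[a aA ->]; have := allP Ax _ aA.
  by case: a {aA} => //= e a /andP[_].
- exact: (all_size_behead Bc).
rewrite (rows_cons n1) (rows_cons n2) row_insert_cons ins_row_index_cons !map_cat.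
have E (y : nat) (c' : seq nat) : heads (A ++ (y :: c') :: B) = heads A ++ y :: heads B.
  by rewrite heads_cat.
by rewrite !E rins_cat //= => E1 E2; rewrite E1 E2.
Qed.

(** The column word reads each column from bottom to top. *)
Definition colword (cols : seq (seq nat)) : seq nat := flatten (map rev cols).

Lemma colword_cat A B : colword (A ++ B) = colword A ++ colword B.
Proof. by rewrite /colword map_cat flatten_cat. Qed.

Lemma colword_rcons A c : colword (rcons A c) = colword A ++ rev c.
Proof. by rewrite -cats1 colword_cat /colword /= cats0. Qed.

Lemma ins_cat u v : ins (u ++ v) = foldl row_insert (ins u) v.
Proof. exact: foldl_cat. Qed.

(** The sum over the cells of their row indices: every cell below the first row is
    counted once for each row above it. *)
Fixpoint depth_sum (T : tableau) : nat :=
  if T is r :: T' then depth_sum T' + size (flatten T') else 0.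

Lemma depth_sum_insert T x :
  depth_sum (row_insert T x) = depth_sum T + ins_row_index T x.
Proof.
elim: T x => [|r T IH] x //; rewrite row_insert_cons /=.
case: (rins_out r x) => [->|[b [-> _ _]]] /=; first by rewrite addn0.
rewrite IH -(perm_size (flatten_row_insert T b)) /=; lia.
Qed.

Definition bin_sum (cols : seq (seq nat)) : nat := \sum_(c <- cols) 'C(size c, 2).

Lemma bin2S m : 'C(m.+1, 2) = 'C(m, 2) + m.
Proof. by rewrite binS bin1. Qed.

(** Inserting a column from bottom to top builds it as a new last column. *)
Lemma ins_column A c : sorted ltn c -> all (fun a => col_le a c) A ->
  foldl row_insert (rows A) (rev c) = rows (rcons A c) /\
  depth_sum (rows (rcons A c)) = depth_sum (rows A) + 'C(size c, 2).
Proof.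
elim: c => [|d c IH] sc Ac.
  by rewrite -cats1 rows_cat_nils //= addn0.
have sc' : sorted ltn c by apply: path_sorted sc.
have Ac' : all (fun a => col_le a c) A.
  by apply/allP => a /(allP Ac); apply: col_le_behead.
have [E1 E2] := IH sc' Ac'; rewrite rev_cons foldl_rcons E1.
have [E3 E4] := insert_on_column (B := [::]) sc Ac isT.
rewrite -!cats1 E3; split=> //.
by rewrite -E3 depth_sum_insert E4 [size _]/= bin2S addnA -E2 -cats1.
Qed.

Definition col_tab cols := sorted col_le cols && all (sorted ltn) cols.

Lemma col_tab_rcons A c : col_tab (rcons A c) =
  [&& col_tab A, all (fun a => col_le a c) A & sorted ltn c].
Proof.
rewrite /col_tab !(sorted_pairwise col_le_trans) pairwise_rcons all_rcons.
by case: (pairwise _ _); case: (all (sorted ltn) A); case: (sorted ltn c);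
  rewrite ?andbT ?andbF.
Qed.

Lemma ins_colword cols : col_tab cols ->
  ins (colword cols) = rows cols /\ depth_sum (rows cols) = bin_sum cols.
Proof.
elim/last_ind: cols => [|A c IH]; first by rewrite /bin_sum big_nil.
rewrite col_tab_rcons => /and3P[/IH[E1 E2] Ac sc].
have [E3 E4] := ins_column sc Ac.
by rewrite colword_rcons ins_cat E1 E3 E4 E2 /bin_sum big_rcons.
Qed.

(** ** Decreasing runs *)

(** In every row the second letter bumps at, or to the left of, the place where
    the first one was inserted, so it is never the first to stop. *)
Lemma ins_row_index_bump T d e : d < e ->
  ins_row_index T e < ins_row_index (row_insert T e) d.
Proof.
elim: T d e => [|r T IH] d e de; first by rewrite /= leqNgt de.
rewrite row_insert_cons [ins_row_index (r :: T) e]/=.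
have [b [E be _]] := rins_decr r de; rewrite [X in _ < X]/= E.
case: (rins_out r e) => [->|[b' [-> _ eb']]] //=.
by rewrite ltnS; apply: IH; lia.
Qed.

Lemma ins_row_index_run T d c : sorted ltn (d :: c) ->
  size c <= ins_row_index (foldl row_insert T (rev c)) d.
Proof.
elim: c d => [|e c IH] d //= /andP[de pc].
rewrite rev_cons foldl_rcons (leq_ltn_trans (IH e pc)) //.
exact: ins_row_index_bump.
Qed.

(** The cells created by a decreasing run are in rows at least [0], [1], [2] and so
    on. *)
Lemma depth_sum_run T c : sorted ltn c ->
  depth_sum T + 'C(size c, 2) <= depth_sum (foldl row_insert T (rev c)).
Proof.
elim: c => [|d c IH] sc; first by rewrite addn0.
rewrite rev_cons foldl_rcons depth_sum_insert [size _]/= bin2S addnA.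
by rewrite leq_add ?ins_row_index_run // IH // (path_sorted sc).
Qed.

Lemma bin_sum_colword cols : all (sorted ltn) cols ->
  bin_sum cols <= depth_sum (ins (colword cols)).
Proof.
elim/last_ind: cols => [|A c IH]; first by rewrite /bin_sum big_nil.
rewrite all_rcons => /andP[sc /IH le]; rewrite colword_rcons ins_cat.
rewrite /bin_sum big_rcons /=; apply: leq_trans (depth_sum_run _ sc).
by rewrite leq_add2r.
Qed.

(** The first column [c] whose top entry exceeds [x] is at least as long as [a].
    Its top entry is bumped and is smaller than the next entry of [c], so the
    insertion goes on at least down to the bottom of [c]. *)
Lemma ins_row_index_ge cols x a : all (sorted ltn) cols ->
  sorted geq (map size cols) -> a \in cols -> a != [::] -> x < head 0 a ->
  size a <= ins_row_index (rows cols) x.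
Proof.
have [k] : exists k, size (head [::] cols) <= k by eexists.
elim: k a cols x => [|k IH] a cols x hk sc szc acols an xa.
  have : size a <= size (head [::] cols).
    case: (cols) szc acols => // c cs; rewrite inE => szc /predU1P[->//|ac].
    move: szc; rewrite /= (path_sortedE (rev_trans leq_trans)).
    by case/andP=> /allP/(_ _ (map_f size ac)).
  by move/leq_trans/(_ hk)/leq_trans; apply.
have [c [A [B [cE Ax cn xc ac]]]] : exists c A B,
  [/\ cols = A ++ c :: B, all (fun e => e <= x) (heads A), c != [::],
      x < head 0 c & size a <= size c].
  elim: cols {hk sc} szc acols => // c cols IHc szc.
  rewrite inE; case: (boolP ((c != [::]) && (x < head 0 c))) => [/andP[cn xc]|nc].
    move=> ac; exists c, [::], cols; split=> //.
    case/predU1P: ac => [->//|ac].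
    move: szc; rewrite /= (path_sortedE (rev_trans leq_trans)) => /andP[/allP/(_ _ (map_f size ac))].
    by [].
  case/predU1P => [E|ac]; first by move: nc; rewrite -E an xa.
  have [|c' [A [B [-> Ax cn xc le]]]] := IHc _ ac; first exact: path_sorted szc.
  exists c', (c :: A), B; split=> //; move: nc; rewrite negb_and negbK /heads /=.
  by case: eqP => //= _; rewrite -leqNgt => ->.
apply: leq_trans ac _.
have hcols : head [::] cols != [::].
  move: szc; rewrite cE; case: (A) => //= b A'.
  rewrite map_cat /= (path_sortedE (rev_trans leq_trans)) => /andP[].
  rewrite all_cat /= => /and3P[_ cb _] _.
  by rewrite -size_eq0 -lt0n; apply: leq_trans cb; rewrite lt0n size_eq0.
rewrite rows_cons // ins_row_index_cons cE heads_cat -cE.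
have -> : heads (c :: B) = head 0 c :: heads B by rewrite /heads /= cn.
rewrite rins_cat //=; case: c cn xc cE => // e [|f c] //= _ xe cE.
have /andP[ef pf] : (e < f) && path ltn f c.
  by have := allP sc [:: e, f & c]; rewrite cE mem_cat mem_head orbT => /(_ isT).
rewrite ltnS; apply: (IH (f :: c)) => //.
- by case: (cols) hk => //= b ? ; rewrite size_behead; lia.
- rewrite all_map; apply: sub_all sc => b; rewrite /= -drop1.
  exact: drop_sorted.
- rewrite -map_comp; have -> : map (size \o behead) cols = map predn (map size cols).
    by rewrite -map_comp; apply: eq_map => b /=; rewrite size_behead.
  apply: homo_sorted szc => i j /=; rewrite /geq /=; lia.
- by apply/mapP; exists [:: e, f & c]; rewrite // cE mem_cat mem_head orbT.
Qed.

Lemma sorted_geq_rcons s x :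
  sorted geq (rcons s x) = all (fun y => x <= y) s && sorted geq s.
Proof. by rewrite !(sorted_pairwise (rev_trans leq_trans)) pairwise_rcons. Qed.

(** A converse of [insert_on_column].  The columns of [A] are longer than [c], so by
    [ins_row_index_ge] an insertion that bumped one of their entries would end
    too low. *)
Lemma col_le_of_row_index A c x : all (sorted ltn) A -> sorted geq (map size A) ->
  all (fun a => size c < size a) A -> sorted ltn (x :: c) ->
  ins_row_index (rows (rcons A c)) x <= size c ->
  all (fun a => col_le a (x :: c)) A.
Proof.
elim: c A x => [|d c IH] A x sA szA Ac sx idx.
  apply/allP => a aA; have := allP Ac _ aA; case: a aA => //= e a aA _.
  rewrite andbT leqNgt; apply: contraL idx => xe; rewrite -ltnNge.
  rewrite -cats1 rows_cat_nils //.
  exact: leq_trans (ins_row_index_ge sA szA aA isT xe).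
have /andP[xd pc] : (x < d) && path ltn d c by [].
have hA : all (fun e => e <= x) (heads A).
  apply/allP => e /mapP[a]; rewrite mem_filter => /andP[an aA] ->.
  rewrite leqNgt; apply: contraL idx => xe; rewrite -ltnNge.
  apply: leq_trans (allP Ac _ aA) _; apply: ins_row_index_ge => //.
  - by rewrite all_rcons sA andbT /= pc.
  - by rewrite map_rcons sorted_geq_rcons szA andbT all_map; apply: sub_all Ac => b /= /ltnW.
  - by rewrite mem_rcons inE aA orbT.
have n1 : head [::] (rcons A (d :: c)) != [::].
  by case: (A) Ac => //= a A' /andP[+ _]; case: a.
move: idx; rewrite rows_cons // ins_row_index_cons -cats1 heads_cat rins_cat //.
rewrite map_cat cats1 => idx.
have /(IH (map behead A)) : sorted ltn (d :: c) by [].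
move=> H; apply/allP => a aA.
have := allP Ac _ aA; case: a aA => //= e a aA _.
apply/andP; split.
  by apply: (allP hA); apply/mapP; exists (e :: a); rewrite ?mem_filter.
suff /allP : all (fun a => col_le a (d :: c)) (map behead A).
  by apply; apply/mapP; exists (e :: a).
apply: H => //.
- rewrite all_map; apply: sub_all sA => b; rewrite /= -drop1; exact: drop_sorted.
- rewrite -map_comp; have -> : map (size \o behead) A = map predn (map size A).
    by rewrite -map_comp; apply: eq_map => b /=; rewrite size_behead.
  apply: homo_sorted szA => i j /=; rewrite /geq /=; lia.
- rewrite all_map; apply: sub_all Ac => b /=; rewrite size_behead; lia.
- by move: idx; rewrite /= -cats1.
Qed.

Lemma run_col_le A c : all (sorted ltn) A -> sorted geq (map size A) ->
  all (fun a => size c <= size a) A -> sorted ltn c ->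
  depth_sum (foldl row_insert (rows A) (rev c)) <= depth_sum (rows A) + 'C(size c, 2) ->
  all (fun a => col_le a c) A.
Proof.
elim: c => [|d c IH] sA szA Ac sc; first by move=> _; apply/allP => a _; case: a.
have sc' : sorted ltn c by apply: path_sorted sc.
have Ac' : all (fun a => size c <= size a) A by apply: sub_all Ac => a /= /ltnW.
rewrite rev_cons foldl_rcons depth_sum_insert [size _]/= bin2S => le.
have le1 := depth_sum_run (rows A) sc'.
have le2 := ins_row_index_run (rows A) sc.
have {}IH : all (fun a => col_le a c) A by apply: IH => //; lia.
have [E _] := ins_column sc' IH; rewrite E in le le1 le2.
apply: col_le_of_row_index => //; lia.
Qed.

(** Equality in [bin_sum_colword] is equality for every run and for every letter,
    and then [col_le_of_row_index] applies to each insertion. *)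
Theorem col_tab_of_depth_sum cols : all (sorted ltn) cols ->
  sorted geq (map size cols) -> depth_sum (ins (colword cols)) <= bin_sum cols ->
  col_tab cols.
Proof.
elim/last_ind: cols => [|A c IH] //.
rewrite all_rcons map_rcons colword_rcons ins_cat /bin_sum big_rcons /= -/(bin_sum A).
move=> /andP[sc sA] szc le; rewrite col_tab_rcons sc andbT.
have szA : sorted geq (map size A).
  by move: szc; rewrite sorted_geq_rcons => /andP[].
have le1 := bin_sum_colword sA; have le2 := depth_sum_run (ins (colword A)) sc.
have tA : col_tab A by apply: IH => //; lia.
rewrite tA /=; have [E1 E2] := ins_colword tA.
apply: run_col_le => //; last by rewrite -E1; lia.
by move: szc; rewrite sorted_geq_rcons all_map => /andP[].
Qed.

(** ** The columns of the tableau of a word *)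

Fixpoint col_lt (r s : seq nat) {struct s} : bool :=
  if s is y :: s' then
    if r is e :: r' then (e < y) && col_lt r' s' else false
  else true.

Fixpoint is_tab (T : tableau) : bool :=
  if T is r :: T' then [&& r != [::], col_lt r (head [::] T') & is_tab T'] else true.

Lemma col_lt_rins r s x : col_lt r s -> col_lt (rins r x).1 s.
Proof.
elim: r s => [|e r IH] [|y s] //= /andP[ey rs]; case: ltnP => xe /=.
  by rewrite (ltn_trans xe ey).
by rewrite ey IH.
Qed.

(** The letter bumped from a row enters the next row weakly to the left of its old
    column, below a smaller entry. *)
Lemma col_lt_rins2 r s x b : col_lt r s -> (rins r x).2 = [:: b] ->
  col_lt (rins r x).1 (rins s b).1.
Proof.
elim: r s => [|e r IH] s //=; case: ltnP => xe /=.
  move=> rs [<-]; case: s rs => [|y s] /=; first by rewrite xe.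
  by case/andP=> ey rs; rewrite ey /= xe.
case: s => [|y s] /=.
  move=> _; case: (rins_out r x) => [->|[b' [-> _ xb]]] // [<-].
  by rewrite (leq_ltn_trans xe xb).
case/andP=> ey rs E; have xb : x < b.
  by case: (rins_out r x) E => [->|[b' [-> _ xb]]] // [<-].
case: ltnP => h /=; first by rewrite (leq_ltn_trans xe xb) col_lt_rins.
by rewrite ey IH.
Qed.

Lemma is_tab_row_insert T x : is_tab T -> is_tab (row_insert T x).
Proof.
elim: T x => [|r T IH] x //; rewrite row_insert_cons [is_tab _]/=.
case/and3P=> rn rT tT.
have rn' : (rins r x).1 != [::] by case: (r) => //= e r' ; case: ifP.
case: (rins_out r x) => [E2|[b [E2 _ _]]]; rewrite E2 /= rn' /=.
  by rewrite col_lt_rins.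
rewrite IH // andbT.
have -> : head [::] (row_insert T b) = (rins (head [::] T) b).1.
  by case: (T) => // r' T'; rewrite row_insert_cons.
exact: col_lt_rins2.
Qed.

Lemma is_tab_ins u : is_tab (ins u).
Proof.
elim/last_ind: u => // u x IH; rewrite /ins foldl_rcons.
exact: is_tab_row_insert.
Qed.

(** Puts the entries of [r] on top of the columns, which amounts to transposing one
    row at a time; the columns must not outnumber the entries of [r]. *)
Fixpoint add_row (r : seq nat) (cols : seq (seq nat)) : seq (seq nat) :=
  if r is e :: r' then
    if cols is c :: cols' then (e :: c) :: add_row r' cols'
    else [:: e] :: add_row r' [::]
  else cols.

Definition columns (T : tableau) : seq (seq nat) := foldr add_row [::] T.

Lemma add_row_nil r : add_row r [::] = [seq [:: e] | e <- r].
Proof. by elim: r => //= e r ->. Qed.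

(** The conjunction of the facts about [columns T] that are preserved when a row
    is added on top. *)
Definition columns_spec T cols :=
  [/\ col_tab cols, rows cols = T, all (fun c => c != [::]) cols
    & map (head 0) cols = head [::] T].

Lemma columns_spec_add r T cols : sorted ltn r -> r != [::] ->
  col_lt r (head [::] T) -> columns_spec T cols ->
  columns_spec (r :: T) (add_row r cols).
Proof.
move=> sr rn rT [ctab rE cn hE]; rewrite -hE in rT.
have [hd beh] : map (head 0) (add_row r cols) = r /\
    exists k, map behead (add_row r cols) = cols ++ nseq k [::].
  elim: r cols rT {rn sr ctab rE cn hE} => [|e r IH] [|c cols] //= rT.
  - by split=> //; exists 0.
  - rewrite add_row_nil -!map_comp; split; last first.
      exists (size r).+1; congr (_ :: _); elim: (r) => //= ? ? ->.
      done.
    by congr (_ :: _); rewrite map_id_in.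
  - case/andP: rT => _ /IH[-> [k ->]]; split=> //; by exists k.
have nn : all (fun c => c != [::]) (add_row r cols).
  elim: r cols cn {rT rn sr ctab rE hE hd beh} => [|e r IH] [|c cols] //=.
    by move=> _; apply: IH.
  by case/andP=> _ /IH.
have srt : all (sorted ltn) (add_row r cols).
  case/andP: ctab => _; elim: r cols cn rT {rn sr rE hE hd beh nn} => [|e r IH] [|c cols] //=.
    by move=> *; apply: IH.
  case/andP=> cn cn' /andP[ec rT] /andP[sc sc']; rewrite IH // andbT.
  by case: c cn ec sc => //= f c _ -> ->.
have leq_cols : sorted col_le (add_row r cols).
  case/andP: ctab => + _; elim: r cols sr rT {rn rE hE hd beh nn srt cn} => [|e r IH] [|c cols] //= sr.
    move=> _ _; have := IH [::] (path_sorted sr) isT isT; case: r sr {IH} => //= f r /andP[ef _].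
    by rewrite (ltnW ef).
  case/andP=> _ rT pc; have := IH cols (path_sorted sr) rT (path_sorted pc).
  case: r sr rT {IH} => [|f r] /=; first by case: (cols).
  case/andP=> ef _ _; case: cols pc => [|d cols] /=.
    by move=> _ ->; rewrite (ltnW ef).
  by case/andP=> cd _ ->; rewrite (ltnW ef) cd.
split=> //; first by rewrite /col_tab leq_cols srt.
rewrite rows_cons; last first.
  by case: (add_row r cols) nn hd => [_ /= E|c ? /andP[]//]; move: rn; rewrite -E.
congr (_ :: _).
  by rewrite /heads (all_filterP nn).
case: beh => k ->; rewrite rows_cat_nils //.
by elim: k => //= k ->.
Qed.

Theorem columnsP T : is_tab T -> all (sorted ltn) T ->
  col_tab (columns T) /\ rows (columns T) = T.
Proof.
move=> tT sT; suff [] : columns_spec T (columns T) by [].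
elim: T tT sT => [|r T IH] //= /and3P[rn rT tT] /andP[sr sT].
by apply: columns_spec_add => //; apply: IH.
Qed.

(** Both words have the tableau [ins u]. *)
Corollary knuth_eq_columns u : uniq u -> knuth_eq u (colword (columns (ins u))).
Proof.
move=> uu; have [ct E] := columnsP (is_tab_ins u) (sorted_ins uu).
have [E1 _] := ins_colword ct; apply: ins_knuth_eq => //; last by rewrite E1 E.
rewrite (perm_uniq (flatten_ins _)) E1 E -(perm_uniq (flatten_ins u)).
exact: uu.
Qed.

(** ** The tableau of the inverse of a column word *)

(** The state of the insertion of the inverse of the column word of [cols] after
    the values up to [k], the positions in that word being counted from [o].  The
    values up to [k] occupy the top of each column of [cols], that is, the end of
    its segment of the column word, and the later a position is inserted, the
    smaller it is; so the column of the state is a final segment of the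
    positions. *)
Fixpoint inv_cols (o k : nat) (cols : seq (seq nat)) : seq (seq nat) :=
  if cols is c :: cols' then
    let p := count (fun e => e <= k) c in
    iota (o + size c - p) p :: inv_cols (o + size c) k cols'
  else [::].

Lemma inv_cols_cat o k A B :
  inv_cols o k (A ++ B) = inv_cols o k A ++ inv_cols (o + size (colword A)) k B.
Proof.
elim: A o => [|a A IH] o /=; first by rewrite addn0.
by rewrite IH /colword /= size_cat size_rev addnA.
Qed.

Lemma count_leS_notin k a : k.+1 \notin a ->
  count (fun e => e <= k.+1) a = count (fun e => e <= k) a.
Proof.
move=> ka; apply: eq_in_count => e ea; have : e != k.+1 by apply: contraNneq ka => <-.
by lia.
Qed.

Lemma inv_cols_notin o k A : k.+1 \notin colword A -> inv_cols o k.+1 A = inv_cols o k A.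
Proof.
elim: A o => [|a A IH] o //=; rewrite /colword /= mem_cat mem_rev negb_or.
by case/andP=> ka /IH ->; rewrite count_leS_notin.
Qed.

Lemma mem_inv_cols o k A b : b \in inv_cols o k A -> exists2 a, a \in A &
  size b = count (fun e => e <= k) a /\ all (fun e => e < o + size (colword A)) b.
Proof.
elim: A o => [|a A IH] o //=; rewrite inE => /predU1P[->|/IH[a' aA [sz lt]]].
  exists a; first exact: mem_head.
  rewrite size_iota; split=> //; apply/allP => e; rewrite mem_iota /colword /= size_cat size_rev.
  by have := count_size (fun e => e <= k) a; lia.
exists a'; first by rewrite inE aA orbT.
by split=> //; apply: sub_all lt => e; rewrite /colword /= size_cat size_rev addnA.
Qed.

Lemma count_index k c : sorted ltn c -> k.+1 \in c ->
  count (fun e => e <= k) c = index k.+1 c /\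
  count (fun e => e <= k.+1) c = (count (fun e => e <= k) c).+1.
Proof.
elim: c => [|e c IH] //= pc; rewrite inE eq_sym.
have ec := order_path_min ltn_trans pc.
case: (eqVneq e k.+1) => [E _|ne /= kc].
  have no m : m <= k.+1 -> count (fun f => f <= m) c = 0.
    move=> mk; apply/eqP; rewrite -leqn0 leqNgt -has_count; apply/hasPn => f fc.
    by have := allP ec f fc; rewrite /= E; lia.
  by rewrite !no // E ltnn leqnn.
have ek : e < k.+1 by apply: (allP ec).
have [-> ->] := IH (path_sorted pc) kc.
have e1 : (e <= k.+1) = true by lia.
have e2 : (e <= k) = true by lia.
by rewrite e1 e2.
Qed.

Lemma col_le_far o a c : size c <= size a -> all (fun e => e < o) a ->
  all (fun e => o <= e) c -> col_le a c.
Proof.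
elim: c a => [|y c IH] [|e a] //= sz /andP[eo ao] /andP[oy oc].
by rewrite (leq_trans (ltnW eo) oy) IH.
Qed.

(** The position of the value [k + 1] is smaller than the positions already inserted
    in its column and larger than all those of the columns on its left; and the
    tableau condition makes these columns longer.  So [insert_on_column]
    applies. *)
Lemma ins_inv_colword cols n k : col_tab cols ->
  perm_eq (colword cols) (iota 1 n) -> k <= n ->
  ins [seq (index i.+1 (colword cols)).+1 | i <- iota 0 k] = rows (inv_cols 1 k cols).
Proof.
move=> ct pe; elim: k => [|k IH] kn.
  rewrite rows_nil //; case: cols ct pe => //= c cols _ pe.
  rewrite (@eq_in_count _ _ pred0 c) ?count_pred0 // => e ec.
  have : e \in iota 1 n by rewrite -(perm_mem pe) /colword /= mem_cat mem_rev ec.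
  by rewrite mem_iota /=; lia.
rewrite -addn1 iotaD map_cat ins_cat IH ?(ltnW kn) //= add0n addn1.
have uc : uniq (colword cols) by rewrite (perm_uniq pe) iota_uniq.
have : k.+1 \in colword cols by rewrite (perm_mem pe) mem_iota; lia.
case/flattenP=> c' /mapP[c cin ->] kc; rewrite mem_rev in kc.
have [A [B cE]] : exists A B, cols = A ++ c :: B.
  by case/splitPr: cin => A B; exists A, B.
subst cols.
move: uc; rewrite colword_cat /colword [map _ (c :: B)]/= [flatten (_ :: _)]/= -/(colword A) -/(colword B).
rewrite cat_uniq cat_uniq has_cat negb_or => /and3P[_ /andP[nA _] /and3P[_ nB _]].
have kA : k.+1 \notin colword A.
  by apply: contraNN nA => kA; apply/hasP; exists k.+1; rewrite // mem_rev.
have kB : k.+1 \notin colword B.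
  by apply: contraNN nB => kB; apply/hasP; exists k.+1; rewrite // mem_rev.
have /andP[pw sc] := ct.
have scc : sorted ltn c by have := allP sc c; rewrite mem_cat mem_head orbT => /(_ isT).
have [cidx ccnt] := count_index scc kc.
move: pw; rewrite (sorted_pairwise col_le_trans) pairwise_cat => /and3P[Ac _ /= /andP[cB _]].
rewrite !inv_cols_cat /= !inv_cols_notin // ccnt.
set p := count (fun e => e <= k) c; set o := 1 + size (colword A).
have pc : p < size c by rewrite /p cidx index_mem.
have -> : (index k.+1 (colword A ++ rev c ++ colword B)).+1 = o + size c - p.+1.
  rewrite index_cat (negPf kA) index_cat mem_rev kc.
  have -> : index k.+1 (rev c) = size c - p.+1.
    rewrite -{1}(nth_index 0 kc) -cidx -/p.
    have -> : nth 0 c p = nth 0 (rev c) (size c - p.+1).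
      by rewrite nth_rev ?subnSK ?subKn ?leq_subr // ltnW.
    by rewrite index_uniq ?size_rev ?rev_uniq ?(sorted_uniq ltn_trans ltnn) //; lia.
  by rewrite /o -addnBA.
have xE : (o + size c - p.+1).+1 = o + size c - p by rewrite subnSK // ltn_addl.
have -> : iota (o + size c - p.+1) p.+1 = (o + size c - p.+1) :: iota (o + size c - p) p.
  by rewrite /= xE.
have [|||-> //] := @insert_on_column (inv_cols 1 k A) (iota (o + size c - p) p)
   (inv_cols (o + size c) k B) (o + size c - p.+1).
- have := iota_ltn_sorted (o + size c - p.+1) p.+1.
  by rewrite /= xE.
- apply/allP => b /mem_inv_cols[a aA [szb ltb]]; apply: (col_le_far _ ltb).
    rewrite szb /= size_iota.
    have := col_le_count k.+1 (allrelP Ac a c aA (mem_head _ _)); rewrite ccnt -/p.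
    rewrite count_leS_notin //; apply: contraNN kA => ka.
    by apply/flattenP; exists (rev a); rewrite ?mem_rev ?map_f.
  have ox : o <= o + size c - p.+1 by rewrite -addnBA // leq_addr.
  rewrite /= ox; apply/allP => e; rewrite mem_iota -xE => /andP[le _].
  exact: leq_trans ox (ltnW le).
- apply/allP => b /mem_inv_cols[b' bB [-> _]]; rewrite size_iota.
  by apply: col_le_count; apply: (allP cB).
Qed.

(** In the final state every column is the whole segment of its positions, which is
    determined by the lengths. *)
Theorem ins_inv_colword_shape cols1 cols2 n : col_tab cols1 -> col_tab cols2 ->
  perm_eq (colword cols1) (iota 1 n) -> perm_eq (colword cols2) (iota 1 n) ->
  map size cols1 = map size cols2 ->
  ins [seq (index i.+1 (colword cols1)).+1 | i <- iota 0 n] =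
  ins [seq (index i.+1 (colword cols2)).+1 | i <- iota 0 n].
Proof.
move=> ct1 ct2 pe1 pe2 szE; rewrite !(ins_inv_colword _ _ (leqnn n)) //; congr rows.
have H cols : perm_eq (colword cols) (iota 1 n) -> all (all (fun e => e <= n)) cols.
  move=> pe; apply/allP => c cin; apply/allP => e ec.
  have : e \in iota 1 n; last by rewrite mem_iota; lia.
  rewrite -(perm_mem pe); apply/flattenP; exists (rev c); rewrite ?mem_rev //.
  exact: map_f.
have := H _ pe2; have := H _ pe1; clear -szE.
elim: cols1 cols2 1 szE => [|c1 cols1 IH] [|c2 cols2] //= o [sz szE] /andP[h1 hs1] /andP[h2 hs2].
move: h1 h2; rewrite !all_count => /eqP-> /eqP->.
by rewrite sz (IH cols2).
Qed.

(** * Knuth transformations of permutations *)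

Section Words.
Variable n : nat.
Implicit Types (w x y z : 'S_n) (i j : 'I_n.-1) (p s u v : seq nat).

Definition word w : seq nat := [seq (w a : nat).+1 | a <- enum 'I_n].

Lemma size_word w : size (word w) = n.
Proof. by rewrite size_map size_enum_ord. Qed.

Lemma nth_word w (a : 'I_n) : nth 0 (word w) a = (w a).+1.
Proof. by rewrite (nth_map a) ?size_enum_ord // nth_ord_enum. Qed.

Lemma word_inj : injective word.
Proof.
move=> w w' E; apply/permP => a; apply: val_inj.
by have := nth_word w a; rewrite E nth_word => -[].
Qed.

Lemma uniq_word w : uniq (word w).
Proof.
rewrite map_inj_uniq ?enum_uniq // => a b [E].
by apply: (@perm_inj _ w); apply: val_inj.
Qed.

Lemma perm_word w : perm_eq (word w) (iota 1 n).
Proof.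
apply: uniq_perm; rewrite ?uniq_word ?iota_uniq //.
suff sub : {subset word w <= iota 1 n}.
  by have [] := uniq_min_size (uniq_word w) sub; rewrite ?size_iota ?size_word.
by move=> e /mapP[a _ ->]; rewrite mem_iota /= add1n ltnS ltn_ord.
Qed.

Lemma word_ex v : perm_eq v (iota 1 n) -> exists w, word w = v.
Proof.
move=> pv; have szv : size v = n by rewrite (perm_size pv) size_iota.
have uv : uniq v by rewrite (perm_uniq pv) iota_uniq.
have mv (a : 'I_n) : 0 < nth 0 v a <= n.
  have : nth 0 v a \in iota 1 n by rewrite -(perm_mem pv) mem_nth ?szv.
  by rewrite mem_iota add1n ltnS.
have lt (a : 'I_n) : (nth 0 v a).-1 < n by have := mv a; lia.
pose f a : 'I_n := Ordinal (lt a).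
have f_inj : injective f.
  move=> a b [E]; apply/val_inj/eqP; rewrite /= -(nth_uniq 0 _ _ uv) ?szv //.
  move: (mv a) (mv b) E; case: (nth 0 v a) => [|m1] //; case: (nth 0 v b) => [|m2] //= _ _ -> //.
exists (perm f_inj); apply: (@eq_from_nth _ 0); first by rewrite size_word szv.
move=> k; rewrite size_word => kn; rewrite (nth_word _ (Ordinal kn)) permE /=.
by have := mv (Ordinal kn); rewrite /=; lia.
Qed.

Lemma word_inv w :
  word w^-1%g = [seq (index k.+1 (word w)).+1 | k <- iota 0 n].
Proof.
rewrite -val_enum_ord -map_comp; apply: eq_map => a /=; congr _.+1.
have := nth_word w (w^-1%g a); rewrite permKV => <-.
by rewrite index_uniq ?uniq_word // size_word.
Qed.

Lemma rdes_word w i : rdes i w = (nth 0 (word w) i.+1 < nth 0 (word w) i).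
Proof. by rewrite (nth_word w (lo i)) (nth_word w (hi i)). Qed.

Lemma word_sr w i p a b s : word w = p ++ [:: a, b & s] -> size p = i ->
  [/\ (w (lo i)).+1 = a, (w (hi i)).+1 = b & word (sr i w) = p ++ [:: b, a & s]].
Proof.
move=> E sp; have nE k : nth 0 (word w) k = nth 0 (p ++ [:: a, b & s]) k by rewrite E.
split.
- by rewrite -nth_word nE nth_cat sp ltnn subnn.
- rewrite -nth_word nE nth_cat sp /= ltnNge leqnSn /= subSnn; done.
- have szE : size (p ++ [:: a, b & s]) = n by rewrite -E size_word.
  apply: (@eq_from_nth _ 0) => [|k]; rewrite size_word.
    by rewrite -szE !size_cat.
  move=> kn; rewrite (nth_word _ (Ordinal kn)) srE -nth_word nE srefl_val /= !nth_cat sp.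
  case: (eqVneq k i) => [->|ki]; first by rewrite ltnn ltnNge leqnSn /= subSnn subnn.
  case: (eqVneq k i.+1) => [->|ki1].
    by rewrite ltnn ltnNge leqnSn /= subSnn subnn.
  case: ltnP => // ik; have : 1 < k - i by lia.
  by case: (k - i) => [|[|m]].
Qed.

Lemma word_split w i j : j = i.+1 :> nat -> exists p s,
  size p = i /\ word w = p ++ [:: (w (lo i)).+1, (w (hi i)).+1, (w (hi j)).+1 & s].
Proof.
move=> ji; exists (take i (word w)), (drop i.+3 (word w)).
have lt1 := ltn_ord (hi j); have lt2 := ltn_ord (lo i).
split; first by rewrite size_take size_word lt2.
rewrite -{1}(cat_take_drop i (word w)); congr cat.
have e1 : lo i = i :> nat by []. have e2 : hi i = i.+1 :> nat by [].
have e3 : hi j = i.+2 :> nat by rewrite /= ji.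
rewrite -!nth_word e1 e2 e3.
have lt3 : i.+2 < n by rewrite -e3.
have lt4 : i.+1 < n by apply: ltnW.
have lt5 : i < n by apply: ltnW.
rewrite (@drop_nth _ 0 i) ?size_word // (@drop_nth _ 0 i.+1) ?size_word //.
by rewrite (@drop_nth _ 0 i.+2) ?size_word.
Qed.

Definition kstep u v := knuth1 u v \/ knuth1 v u.

(** The two Knuth relations correspond to the exchange of the first two and of the
    last two of the three positions. *)
Lemma star_knuth i j w w' : star i j w w' -> kstep (word w) (word w').
Proof.
wlog ji : i j w w' / j = i.+1 :> nat.
  move=> H st; have [adj _ _ _ _] := and5P st.
  case/orP: adj => /eqP E; first exact: (H i j).
  by case: (H j i w' w E (star_sym st)) => ?; [right|left].
case/and5P=> _ di nj ni /andP[dj' E].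
have [p [s [sp wE]]] := word_split w ji.
have loj : lo j = hi i by apply: val_inj; rewrite /= ji.
have hij : hi i != hi j by rewrite -(inj_eq val_inj) /= ji neq_ltn leqnn.
have {}nj : w (hi i) < w (hi j).
  by move: nj; rewrite /rdes loj -leqNgt ltn_neqAle (inj_eq (@ord_inj n)) (inj_eq perm_inj) hij.
have hac : w (lo i) != w (hi j) :> nat.
  rewrite (inj_eq (@ord_inj n)) (inj_eq perm_inj) -(inj_eq val_inj) /= ji.
  by rewrite neq_ltn ltnW.
move: di nj hac wE; rewrite /rdes.
move: (w (lo i)) (w (hi i)) (w (hi j)) => a b c ba bc ac wE.
case/orP: E => /eqP w'E; move: ni dj'; rewrite w'E.
- have [_ _ wE'] := word_sr wE sp; have wE2 := wE'.
  rewrite -[[:: b.+1, _ & _]]/([:: b.+1] ++ [:: a.+1, c.+1 & s]) catA in wE2.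
  have [|E1 E2 _] := @word_sr _ j _ _ _ _ wE2; first by rewrite size_cat sp addn1 ji.
  rewrite /rdes => _; case: E1 => ->; case: E2 => -> ca.
  right; exists p, s, [:: b.+1; a.+1; c.+1], [:: a.+1; b.+1; c.+1].
  by split=> //; apply: Knuth_xzy.
- have wE2 := wE.
  rewrite -[[:: a.+1, _ & _]]/([:: a.+1] ++ [:: b.+1, c.+1 & s]) catA in wE2.
  have [|_ _ wE'] := @word_sr _ j _ _ _ _ wE2; first by rewrite size_cat sp addn1 ji.
  rewrite -catA /= in wE'; have [E1 E2 _] := word_sr wE' sp.
  rewrite /rdes; case: E1 => ->; case: E2 => -> nca _; have {}ac : a < c by lia.
  right; exists p, s, [:: a.+1; c.+1; b.+1], [:: a.+1; b.+1; c.+1].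
  by split=> //; apply: Knuth_yzx.
Qed.

Lemma knuth_star w v : kstep (word w) v -> exists w', v = word w' /\
  exists i j, star i j w w'.
Proof.
have fwd w1 v1 : knuth1 (word w1) v1 -> exists w', v1 = word w' /\
    exists i j, star i j w1 w'.
  case=> p [s [a1 [a2 [kn wE vE]]]].
  have szn : size p + 3 + size s = n.
    by rewrite -(size_word w1) wE !size_cat; case: kn => *; rewrite /= addnA.
  have lti : size p < n.-1 by lia.
  have ltj : (size p).+1 < n.-1 by lia.
  pose i := Ordinal lti; pose j := Ordinal ltj.
  have loj : lo j = hi i by apply: val_inj.
  have adj : adjacent i j by rewrite /adjacent /= eqxx.
  have splitE (a b c : nat) (t : seq nat) :
      p ++ [:: a, b, c & t] = (p ++ [:: a]) ++ [:: b, c & t] by rewrite -catA.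
  have szpj a : size (p ++ [:: a]) = j by rewrite size_cat addn1.
  move: wE vE; case: kn => x y z xy yz /= wE vE.
  - have [E1 E2 _] := word_sr wE (erefl : size p = i); have wE2 := wE; rewrite splitE in wE2.
    have [E3 E4 wE3] := word_sr wE2 (szpj _).
    have wE4 := wE3; rewrite -catA /= in wE4.
    have [E5 E6 _] := word_sr wE4 (erefl : size p = i).
    exists (sr j w1); split; first by rewrite vE wE4.
    exists j, i; rewrite /star adjacent_sym adj eqxx rdes_sr /rdes.
    have h1 : w1 (hi j) < w1 (lo j) by lia.
    have h2 : (w1 (hi i) < w1 (lo i)) = false by lia.
    have h3 : sr j w1 (hi i) < sr j w1 (lo i) by lia.
    by rewrite h1 h2 h3.
  - have [E1 E2 wE3] := word_sr wE (erefl : size p = i); have wE2 := wE; rewrite splitE in wE2.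
    have [E3 E4 _] := word_sr wE2 (szpj _).
    have wE4 := wE3; rewrite splitE in wE4.
    have [E5 E6 _] := word_sr wE4 (szpj _).
    exists (sr i w1); split; first by rewrite vE wE3.
    exists j, i; rewrite /star adjacent_sym adj eqxx orbT rdes_sr /rdes.
    have h1 : w1 (hi j) < w1 (lo j) by lia.
    have h2 : (w1 (hi i) < w1 (lo i)) = false by lia.
    have h3 : (sr i w1 (hi j) < sr i w1 (lo j)) = false by lia.
    by rewrite h1 h2 h3.
case=> kn; first exact: fwd.
have [w' wE] : exists w', word w' = v.
  apply: word_ex; apply: perm_trans (knuth1_perm kn) (perm_word w).
subst v; exists w'; split=> //; have [w2 [/word_inj <- [i [j st]]]] := fwd _ _ kn.
by exists j, i; apply: star_sym.
Qed.

Definition rmove x y := [exists i, exists j, star i j x y].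

Lemma connect_rmove_sym x y : connect rmove x y = connect rmove y x.
Proof.
apply: (@sym_connect_sym _ rmove) => a b.
by apply/idP/idP => /existsP[i /existsP[j st]];
  apply/existsP; exists j; apply/existsP; exists i; apply: star_sym.
Qed.

Lemma knuth_eq_rmove u v : knuth_eq u v ->
  forall w w', word w = u -> word w' = v -> connect rmove w w'.
Proof.
elim=> {u v} [u|u v st|u v _ IH|u v t uv IH1 _ IH2] w w' wE wE'.
- by rewrite (word_inj (etrans wE (esym wE'))) connect0.
- have [w2 [E [i [j st2]]]] : exists w2, v = word w2 /\ exists i j, star i j w w2.
    by apply: knuth_star; rewrite wE; left.
  move: E; rewrite -wE' => /word_inj->; apply: connect1.
  by apply/existsP; exists i; apply/existsP; exists j.
- by rewrite connect_rmove_sym; apply: IH.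
- have [w2 wE2] : exists w2, word w2 = v.
    apply: word_ex; apply: perm_trans (perm_word w).
    by rewrite wE perm_sym knuth_eq_perm.
  exact: connect_trans (IH1 w w2 wE wE2) (IH2 w2 w' wE2 wE').
Qed.

Lemma rmove_ins x y : rmove x y -> ins (word x) = ins (word y).
Proof.
case/existsP=> i /existsP[j /star_knuth[]] kn; first exact: knuth1_ins (uniq_word _) kn.
exact/esym/(knuth1_ins (uniq_word _) kn).
Qed.

Lemma connect_rmove_ins x y : connect rmove x y -> ins (word x) = ins (word y).
Proof.
case/connectP=> p; elim: p x => [|z p IH] x /=; first by move=> _ ->.
by case/andP=> /rmove_ins-> pth E; apply: IH.
Qed.

Lemma connect_rmoveV x y : connect rmove x^-1%g y^-1%g = connect (@lmove n) x y.
Proof.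
have fwd a b : connect rmove a b -> connect (@lmove n) a^-1%g b^-1%g.
  case/connectP=> p; elim: p a => [|z p IH] a /=; first by move=> _ ->.
  case/andP=> mv pth E; apply: connect_trans (IH z pth E); apply: connect1.
  by rewrite /lmove !invgK.
have bwd a b : connect (@lmove n) a b -> connect rmove a^-1%g b^-1%g.
  case/connectP=> p; elim: p a => [|z p IH] a /=; first by move=> _ ->.
  by case/andP=> mv pth E; apply: connect_trans (IH z pth E); apply: connect1.
by apply/idP/idP => [/fwd|/bwd//]; rewrite !invgK.
Qed.

(** ** The equivalence generated by the dual Knuth transformations *)

Lemma Q_symbolE w : Q_symbol w = ins (word w^-1%g).
Proof. by []. Qed.

(** Knuth's theorem for the inverses. *)
Theorem lmove_Q_symbol x y : connect (@lmove n) x y <-> Q_symbol x = Q_symbol y.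
Proof.
rewrite -connect_rmoveV !Q_symbolE; split; first exact: connect_rmove_ins.
move=> E; apply: (@knuth_eq_rmove (word x^-1%g) (word y^-1%g)) => //.
by apply: ins_knuth_eq => //; apply: uniq_word.
Qed.

(** ** Left cells *)

(** Right descents are constant on the left cell, so that every star operation of
    the chain applies to the image of [w]; [connect_lmove_star], applied to the
    reversed operations, undoes them. *)
Lemma transport y y' w : connect rmove y y' -> left_equiv y w ->
  exists w', [/\ connect rmove w w', left_equiv y' w' &
    connect (@lmove n) y' w' -> connect (@lmove n) y w].
Proof.
case/connectP=> p; elim: p y w => [|z p IH] y w /=.
  by move=> _ -> eqv; exists w; split; rewrite ?connect0.
case/andP=> /existsP[i /existsP[j st]] pth E eqv.
have [adj di nj _ _] := and5P st.
have [z' stz] : exists z', star i j w z'.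
  by apply: star_ex; rewrite -?(left_equiv_rdes _ eqv).
have [w' [c1 c2 c3]] := IH z z' pth E (left_equiv_star eqv st stz).
exists w'; split=> // [|/c3 c4].
  apply: connect_trans c1; apply: connect1.
  by apply/existsP; exists i; apply/existsP; exists j.
by apply: connect_lmove_star c4 (star_sym st) (star_sym stz).
Qed.

(** Cutting [v] at the places where the columns end gives decreasing runs, because
    inside a column there are only descents. *)
Lemma colword_of_descents cols v : size v = size (colword cols) ->
  all (sorted ltn) cols ->
  (forall k, k.+1 < size v -> nth 0 (colword cols) k.+1 < nth 0 (colword cols) k ->
     nth 0 v k.+1 < nth 0 v k) ->
  exists cols', [/\ v = colword cols', all (sorted ltn) cols' &
    map size cols' = map size cols].
Proof.
elim: cols v => [|c cols IH] v szv /=.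
  by exists [::]; split=> //; apply/size0nil.
case/andP=> sc sc' dv.
have szc : size (colword (c :: cols)) = size c + size (colword cols).
  by rewrite /colword /= size_cat size_rev.
have nthc k : nth 0 (colword (c :: cols)) k =
    if k < size c then nth 0 (rev c) k else nth 0 (colword cols) (k - size c).
  by rewrite /colword /= nth_cat size_rev.
have [||k kv|cols' [E1 E2 E3]] := IH (drop (size c) v).
- by rewrite size_drop szv szc addKn.
- by [].
- have lt0 m : (size c + m < size c) = false by rewrite ltnNge leq_addr.
  have lt1 : ((size c + k).+1 < size c) = false by rewrite -addnS lt0.
  have := dv (size c + k); rewrite !nthc lt0 lt1 -addnS !addKn !nth_drop.
  by apply; move: kv; rewrite size_drop ltn_subRL.
exists (rev (take (size c) v) :: cols'); split.
- by rewrite /colword /= revK -/(colword cols') -E1 cat_take_drop.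
- rewrite /= E2 andbT rev_sorted; apply/(sortedP 0) => k.
  have szt : size (take (size c) v) = size c by rewrite size_takel // szv szc leq_addr.
  rewrite szt => kc; rewrite !nth_take ?(ltnW kc) //; apply: dv.
    by rewrite szv szc (leq_trans kc) ?leq_addr.
  rewrite !nthc kc (ltnW kc).
  have : sorted gtn (rev c) by rewrite rev_sorted.
  by move/(sortedP 0)/(_ k); rewrite size_rev; apply.
- by rewrite /= E3 size_rev size_takel // szv szc leq_addr.
Qed.

(** Inside a left cell, some sequence of star operations makes [y] the column
    word of its tableau; it turns [w] into a word with the same decreasing
    runs. *)
Lemma left_equiv_columns y w : left_equiv y w ->
  exists y' w' cols, [/\ word y' = colword (columns (ins (word y))),
    word w' = colword cols, ins (word w') = ins (word w),
    all (sorted ltn) cols /\ map size cols = map size (columns (ins (word y)))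
    & connect (@lmove n) y' w' -> connect (@lmove n) y w].
Proof.
move=> eqv; have kn := knuth_eq_columns (uniq_word y).
have [y' y'E] : exists y', word y' = colword (columns (ins (word y))).
  by apply: word_ex; apply: perm_trans (perm_word y); rewrite perm_sym knuth_eq_perm.
have cy := knuth_eq_rmove kn erefl y'E.
have [w' [cw eqv' back]] := transport cy eqv.
have [ct _] := columnsP (is_tab_ins (word y)) (sorted_ins (uniq_word y)).
have [|||cols [E1 E2 E3]] := @colword_of_descents (columns (ins (word y))) (word w').
- by rewrite -y'E !size_word.
- by case/andP: ct.
- move=> k; rewrite size_word => kn1; rewrite -y'E.
  have ltk : k < n.-1 by lia.
  have := left_equiv_rdes (Ordinal ltk) eqv'; rewrite !rdes_word /= => ->.
  by [].
exists y', w', cols; split=> //.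
exact/esym/connect_rmove_ins.
Qed.

(** The decreasing runs of [w'] have the lengths of the columns for [y], for which
    [bin_sum_colword] is an equality. *)
Lemma left_equiv_depth_sum y w : left_equiv y w ->
  depth_sum (ins (word y)) <= depth_sum (ins (word w)).
Proof.
case/left_equiv_columns=> y' [w' [cols [_ E2 <- [sc szE] _]]].
have [ct Er] := columnsP (is_tab_ins (word y)) (sorted_ins (uniq_word y)).
have [_ dE] := ins_colword ct; rewrite -{1}Er dE.
have -> : bin_sum (columns (ins (word y))) = bin_sum cols.
  rewrite /bin_sum -(big_map size xpredT (fun m => 'C(m, 2))) -szE.
  by rewrite (big_map size xpredT (fun m => 'C(m, 2))).
by rewrite E2 bin_sum_colword.
Qed.

(** By symmetry [left_equiv_depth_sum] is an equality, so the runs of [w'] are the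
    columns of a tableau with the column lengths of the tableau of [y]. *)
Theorem left_equiv_lmove y w : left_equiv y w -> connect (@lmove n) y w.
Proof.
move=> eqv; have [y' [w' [cols [E1 E2 E3 [sc szE] back]]]] := left_equiv_columns eqv.
apply: back; apply/lmove_Q_symbol.
have [ct Er] := columnsP (is_tab_ins (word y)) (sorted_ins (uniq_word y)).
have szg : sorted geq (map size cols).
  rewrite szE; case/andP: ct => + _; apply: homo_sorted => a c.
  exact: col_le_size.
have ctc : col_tab cols.
  apply: col_tab_of_depth_sum => //; rewrite -E2 E3.
  have [_ dE] := ins_colword ct; rewrite Er in dE.
  have -> : bin_sum cols = bin_sum (columns (ins (word y))).
    rewrite /bin_sum -(big_map size xpredT (fun m => 'C(m, 2))) szE.
    by rewrite (big_map size xpredT (fun m => 'C(m, 2))).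
  by rewrite -dE; apply: left_equiv_depth_sum; apply: left_equiv_sym.
rewrite !Q_symbolE !word_inv E1 E2; apply: ins_inv_colword_shape => //.
- by rewrite -E1 perm_word.
- by rewrite -E2 perm_word.
Qed.

End Words.

Theorem theoremA (n : nat) (hn : (1 <= n)%N) (y w : 'S_n) :
  left_equiv y w <-> Q_symbol y = Q_symbol w.
Proof.
rewrite -lmove_Q_symbol; split; first exact: left_equiv_lmove.
exact: connect_lmove_equiv.
Qed.
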